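(* Assume $\widehat H_A\propto\mathbb 1_A$ and $|A'|=|A|$. For every tele-covariant bipartite channel $\mathcal N\in\mathrm{Ch}(A'B',AB)$, \[ \mathrm{Dist}^{(\infty,0)}(\mathcal N,\mathcal R^\pi)=\mathrm{Cost}^{(\infty,0)}(\mathcal N,\mathcal R^\pi)=\tfrac12\big(\log|A|-S[A|B]_{\mathcal N}\big)=\tfrac12\big[\log(|A'||A|)-S(R_AA|R_BB)_{\Phi^{\mathcal N}}\big]. \]
   Context: All systems are finite-dimensional; $|X|$ is the dimension; $\log$ base 2; $\mathrm{St}(X)$ density operators; $\mathrm{Ch}(X',X)$ quantum channels. For an $m$-dimensional system $C$ ($|C'|=|C|=m$), $\mathrm{id}_m$ is the identity channel $C'\to C$ and $\mathcal R^\pi_m(X):=\operatorname{tr}(X)\mathbb 1_C/m$; $\mathcal R^\pi_{A'\to A}(X):=\operatorname{tr}(X)\mathbb 1_A/|A|$; $\mathcal R^{\mathbb 1}_{A'\to A}(X):=\operatorname{tr}(X)\mathbb 1_A$. A superchannel $\Theta$ from $\mathrm{Ch}(X',X)$ to $\mathrm{Ch}(Y',Y)$ acts as $\Theta(\mathcal M)=\mathcal Q_{EX\to Y}\circ(\mathrm{id}_E\otimes\mathcal M)\circ\mathcal P_{Y'\to EX'}$ for channels $\mathcal P,\mathcal Q$. Purified distance of channels: $P[\mathcal M_1,\mathcal M_2]:=\sup_{\rho\in\mathrm{St}(RX')}\sqrt{1-F((\mathrm{id}\otimes\mathcal M_1)(\rho),(\mathrm{id}\otimes\mathcal M_2)(\rho))}$,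 $F(\rho,\sigma)=\|\sqrt\rho\sqrt\sigma\|_1^2$. For $\mathcal N\in\mathrm{Ch}(A'B',AB)$ and free channel $\mathcal F_{A'\to A}$: $\mathrm{Dist}^{(1,\varepsilon)}(\mathcal N,\mathcal F):=\inf_{\mathcal Q\in\mathrm{Ch}(B',B)}\sup\{\log m:$ there exist $C',C$ with $|C'|=|C|=m$, systems $D',D$, $\mathcal Q'\in\mathrm{Ch}(D',D)$ and a superchannel $\Theta$ from $\mathrm{Ch}(A'B',AB)$ to $\mathrm{Ch}(C'D',CD)$ with $\Theta(\mathcal F\otimes\mathcal Q)=\mathcal R^\pi_m\otimes\mathcal Q'$ and $P[\mathrm{id}_m\otimes\mathcal Q',\Theta(\mathcal N)]\le\varepsilon\}$; $\mathrm{Cost}^{(1,\varepsilon)}(\mathcal N,\mathcal F):=\inf_{\mathcal Q\in\mathrm{Ch}(B',B)}\inf\{\log m:$ there exist $C',C$ with $|C'|=|C|=m$, systems $D',D$, $\mathcal Q'\in\mathrm{Ch}(D',D)$ and a superchannel $\Theta$ from $\mathrm{Ch}(C'D',CD)$ to $\mathrm{Ch}(A'B',AB)$ with $\Theta(\mathcal R^\pi_m\otimes\mathcal Q')=\mathcal F\otimes\mathcal Q$ and $P[\mathcal N,\Theta(\mathrm{id}_m\otimes\mathcal Q')]\le\varepsilon\}$. Capacities: $\mathrm{Dist}^{(\infty,0)}(\mathcal N,\mathcal R^\pi):=\lim_{\varepsilon\to0^+}\lim_{n\to\infty}\frac1n\mathrm{Dist}^{(1,\varepsilon)}(\mathcal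 N^{\otimes n},\mathcal R^\pi_{A'^n\to A^n})$ and $\mathrm{Cost}^{(\infty,0)}(\mathcal N,\mathcal R^\pi):=\lim_{\varepsilon\to0^+}\lim_{n\to\infty}\frac1n\mathrm{Cost}^{(1,\varepsilon)}(\mathcal N^{\otimes n},\mathcal R^\pi_{A'^n\to A^n})$, with $\mathcal N^{\otimes n}$ regarded as a bipartite channel $A'^nB'^n\to A^nB^n$. Choi state: $\Phi^{\mathcal N}_{R_AAR_BB}:=(\mathrm{id}\otimes\mathcal N)(\Phi_{R_AA'}\otimes\Phi_{R_BB'})$, $\Phi_{RX}:=\frac1{|X|}\sum_{i,j}|ii\rangle\langle jj|$; $S(X|Y)_\rho:=S(XY)_\rho-S(Y)_\rho$. Channel relative entropy $D[\mathcal M\|\mathcal M']:=\sup_\rho D((\mathrm{id}\otimes\mathcal M)(\rho)\|(\mathrm{id}\otimes\mathcal M')(\rho))$, with $D(\rho\|\sigma)=\operatorname{tr}\rho(\log\rho-\log\sigma)$; $S[A|B]_{\mathcal N}:=-\inf_{\mathcal Q\in\mathrm{Ch}(B',B)}D[\mathcal N\|\mathcal R^{\mathbb 1}_{A'\to A}\otimes\mathcal Q]$. Tele-covariance: there are finite groups $G,H$ and unitary representations $U^{(g)}$ on $A'$, $V^{(h)}$ on $B'$, $W^{(g,h)}$ on $A$, $Z^{(g,h)}$ on $B$ with $\mathcal N((U^{(g)}\otimes V^{(h)})\rho(U^{(g)}\otimes V^{(h)})^\dagger)=(W^{(g,h)}\otimes Z^{(g,h)})\mathcal N(\rho)(W^{(g,h)}\otimes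 Z^{(g,h)})^\dagger$ for all $\rho,g,h$, and $\frac1{|G|}\sum_gU^{(g)}\rho U^{(g)\dagger}=\mathbb 1_{A'}/|A'|$, $\frac1{|H|}\sum_hV^{(h)}\sigma V^{(h)\dagger}=\mathbb 1_{B'}/|B'|$ for all states $\rho$ on $A'$, $\sigma$ on $B'$. *)

(* Defs.v *)
(* MathComp 2.5 + MathComp-Analysis 1.16, scalars R[i] for R : realType. *)
From HB Require Import structures.
From mathcomp Require Import all_boot all_order all_algebra all_fingroup.
From mathcomp Require Import complex.
From mathcomp Require Import all_classical all_reals all_analysis.

Set Implicit Arguments.
Unset Strict Implicit.
Unset Printing Implicit Defensive.

Import Order.TTheory GRing.Theory Num.Theory.
Local Open Scope ring_scope.
Local Open Scope sesquilinear_scope.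

(* Conventions.  A (finite-dimensional quantum) system is a nonempty finite
   type T; its Hilbert space is C^T with C = R[i] the complex numbers over a
   real field R : realType, and |T| = #|T|.  Operators on T are the square
   matrices  op R T := 'M[R[i]]_#|T|,  whose rows/columns are indexed through
   enum_rank.  The composite system XY is the product type (X * Y)%type.
   An m-dimensional system is 'I_m. *)

Section Quantum.
Variable R : realType.
Local Notation C := (R[i]).

Definition op (T : finType) := 'M[C]_#|T|.
Arguments op T%_type.

(* matrix entry <s|X|t> *)
Definition ent (T : finType) (X : op T) (s t : T) : C :=
  X (enum_rank s) (enum_rank t).

(* operator with prescribed entries *)
Definition mkop (T : finType) (f : T -> T -> C) : op T :=
  \matrix_(i, j) f (enum_val i) (enum_val j).

(* matrix unit |s><t| *)
Definition munit (T : finType) (s t : T) : op T :=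
  mkop (fun x y => ((x == s) && (y == t))%:R).

(* Kronecker (tensor) product of operators *)
Definition tens (T U : finType) (X : op T) (Y : op U) : op (T * U) :=
  mkop (fun p q => ent X p.1 q.1 * ent Y p.2 q.2).

(* tensor product of (linear) maps, defined by linear extension on matrix units *)
Definition tensmap (T1 T2 U1 U2 : finType)
    (F1 : op T1 -> op U1) (F2 : op T2 -> op U2) : op (T1 * T2) -> op (U1 * U2) :=
  fun X => \sum_(p : T1 * T2) \sum_(q : T1 * T2)
            ent X p q *: tens (F1 (munit p.1 q.1)) (F2 (munit p.2 q.2)).

(* positive semidefinite operators and density operators St(T) *)
Definition psd (T : finType) (X : op T) : Prop :=
  X \is hermsymmx /\ forall v : 'rV[C]_#|T|, 0 <= (v *m X *m v ^t*) 0 0.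

Definition state (T : finType) (X : op T) : Prop := psd X /\ \tr X = 1.

(* quantum channels Ch(T, U): linear, trace preserving, completely positive *)
Definition is_channel (T U : finType) (F : op T -> op U) : Prop :=
  [/\ forall (a : C) (X Y : op T), F (a *: X + Y) = a *: F X + F Y,
      forall X : op T, \tr (F X) = \tr X
    & forall (k : nat) (X : op ('I_k * T)),
        psd X -> psd (tensmap (@idfun (op 'I_k)) F X)].

(* identity channel id_m on an m-dimensional system, and replacement channels *)
Definition idm (m : nat) : op 'I_m -> op 'I_m := idfun.
Definition rep_pi (T U : finType) : op T -> op U :=
  fun X => (\tr X / #|U|%:R) *: 1%:M.
Definition rep_one (T U : finType) : op T -> op U :=
  fun X => \tr X *: 1%:M.

(* functional calculus for Hermitian operators, via the spectral decomposition
   X = P^-1 diag(sp) P with P unitary (P^-1 = P^t* ) *)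
Definition mxfun (T : finType) (f : R -> R) (X : op T) : op T :=
  let P := spectralmx X in
  P ^t* *m diag_mx (map_mx (fun z : C => real_complex R (f (@complex.Re R z)))
                          (spectral_diag X)) *m P.

Definition log2 (x : R) : R := ln x / ln 2.

Definition sqrtm (T : finType) (X : op T) : op T := mxfun (@Num.sqrt R) X.

(* logarithm (base 2) on the support, with the convention log 0 = 0 on the kernel *)
Definition logm (T : finType) (X : op T) : op T :=
  mxfun (fun x => if 0 < x then log2 x else 0) X.

(* trace norm and fidelity F(rho,sigma) = ||sqrt rho sqrt sigma||_1^2 *)
Definition trnorm (T : finType) (X : op T) : R :=
  @complex.Re R (\tr (sqrtm (X ^t* *m X))).

Definition fid (T : finType) (rho sigma : op T) : R :=
  trnorm (sqrtm rho *m sqrtm sigma) ^+ 2.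

(* purified distance of channels *)
Definition pdist (T U : finType) (M1 M2 : op T -> op U) : \bar R :=
  ereal_sup [set x | exists (r : nat) (rho : op ('I_r * T)),
    [/\ (0 < r)%N, state rho &
        x = (Num.sqrt (1 - fid (tensmap (@idfun (op 'I_r)) M1 rho)
                               (tensmap (@idfun (op 'I_r)) M2 rho)))%:E]].

(* Umegaki relative entropy D(rho||sigma) = tr rho (log rho - log sigma),
   +oo unless supp rho is contained in supp sigma *)
Definition relent (T : finType) (rho sigma : op T) : \bar R :=
  if (kermx sigma <= kermx rho)%MS
  then (@complex.Re R (\tr (rho *m (logm rho - logm sigma))))%:E
  else +oo%E.

(* channel relative entropy *)
Definition chrelent (T U : finType) (M1 M2 : op T -> op U) : \bar R :=
  ereal_sup [set x | exists (r : nat) (rho : op ('I_r * T)),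
    [/\ (0 < r)%N, state rho &
        x = relent (tensmap (@idfun (op 'I_r)) M1 rho)
                   (tensmap (@idfun (op 'I_r)) M2 rho)]].

(* S[A|B]_N := - inf_{Q in Ch(B',B)} D[N || R^1_{A'->A} (x) Q] *)
Definition condent_ch (A' B' A B : finType) (N : op (A' * B') -> op (A * B))
  : \bar R :=
  (- ereal_inf [set x | exists Q : op B' -> op B,
        is_channel Q /\ x = chrelent N (tensmap (@rep_one A' A) Q)])%E.

(* von Neumann entropy (base 2), partial trace, conditional entropy *)
Definition vN (T : finType) (rho : op T) : R :=
  - @complex.Re R (\tr (rho *m logm rho)).

Definition ptr1 (T U : finType) (X : op (T * U)) : op U :=
  mkop (fun u u' => \sum_(t : T) ent X (t, u) (t, u')).

(* S(X|Y)_rho = S(XY) - S(Y) for rho on XY *)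
Definition condent_st (T U : finType) (rho : op (T * U)) : R :=
  vN rho - vN (ptr1 rho).

(* Choi state Phi^N on R_A A R_B B (R_A a copy of A', R_B a copy of B'):
   (id (x) N)(Phi_{R_A A'} (x) Phi_{R_B B'}), reordered as R_A A R_B B *)
Definition choi (A' B' A B : finType) (N : op (A' * B') -> op (A * B))
  : op ((A' * A) * (B' * B)) :=
  mkop (fun p q => ((#|A'| * #|B'|)%:R)^-1 *
     ent (N (munit (p.1.1, p.2.1) (q.1.1, q.2.1))) (p.1.2, p.2.2) (q.1.2, q.2.2)).

(* superchannel Theta(M) = Q o (id_E (x) M) o P, E = 'I_e *)
Definition supapp (Y' X' X Y : finType) (e : nat)
    (P : op Y' -> op ('I_e * X')) (Q : op ('I_e * X) -> op Y)
    (M : op X' -> op X) : op Y' -> op Y :=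
  fun Z => Q (tensmap (@idfun (op 'I_e)) M (P Z)).

Definition is_superchannel (Y' X' X Y : finType) (e : nat)
    (P : op Y' -> op ('I_e * X')) (Q : op ('I_e * X) -> op Y) : Prop :=
  [/\ (0 < e)%N, is_channel P & is_channel Q].

(* one-shot distillable resource Dist^{(1,eps)}(N, F) *)
Definition dist1 (A' B' A B : finType) (eps : R)
    (N : op (A' * B') -> op (A * B)) (F : op A' -> op A) : \bar R :=
  ereal_inf [set y | exists Q : op B' -> op B, is_channel Q /\
    y = ereal_sup [set x | exists (m d' d e : nat)
          (Q' : op 'I_d' -> op 'I_d)
          (P : op ('I_m * 'I_d') -> op ('I_e * (A' * B')))
          (Qs : op ('I_e * (A * B)) -> op ('I_m * 'I_d)),
        [/\ [/\ (0 < m)%N, (0 < d')%N, (0 < d)%N & is_channel Q'],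
            is_superchannel P Qs,
            supapp P Qs (tensmap F Q) =1 tensmap (@rep_pi 'I_m 'I_m) Q',
            (pdist (tensmap (@idm m) Q') (supapp P Qs N) <= eps%:E)%E
          & x = (log2 m%:R)%:E]]].

(* one-shot resource cost Cost^{(1,eps)}(N, F) *)
Definition cost1 (A' B' A B : finType) (eps : R)
    (N : op (A' * B') -> op (A * B)) (F : op A' -> op A) : \bar R :=
  ereal_inf [set y | exists Q : op B' -> op B, is_channel Q /\
    y = ereal_inf [set x | exists (m d' d e : nat)
          (Q' : op 'I_d' -> op 'I_d)
          (P : op (A' * B') -> op ('I_e * ('I_m * 'I_d')))
          (Qs : op ('I_e * ('I_m * 'I_d)) -> op (A * B)),
        [/\ [/\ (0 < m)%N, (0 < d')%N, (0 < d)%N & is_channel Q'],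
            is_superchannel P Qs,
            supapp P Qs (tensmap (@rep_pi 'I_m 'I_m) Q') =1 tensmap F Q,
            (pdist N (supapp P Qs (tensmap (@idm m) Q')) <= eps%:E)%E
          & x = (log2 m%:R)%:E]]].

(* n-fold tensor power N^{(x)n}, regarded as a bipartite channel
   A'^n B'^n -> A^n B^n (A'^n = {ffun 'I_n -> A'} etc.) *)
Definition tpow (A' B' A B : finType) (n : nat) (N : op (A' * B') -> op (A * B))
  : op ({ffun 'I_n -> A'} * {ffun 'I_n -> B'}) ->
    op ({ffun 'I_n -> A} * {ffun 'I_n -> B}) :=
  fun X => \sum_(p : {ffun 'I_n -> A'} * {ffun 'I_n -> B'})
            \sum_(q : {ffun 'I_n -> A'} * {ffun 'I_n -> B'}) ent X p q *:
    mkop (fun x y : {ffun 'I_n -> A} * {ffun 'I_n -> B} => \prod_(k < n)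
       ent (N (munit (p.1 k, p.2 k) (q.1 k, q.2 k))) (x.1 k, x.2 k) (y.1 k, y.2 k)).

Arguments tpow {A' B' A B} n N.

(* lim_{eps -> 0+} lim_{n -> oo} f eps n = v  (both limits exist, in \bar R) *)
Definition iterlim (f : R -> nat -> \bar R) (v : \bar R) : Prop :=
  exists L : R -> \bar R,
    (\forall eps \near (0 : R)^'+, f eps @ \oo --> L eps)%classic /\
    (L eps @[eps --> (0 : R)^'+] --> v)%classic.

Definition dist_seq (A' B' A B : finType) (N : op (A' * B') -> op (A * B))
  : R -> nat -> \bar R :=
  fun eps n => (((n%:R : R)^-1)%:E *
     dist1 eps (tpow n N) (@rep_pi {ffun 'I_n -> A'} {ffun 'I_n -> A}))%E.

Definition cost_seq (A' B' A B : finType) (N : op (A' * B') -> op (A * B))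
  : R -> nat -> \bar R :=
  fun eps n => (((n%:R : R)^-1)%:E *
     cost1 eps (tpow n N) (@rep_pi {ffun 'I_n -> A'} {ffun 'I_n -> A}))%E.

(* unitary representations of a finite group, and of a product of two groups *)
Definition unitary_rep (gT : finGroupType) (T : finType) (U : gT -> op T) : Prop :=
  [/\ U 1%g = 1%:M,
      forall g g' : gT, U (g * g')%g = U g *m U g'
    & forall g, U g \is unitarymx].

Definition unitary_rep2 (gT hT : finGroupType) (T : finType)
    (W : gT -> hT -> op T) : Prop :=
  [/\ W 1%g 1%g = 1%:M,
      forall (g g' : gT) (h h' : hT), W (g * g')%g (h * h')%g = W g h *m W g' h'
    & forall g h, W g h \is unitarymx].

(* tele-covariance of a bipartite channel *)
Definition tele_covariant (A' B' A B : finType) (N : op (A' * B') -> op (A * B))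
  : Prop :=
  exists (gT hT : finGroupType) (U : gT -> op A') (V : hT -> op B')
         (W : gT -> hT -> op A) (Z : gT -> hT -> op B),
  [/\ [/\ unitary_rep U, unitary_rep V, unitary_rep2 W & unitary_rep2 Z],
      forall (g : gT) (h : hT) (rho : op (A' * B')),
        N (tens (U g) (V h) *m rho *m (tens (U g) (V h)) ^t*)
        = tens (W g h) (Z g h) *m N rho *m (tens (W g h) (Z g h)) ^t*,
      forall rho : op A', state rho ->
        (#|gT|%:R)^-1 *: \sum_(g : gT) (U g *m rho *m (U g) ^t*)
        = (#|A'|%:R)^-1 *: 1%:M
    & forall sigma : op B', state sigma ->
        (#|hT|%:R)^-1 *: \sum_(h : hT) (V h *m sigma *m (V h) ^t*)
        = (#|B'|%:R)^-1 *: 1%:M].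

End Quantum.

Arguments op R T%_type.

(* Main.v *)
Require Import Defs.
From HB Require Import structures.
From mathcomp Require Import all_boot all_order all_algebra all_fingroup.
From mathcomp Require Import complex.
From mathcomp Require Import all_classical all_reals all_analysis.
From mathcomp Require Import ring lra.
Set Implicit Arguments.
Unset Strict Implicit.
Unset Printing Implicit Defensive.
Import Order.TTheory GRing.Theory Num.Theory.
Local Open Scope ring_scope.
Local Open Scope sesquilinear_scope.

(* Write Phi for the Choi state of N on X Y, X = R_A A, Y = R_B B, and
   D = log |A'||A| - S(X|Y), which is D(Phi || pi_X (x) Phi_Y); every rate
   equals D / 2.
   Phi_Y is the Choi state of the B-marginal Q1 of N, and averaging over the
   covariance group turns any experiment that distinguishes N^n from
   (R (x) Q1)^n into a test between Phi^n and (pi_X (x) Phi_Y)^n.  Two facts on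
   such tests suffice.
   - Smoothing: Phi^n is close to an operator below 2^(n(D+delta)) times
     (pi_X (x) Phi_Y)^n.  This bounds Dist from above (strong converse) and,
     the operator being the Choi state of a map, it bounds Cost from above.
   - A universal test: some test accepts Phi^n but accepts pi_X^n (x) omega
     with probability at most 2^(-n(D-delta)) for all omega at once.  Used as
     a measurement it distils id_m with m^2 = 2^(n(D-delta)) whatever the free
     channel is; it also bounds Cost from below because id_m <= m^2 R_m in the
     completely positive order.
   The same two facts give data processing and the minimality of Q1 in
   S[A|B]_N = S(X|Y) - log |A'|. *)

(** The place of the free channel Q decides which fact is used where. Both one-shot quantities are
    infima over Q, so an upper bound may choose Q as a power of Q1, while a lower bound must hold
    for every Q on n copies, correlated ones included: hence a single test that serves all of them.
    N may signal from A' to B; Q1 is its B-marginal for the maximally mixed input on A', the choice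
    for which Phi_Y is a Choi state and covariance is inherited. The free channel has to be
    converted exactly. Every superchannel built here measures and then applies one of two channels,
    the second chosen so that the mixture at acceptance probability m^-2 is exactly the required
    free channel. This m^-2 is the overlap of a maximally entangled state with the maximally mixed
    state in dimension m^2, the source of the factor 1/2. Distances enter only through acceptance
    probabilities: one inequality in each direction between fidelity and tests replaces all
    computations of fidelities. The bounds hold at every error in ]0,1[, so the inner limit is
    already independent of eps. *)

(* The matrix operations are restated in locked form, with systems instead of
   dimensions as arguments: unfolding the library ones over R[i] makes
   unification prohibitively slow. *)
Definition rop (R : realType) (T U : finType) := 'M[R[i]]_(#|T|, #|U|).
Arguments rop R T%_type U%_type.

HB.lock Definition mk (R : realType) (T U : finType) (f : T -> U -> R[i]) :
  rop R T U := \matrix_(i, j) f (enum_val i) (enum_val j).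

HB.lock Definition dg (R : realType) (T : finType) (f : T -> R[i]) : rop R T T :=
  mk (fun s t => f s *+ (s == t)).

HB.lock Definition mm (R : realType) (T U V : finType)
  (X : rop R T U) (Y : rop R U V) : rop R T V := X *m Y.

HB.lock Definition adj (R : realType) (T U : finType) (X : rop R T U) : rop R U T :=
  X ^t*.

HB.lock Definition idt (R : realType) (T : finType) : rop R T T := 1%:M.

HB.lock Definition ctr (R : realType) (T : finType) (X : rop R T T) : R[i] := \tr X.

HB.lock Definition en (R : realType) (T U : finType) (X : rop R T U) (s : T) (t : U)
  : R[i] := X (enum_rank s) (enum_rank t).

Arguments idt {R T}.
Notation "X ** Y" := (mm X Y) (at level 40, left associativity).
Notation "X ^†" := (adj X) (at level 30).
Notation Id := idt.

(** * Matrix entries, the positive semidefinite order and functional calculus *)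

Section Entries.
Variable R : realType.
Local Notation C := (R[i]).
Local Notation rop := (rop R).
Implicit Types T U V W : finType.

Lemma en_mk T U (f : T -> U -> C) s t : en (mk f) s t = f s t.
Proof. by rewrite mk.unlock en.unlock mxE !enum_rankK. Qed.

Lemma entE T (X : op R T) s t : ent X s t = en X s t.
Proof. by rewrite en.unlock. Qed.

Lemma mkopE T (f : T -> T -> C) : mkop f = mk f.
Proof. by rewrite mk.unlock. Qed.

Lemma en_inj T U (X Y : rop T U) : (forall s t, en X s t = en Y s t) -> X = Y.
Proof.
by move=> h; apply/matrixP=> i j; move: (h (enum_val i) (enum_val j));
   rewrite en.unlock !enum_valK.
Qed.

Lemma sum_ord T (F : 'I_#|T| -> C) : \sum_j F j = \sum_t F (enum_rank t).
Proof.
rewrite (reindex (@enum_rank T)) //=.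
by exists enum_val => x _; rewrite ?enum_rankK ?enum_valK.
Qed.

Lemma enM T U V (X : rop T U) (Y : rop U V) s t :
  en (X ** Y) s t = \sum_u en X s u * en Y u t.
Proof. by rewrite mm.unlock en.unlock mxE sum_ord. Qed.

Lemma enA T U (X : rop T U) s t : en (X ^†) s t = (en X t s)^*.
Proof. by rewrite adj.unlock en.unlock !mxE. Qed.

Lemma enD T U (X Y : rop T U) s t : en (X + Y) s t = en X s t + en Y s t.
Proof. by rewrite en.unlock !mxE. Qed.

Lemma enN T U (X : rop T U) s t : en (- X) s t = - en X s t.
Proof. by rewrite en.unlock !mxE. Qed.

Lemma enB T U (X Y : rop T U) s t : en (X - Y) s t = en X s t - en Y s t.
Proof. by rewrite enD enN. Qed.

Lemma enZ T U (a : C) (X : rop T U) s t : en (a *: X) s t = a * en X s t.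
Proof. by rewrite en.unlock !mxE. Qed.

Lemma en0 T U s t : en (0 : rop T U) s t = 0.
Proof. by rewrite en.unlock !mxE. Qed.

Lemma en1 T s t : en (Id : rop T T) s t = (s == t)%:R.
Proof. by rewrite idt.unlock en.unlock !mxE (inj_eq enum_rank_inj). Qed.

Lemma en_sum T U I (r : seq I) (P : pred I) (F : I -> rop T U) s t :
  en (\sum_(i <- r | P i) F i) s t = \sum_(i <- r | P i) en (F i) s t.
Proof. by rewrite en.unlock summxE. Qed.

Lemma tr_en T (X : rop T T) : ctr X = \sum_t en X t t.
Proof. by rewrite ctr.unlock en.unlock /mxtrace sum_ord. Qed.

Lemma trE T (X : op R T) : \tr X = ctr X.
Proof. by rewrite ctr.unlock. Qed.

Lemma mmE T U V (X : rop T U) (Y : rop U V) : X *m Y = X ** Y.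
Proof. by rewrite mm.unlock. Qed.

Lemma adjmxE T U (X : rop T U) : X ^t* = X ^†.
Proof. by rewrite adj.unlock. Qed.

Lemma idtE T : 1%:M = Id :> rop T T.
Proof. by rewrite idt.unlock. Qed.

Lemma mmA T U V W (X : rop T U) (Y : rop U V) (Z : rop V W) :
  X ** (Y ** Z) = X ** Y ** Z.
Proof. by rewrite mm.unlock mulmxA. Qed.

Lemma mm1 T U (X : rop T U) : X ** Id = X.
Proof. by rewrite mm.unlock idt.unlock mulmx1. Qed.

Lemma mm1l T U (X : rop T U) : Id ** X = X.
Proof. by rewrite mm.unlock idt.unlock mul1mx. Qed.

Lemma mm0 T U V (X : rop T U) : X ** (0 : rop U V) = 0.
Proof. by rewrite mm.unlock mulmx0. Qed.

Lemma mm0l T U V (X : rop U V) : (0 : rop T U) ** X = 0.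
Proof. by rewrite mm.unlock mul0mx. Qed.

Lemma mmDl T U V (X Y : rop T U) (Z : rop U V) : (X + Y) ** Z = X ** Z + Y ** Z.
Proof. by rewrite mm.unlock mulmxDl. Qed.

Lemma mmDr T U V (Z : rop T U) (X Y : rop U V) : Z ** (X + Y) = Z ** X + Z ** Y.
Proof. by rewrite mm.unlock mulmxDr. Qed.

Lemma mmBl T U V (X Y : rop T U) (Z : rop U V) : (X - Y) ** Z = X ** Z - Y ** Z.
Proof. by rewrite mm.unlock mulmxBl. Qed.

Lemma mmBr T U V (Z : rop T U) (X Y : rop U V) : Z ** (X - Y) = Z ** X - Z ** Y.
Proof. by rewrite mm.unlock mulmxBr. Qed.

Lemma mmZl T U V a (X : rop T U) (Y : rop U V) : (a *: X) ** Y = a *: (X ** Y).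
Proof. by rewrite mm.unlock scalemxAl. Qed.

Lemma mmZr T U V a (X : rop T U) (Y : rop U V) : X ** (a *: Y) = a *: (X ** Y).
Proof. by rewrite mm.unlock scalemxAr. Qed.

Lemma mm_suml T U V I (r : seq I) (P : pred I) (F : I -> rop T U) (Y : rop U V) :
  (\sum_(i <- r | P i) F i) ** Y = \sum_(i <- r | P i) F i ** Y.
Proof. by elim/big_rec2: _ => [|i x y _ <-]; rewrite ?mm0l ?mmDl. Qed.

Lemma mm_sumr T U V I (r : seq I) (P : pred I) (X : rop T U) (F : I -> rop U V) :
  X ** (\sum_(i <- r | P i) F i) = \sum_(i <- r | P i) X ** F i.
Proof. by elim/big_rec2: _ => [|i x y _ <-]; rewrite ?mm0 ?mmDr. Qed.

Lemma adjM T U V (X : rop T U) (Y : rop U V) : (X ** Y) ^† = Y ^† ** X ^†.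
Proof. by rewrite adj.unlock mm.unlock trmx_mul map_mxM. Qed.

Lemma adjK T U (X : rop T U) : X ^† ^† = X.
Proof. by rewrite adj.unlock trmxCK. Qed.

Lemma adjD T U (X Y : rop T U) : (X + Y) ^† = X ^† + Y ^†.
Proof. by apply: en_inj => s t; rewrite !(enA, enD) rmorphD. Qed.

Lemma adjN T U (X : rop T U) : (- X) ^† = - X ^†.
Proof. by apply: en_inj => s t; rewrite !(enA, enN) rmorphN. Qed.

Lemma adjB T U (X Y : rop T U) : (X - Y) ^† = X ^† - Y ^†.
Proof. by rewrite adjD adjN. Qed.

Lemma adjZ T U a (X : rop T U) : (a *: X) ^† = a^* *: X ^†.
Proof. by apply: en_inj => s t; rewrite !(enA, enZ) rmorphM. Qed.

Lemma adj1 T : (Id : rop T T) ^† = Id.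
Proof. by apply: en_inj => s t; rewrite !(enA, en1) conjC_nat eq_sym. Qed.

Lemma adj0 T U : (0 : rop T U) ^† = 0.
Proof. by apply: en_inj => s t; rewrite !(enA, en0) conjC0. Qed.

Definition adjE := (adjM, adjB, adjD, adjN, adj1, adj0, @adjK).

Lemma tr_adj T (X : rop T T) : ctr (X ^†) = (ctr X)^*.
Proof. by rewrite !tr_en rmorph_sum; apply: eq_bigr => i _; rewrite enA. Qed.

Lemma trD T (X Y : rop T T) : ctr (X + Y) = ctr X + ctr Y.
Proof. by rewrite ctr.unlock linearD. Qed.

Lemma trN T (X : rop T T) : ctr (- X) = - ctr X.
Proof. by rewrite ctr.unlock linearN. Qed.

Lemma trZ T a (X : rop T T) : ctr (a *: X) = a * ctr X.
Proof. by rewrite ctr.unlock linearZ. Qed.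

Lemma tr0 T : ctr (0 : rop T T) = 0.
Proof. by rewrite ctr.unlock linear0. Qed.

Lemma trC T U (X : rop T U) (Y : rop U T) : ctr (X ** Y) = ctr (Y ** X).
Proof. by rewrite ctr.unlock mm.unlock mxtrace_mulC. Qed.

Lemma tr_sum T I (r : seq I) (P : pred I) (F : I -> rop T T) :
  ctr (\sum_(i <- r | P i) F i) = \sum_(i <- r | P i) ctr (F i).
Proof. by elim/big_rec2: _ => [|i x y _ <-]; rewrite ?tr0 ?trD. Qed.

Definition rtr T (X : rop T T) : R := complex.Re (ctr X).

Lemma rtrD T (X Y : rop T T) : rtr (X + Y) = rtr X + rtr Y.
Proof. by rewrite /rtr trD; case: (ctr X); case: (ctr Y). Qed.

Lemma rtrN T (X : rop T T) : rtr (- X) = - rtr X.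
Proof. by rewrite /rtr trN; case: (ctr X). Qed.

Lemma rtrB T (X Y : rop T T) : rtr (X - Y) = rtr X - rtr Y.
Proof. by rewrite rtrD rtrN. Qed.

Lemma rtr0 T : rtr (0 : rop T T) = 0.
Proof. by rewrite /rtr tr0. Qed.

Lemma rtrC T U (X : rop T U) (Y : rop U T) : rtr (X ** Y) = rtr (Y ** X).
Proof. by rewrite /rtr trC. Qed.

Lemma conjc_complex (z : C) : z^* = conjc z.
Proof. by []. Qed.

Lemma ReD (a b : C) : complex.Re (a + b) = complex.Re a + complex.Re b.
Proof. by case: a; case: b. Qed.

Lemma Re_realM (k : R) (a : C) : complex.Re (k%:C%C * a) = k * complex.Re a.
Proof. by case: a => x y /=; rewrite mul0r subr0. Qed.

Lemma Re_conj (a : C) : complex.Re (a^*) = complex.Re a.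
Proof. by case: a. Qed.

Lemma Re_sum I (r : seq I) (P : pred I) (F : I -> C) :
  complex.Re (\sum_(i <- r | P i) F i) = \sum_(i <- r | P i) complex.Re (F i).
Proof. by elim/big_rec2: _ => [|i x y _ <-] //; rewrite ReD. Qed.

Lemma Re_ge0 (a : C) : 0 <= a -> 0 <= complex.Re a.
Proof. by rewrite lecE => /andP[]. Qed.

Lemma ge0_Re (a : C) : 0 <= a -> a = (complex.Re a)%:C%C.
Proof. by rewrite lecE => /andP[/eqP h _]; case: a h => x y /= ->. Qed.

Lemma conj_normCK (z : C) : z * z^* = (complex.Re z ^+ 2 + complex.Im z ^+ 2)%:C%C.
Proof. by rewrite -normCK add_Re2_Im2. Qed.

Lemma rtrZ T (k : R) (X : rop T T) : rtr (k%:C%C *: X) = k * rtr X.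
Proof. by rewrite /rtr trZ Re_realM. Qed.

Lemma rtr_adj T (X : rop T T) : rtr (X ^†) = rtr X.
Proof. by rewrite /rtr tr_adj Re_conj. Qed.

(** The conjugate sits on the right because [psd] tests row vectors; [ketbra] follows the same
    convention. *)
Definition qf T (X : rop T T) (v : T -> C) : C := \sum_s \sum_t v s * en X s t * (v t)^*.

Lemma conjM (a b : C) : (a * b)^* = a^* * b^*.
Proof. exact: rmorphM. Qed.

Lemma conjK (a : C) : a^*^* = a.
Proof. exact: conjCK. Qed.

Lemma qfE T (X : rop T T) (v : 'rV[C]_#|T|) :
  (v *m X *m v ^t* ) 0 0 = qf X (fun t => v 0 (enum_rank t)).
Proof.
rewrite mxE sum_ord /qf exchange_big /=; apply: eq_bigr => t _.
rewrite !mxE sum_ord mulr_suml; apply: eq_bigr => s _.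
by rewrite en.unlock.
Qed.

Lemma psd_herm T (X : rop T T) : psd X -> X ^† = X.
Proof. by rewrite adj.unlock => -[/is_hermitianmxP]; rewrite expr0 scale1r => <-. Qed.

Lemma psd_qf T (X : rop T T) v : psd X -> 0 <= qf X v.
Proof.
move=> [_ /(_ (\row_j v (enum_val j)))]; rewrite qfE /qf.
under eq_bigr do under eq_bigr do rewrite !mxE !enum_rankK.
by [].
Qed.

Lemma psd_intro T (X : rop T T) : X ^† = X -> (forall v, 0 <= qf X v) -> psd X.
Proof.
move=> h1 h2; split=> [|v]; last by rewrite qfE.
by apply/is_hermitianmxP; rewrite expr0 scale1r -[LHS]h1 adj.unlock.
Qed.

Lemma psd_gram T U (Y : rop U T) : psd (Y ^† ** Y).
Proof.
apply: psd_intro => [|v]; first by rewrite !adjE.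
have -> : qf (Y ^† ** Y) v = \sum_u (\sum_s v s * (en Y u s)^*) * (\sum_s v s * (en Y u s)^*)^*.
  transitivity (\sum_s \sum_t \sum_u v s * (en Y u s)^* * (v t * (en Y u t)^*)^*).
    apply: eq_bigr => s _; apply: eq_bigr => t _; rewrite enM mulr_sumr mulr_suml.
    apply: eq_bigr => u _; rewrite enA conjM conjK; ring.
  under eq_bigr do rewrite exchange_big /=.
  rewrite exchange_big /=; apply: eq_bigr => u _; rewrite mulr_suml.
  by apply: eq_bigr => s _; rewrite rmorph_sum mulr_sumr.
by apply: sumr_ge0 => u _; exact: mul_conjC_ge0.
Qed.

Lemma en_dg T (f : T -> C) s t : en (dg f) s t = f s *+ (s == t).
Proof. by rewrite dg.unlock en_mk. Qed.

Lemma en_dgl T U (f : T -> C) (X : rop T U) s t :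
  en (dg f ** X) s t = f s * en X s t.
Proof.
rewrite enM (bigD1 s) //= big1 ?addr0 => [|u /negPf us].
  by rewrite en_dg eqxx mulr1n.
by rewrite en_dg eq_sym us mul0r.
Qed.

Lemma en_dgr T U (f : U -> C) (X : rop T U) s t :
  en (X ** dg f) s t = en X s t * f t.
Proof.
rewrite enM (bigD1 t) //= big1 ?addr0 => [|u /negPf us].
  by rewrite en_dg eqxx mulr1n.
by rewrite en_dg us mulr0.
Qed.

Lemma dgM T (f g : T -> C) : dg f ** dg g = dg (fun t => f t * g t).
Proof. by apply: en_inj => s t; rewrite en_dgl !en_dg mulrnAr. Qed.

Lemma dg_adj T (f : T -> C) : (dg f) ^† = dg (fun t => (f t)^*).
Proof.
by apply: en_inj => s t; rewrite enA !en_dg eq_sym; case: eqP => [->|] //=;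
   rewrite ?mulr0n ?conjC0.
Qed.

Lemma dg_adjr T (f : T -> R) :
  (dg (fun t => (f t)%:C%C)) ^† = dg (fun t => (f t)%:C%C).
Proof.
by rewrite dg_adj; apply: en_inj => s t; rewrite !en_dg conjc_complex conjc_real.
Qed.

Lemma dg1 T : dg (fun _ : T => 1) = Id :> rop T T.
Proof. by apply: en_inj => s t; rewrite en_dg en1. Qed.

Lemma dgB T (f g : T -> C) : dg f - dg g = dg (fun t => f t - g t).
Proof. by apply: en_inj => s t; rewrite enB !en_dg mulrnBl. Qed.

Lemma dgZ T a (f : T -> C) : a *: dg f = dg (fun t => a * f t).
Proof. by apply: en_inj => s t; rewrite enZ !en_dg mulrnAr. Qed.

Lemma eq_dg T (f g : T -> C) : f =1 g -> dg f = dg g.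
Proof. by move=> h; apply: en_inj => s t; rewrite !en_dg h. Qed.

Definition unit2 T U (P : rop T U) := P ** P ^† = Id /\ P ^† ** P = Id.

Lemma unitary_unit2 T (P : op R T) : P \is unitarymx -> unit2 P.
Proof.
move=> h; rewrite /unit2 mm.unlock adj.unlock idt.unlock.
by split; [exact/unitarymxP|apply/mulmx1C/unitarymxP].
Qed.

(** One unitary serves X and all its functions at once. Hermiticity is asked only for recovering X,
    because [mxfun] is computed from the spectral data of any X. *)
Lemma diagP T (X : op R T) : exists (P : rop T T) (d : T -> R),
  [/\ unit2 P, X ^† = X -> X = P ^† ** dg (fun t => (d t)%:C%C) ** P
    & forall f, mxfun f X = P ^† ** dg (fun t => (f (d t))%:C%C) ** P].
Proof.
exists (spectralmx X), (fun t => complex.Re (spectral_diag X 0 (enum_rank t))).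
split; first exact/unitary_unit2/spectral_unitarymx.
  move=> hX; have hh : X \is hermsymmx.
    by apply/is_hermitianmxP; rewrite expr0 scale1r -[LHS]hX adj.unlock.
  have /orthomx_spectralP {1}-> := hermitian_normalmx hh.
  rewrite (invmx_unitary (spectral_unitarymx X)) adj.unlock mm.unlock.
  suff -> : diag_mx (spectral_diag X)
          = dg (fun t => (complex.Re (spectral_diag X 0 (enum_rank t)))%:C%C) by [].
  have /mxOverP hr := hermitian_spectral_diag_real hh.
  apply: en_inj => s t; rewrite en_dg en.unlock !mxE (inj_eq enum_rank_inj).
  by congr (_ *+ _); rewrite RRe_real ?hr.
move=> f; rewrite /mxfun adj.unlock mm.unlock; set D := diag_mx _.
suff -> : D = dg (fun t => (f (complex.Re (spectral_diag X 0 (enum_rank t))))%:C%C) by [].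
by apply: en_inj => s t; rewrite en_dg en.unlock !mxE (inj_eq enum_rank_inj).
Qed.

(* Functional calculus does not depend on the diagonalisation: the change of
   basis M between two of them satisfies M_ij (d_j - e_i) = 0. *)
Lemma mxfun_diag T U (f : R -> R) (P : rop U T) (d : U -> R) (X : op R T) :
  unit2 P -> X = P ^† ** dg (fun t => (d t)%:C%C) ** P ->
  mxfun f X = P ^† ** dg (fun t => (f (d t))%:C%C) ** P.
Proof.
move=> [hP1 hP2] hX.
have hXh : X ^† = X by rewrite hX !adjE dg_adjr mmA.
have [Q [e [[hQ1 hQ2] /(_ hXh) hS ->]]] := diagP X.
have key s t : en (Q ** P ^†) s t * (d t)%:C%C = (e s)%:C%C * en (Q ** P ^†) s t.
  rewrite -(en_dgr (fun t => (d t)%:C%C)) -(en_dgl (fun t => (e t)%:C%C)); congr (en _ s t).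
  transitivity (Q ** X ** P ^†); first by rewrite hX !mmA -[RHS]mmA hP1 mm1.
  by rewrite hS !mmA hQ1 mm1l.
have key2 : (Q ** P ^†) ** dg (fun t => (f (d t))%:C%C)
          = dg (fun t => (f (e t))%:C%C) ** (Q ** P ^†).
  apply: en_inj => s t; rewrite en_dgr en_dgl; have := key s t.
  have [->|nz] := eqVneq (en (Q ** P ^†) s t) 0; first by rewrite !(mulr0, mul0r).
  by rewrite [RHS]mulrC => /(mulfI nz) /complexI ->; rewrite mulrC.
transitivity (Q ^† ** ((Q ** P ^†) ** dg (fun t => (f (d t))%:C%C)) ** P).
  by rewrite key2 !mmA -[RHS]mmA hP2 mm1.
by rewrite !mmA hQ2 mm1l.
Qed.

Lemma mxfunM T (f g : R -> R) (X : op R T) :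
  mxfun f X ** mxfun g X = mxfun (fun x => f x * g x) X.
Proof.
have [P [d [[h1 h2] _ h]]] := diagP X.
rewrite !h !mmA -(mmA _ P) h1 mm1 -(mmA _ (dg _) (dg _)) dgM.
by congr (_ ** _ ** _); apply: eq_dg => t; rewrite rmorphM.
Qed.

Lemma mxfun_adj T f (X : op R T) : (mxfun f X) ^† = mxfun f X.
Proof. by have [P [d [_ _ h]]] := diagP X; rewrite h !adjE dg_adjr mmA. Qed.

Lemma sqrC_ge0 (x : R) : 0 <= x -> ((Num.sqrt x)%:C%C)^* * (Num.sqrt x)%:C%C = x%:C%C.
Proof. by move=> x0; rewrite conjc_complex conjc_real -rmorphM -expr2 sqr_sqrtr. Qed.

Lemma dg_psd T (f : T -> R) : (forall t, 0 <= f t) ->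
  psd (dg (fun t => (f t)%:C%C)).
Proof.
move=> h; have -> : dg (fun t => (f t)%:C%C) =
   (dg (fun t => (Num.sqrt (f t))%:C%C)) ^† ** (dg (fun t => (Num.sqrt (f t))%:C%C)).
  by rewrite dg_adj dgM; apply: eq_dg => t; rewrite sqrC_ge0.
exact: psd_gram.
Qed.

Lemma psd_diag T U (P : rop U T) (d : U -> R) (X : rop T T) :
  unit2 P -> psd X -> X = P ^† ** dg (fun t => (d t)%:C%C) ** P -> forall t, 0 <= d t.
Proof.
move=> [h1 h2] hX hS t.
have hd : P ** X ** P ^† = dg (fun t => (d t)%:C%C).
  by rewrite hS !mmA h1 mm1l -mmA h1 mm1.
rewrite -ler0c; suff <- : qf X (en P t) = (d t)%:C%C by exact: psd_qf.
transitivity (en (P ** X ** P ^†) t t); last by rewrite hd en_dg eqxx.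
rewrite enM /qf exchange_big /=; apply: eq_bigr => s _.
by rewrite enM enA mulr_suml.
Qed.

Lemma psdP T (X : op R T) : psd X -> exists (P : rop T T) (d : T -> R),
  [/\ unit2 P, forall t, 0 <= d t, X = P ^† ** dg (fun t => (d t)%:C%C) ** P
    & forall f, mxfun f X = P ^† ** dg (fun t => (f (d t))%:C%C) ** P].
Proof.
move=> hX; have [P [d [h1 h2 h3]]] := diagP X; have hS := h2 (psd_herm hX).
by exists P, d; split=> //; exact: (psd_diag h1 hX hS).
Qed.

Lemma sqrtmE T (X : op R T) : sqrtm X = mxfun (@Num.sqrt R) X.
Proof. by []. Qed.

Lemma logmE T (X : op R T) : logm X = mxfun (fun x => if 0 < x then log2 x else 0) X.
Proof. by []. Qed.

Lemma sqrtm_sqr T (X : op R T) : psd X -> sqrtm X ** sqrtm X = X.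
Proof.
move=> hX; rewrite mxfunM; have [P [d [h1 h2 h3 ->]]] := psdP hX; rewrite [RHS]h3.
by congr (_ ** _ ** _); apply: eq_dg => t; rewrite -expr2 sqr_sqrtr.
Qed.

Lemma sqrtm_adj T (X : op R T) : (sqrtm X) ^† = sqrtm X.
Proof. exact: mxfun_adj. Qed.

Lemma psd_ex T (X : rop T T) : psd X -> exists Y : rop T T, Y ^† = Y /\ X = Y ** Y.
Proof. by move=> hX; exists (sqrtm X); rewrite sqrtm_adj sqrtm_sqr. Qed.

Lemma psd_conj T U (Z : rop U T) (X : rop T T) : psd X -> psd (Z ** X ** Z ^†).
Proof.
move=> /psd_ex [Y [hY ->]].
have -> : Z ** (Y ** Y) ** Z ^† = (Y ** Z ^†) ^† ** (Y ** Z ^†).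
  by rewrite !adjE hY !mmA.
exact: psd_gram.
Qed.

Lemma psd_conj' T U (Z : rop T U) (X : rop T T) : psd X -> psd (Z ^† ** X ** Z).
Proof. by move=> h; have := psd_conj (Z ^†) h; rewrite adjK. Qed.

Lemma mxfun_psd T f (X : op R T) : (forall x, 0 <= f x) -> psd (mxfun f X).
Proof.
move=> h; have [P [d [_ _ ->]]] := diagP X.
by apply: psd_conj'; apply: dg_psd => t.
Qed.

Lemma sqrtm_psd T (X : op R T) : psd (sqrtm X).
Proof. by apply: mxfun_psd => x; exact: sqrtr_ge0. Qed.

Lemma psdD T (X Y : rop T T) : psd X -> psd Y -> psd (X + Y).
Proof.
move=> hX hY; apply: psd_intro => [|v]; first by rewrite adjD !psd_herm.
have -> : qf (X + Y) v = qf X v + qf Y v.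
  rewrite /qf -big_split /=; apply: eq_bigr => s _; rewrite -big_split /=.
  by apply: eq_bigr => t _; rewrite enD mulrDr mulrDl.
by rewrite addr_ge0 ?psd_qf.
Qed.

Lemma psdZ T (k : R) (X : rop T T) : 0 <= k -> psd X -> psd (k%:C%C *: X).
Proof.
move=> k0 hX; apply: psd_intro => [|v].
  by rewrite adjZ conjc_complex conjc_real psd_herm.
have -> : qf (k%:C%C *: X) v = k%:C%C * qf X v.
  rewrite /qf mulr_sumr; apply: eq_bigr => s _; rewrite mulr_sumr.
  by apply: eq_bigr => t _; rewrite enZ; ring.
by rewrite mulr_ge0 ?ler0c ?psd_qf.
Qed.

Lemma psd1 T : psd (Id : rop T T).
Proof. by have := psd_gram (Id : rop T T); rewrite adj1 mm1. Qed.

Lemma psd0 T : psd (0 : rop T T).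
Proof. by have := psd_conj (0 : rop T T) (psd1 T); rewrite mm0l mm0l. Qed.

Lemma psd_sum T I (r : seq I) (P : pred I) (F : I -> rop T T) :
  (forall i, P i -> psd (F i)) -> psd (\sum_(i <- r | P i) F i).
Proof. by move=> h; elim/big_rec: _ => [|i x Pi hx]; [exact: psd0|exact: psdD (h i Pi) hx]. Qed.

Lemma tr_gram T U (Z : rop T U) : 0 <= ctr (Z ^† ** Z).
Proof.
rewrite tr_en; apply: sumr_ge0 => i _; rewrite enM; apply: sumr_ge0 => j _.
by rewrite enA mulrC mul_conjC_ge0.
Qed.

(** For X = A^2 and Y = B^2, cyclicity turns the trace into tr (BA)^† (BA). *)
Lemma tr_psdM T (X Y : rop T T) : psd X -> psd Y -> 0 <= ctr (X ** Y).
Proof.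
move=> /psd_ex [A [hA ->]] /psd_ex [B [hB ->]].
rewrite -mmA trC.
have -> : A ** (B ** B) ** A = (B ** A) ^† ** (B ** A).
  by rewrite adjM hA hB !mmA.
exact: tr_gram.
Qed.

Lemma rtr_psdM T (X Y : rop T T) : psd X -> psd Y -> 0 <= rtr (X ** Y).
Proof. by move=> hX hY; apply: Re_ge0; apply: tr_psdM. Qed.

Lemma tr_psd T (X : rop T T) : psd X -> 0 <= ctr X.
Proof. by move=> hX; have := tr_psdM hX (psd1 T); rewrite mm1. Qed.

Lemma rtr_psd T (X : rop T T) : psd X -> 0 <= rtr X.
Proof. by move=> hX; apply: Re_ge0; apply: tr_psd. Qed.

Definition lel T (X Y : rop T T) := psd (Y - X).

Lemma lel_refl T (X : rop T T) : lel X X.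
Proof. by rewrite /lel subrr; exact: psd0. Qed.

Lemma lel_trans T (Y X Z : rop T T) : lel X Y -> lel Y Z -> lel X Z.
Proof. by move=> h1 h2; have := psdD h2 h1; rewrite /lel addrA subrK. Qed.

Lemma lel_conj T U (Z : rop U T) (X Y : rop T T) : lel X Y ->
  lel (Z ** X ** Z ^†) (Z ** Y ** Z ^†).
Proof. by move=> h; rewrite /lel -mmBl -mmBr; exact: psd_conj. Qed.

Lemma lelZ T (k : R) (X Y : rop T T) : 0 <= k -> lel X Y -> lel (k%:C%C *: X) (k%:C%C *: Y).
Proof. by move=> k0 h; rewrite /lel -scalerBr; exact: psdZ. Qed.

Lemma lel_rtr T (A X Y : rop T T) : psd A -> lel X Y -> rtr (A ** X) <= rtr (A ** Y).
Proof. by move=> hA h; rewrite -subr_ge0 -rtrB -mmBr; exact: rtr_psdM. Qed.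

(** The accepting effect of a two-outcome measurement; [rtr (A ** rho)] is the probability that A
    accepts rho. *)
Definition test T (X : rop T T) := psd X /\ psd (Id - X).

Lemma test1 T : test (Id : rop T T).
Proof. by split; [exact: psd1|rewrite subrr; exact: psd0]. Qed.

Lemma testC T (X : rop T T) : test X -> test (Id - X).
Proof. by case=> h1 h2; split; [exact: h2|rewrite subKr; exact: h1]. Qed.

Lemma test_le1 T (A X : rop T T) : test A -> psd X -> rtr (A ** X) <= rtr X.
Proof.
move=> [_ h] hX; rewrite -subr_ge0 -{1}(mm1l X) -rtrB -mmBl; exact: rtr_psdM.
Qed.

Lemma proj_test T (P : rop T T) : P ^† = P -> P ** P = P -> test P.
Proof.
move=> h1 h2; have aux (Q : rop T T) : Q ^† = Q -> Q ** Q = Q -> psd Q.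
  by move=> hQ1 hQ2; have := psd_gram Q; rewrite hQ1 hQ2.
split; apply: aux => //; first by rewrite adjB adj1 h1.
by rewrite mmBl mmBr mm1 mm1l mmBr mm1 h2 subrr subr0.
Qed.

Lemma test_conj T (Z P : rop T T) : test Z -> P ^† = P -> P ** P = P ->
  test (P ** Z ** P).
Proof.
move=> [h1 h2] hP1 hP2; have [_ hPC] := proj_test hP1 hP2; split.
  by have := psd_conj P h1; rewrite hP1.
have -> : Id - P ** Z ** P = (Id - P) + P ** (Id - Z) ** P ^†.
  by rewrite hP1 mmBr mmBl mm1 hP2 addrA subrK.
exact: psdD hPC (psd_conj _ h2).
Qed.

End Entries.

Lemma tensE (R : realType) (T U : finType) (X : op R T) (Y : op R U) :
  tens X Y = mk (fun p q => en X p.1 q.1 * en Y p.2 q.2).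
Proof. by rewrite en.unlock -mkopE. Qed.

Lemma en_tensmap (R : realType) (T1 T2 U1 U2 : finType)
    (F1 : op R T1 -> op R U1) (F2 : op R T2 -> op R U2) (X : op R (T1 * T2)) u u' :
  en (tensmap F1 F2 X) u u' = \sum_p \sum_q en X p q *
    (en (F1 (munit R p.1 q.1)) u.1 u'.1 * en (F2 (munit R p.2 q.2)) u.2 u'.2).
Proof.
rewrite /tensmap en_sum; apply: eq_bigr => p _; rewrite en_sum; apply: eq_bigr => q _.
by rewrite enZ entE tensE en_mk.
Qed.

#[global] Opaque psd mxfun sqrtm logm tens tensmap.

(** * Trace norm and fidelity *)

Section Norms.
Variable R : realType.
Local Notation C := (R[i]).
Local Notation rop := (rop R).
Implicit Types T U V : finType.

Definition n2 T U (X : rop T U) : R := rtr (X ^† ** X).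

Lemma n2_ge0 T U (X : rop T U) : 0 <= n2 X.
Proof. by apply: Re_ge0; exact: tr_gram. Qed.

Lemma n2_expand T U (X Y : rop T U) (t : R) :
  n2 (X + t%:C%C *: Y) = n2 X + 2 * t * rtr (X ^† ** Y) + t ^+ 2 * n2 Y.
Proof.
have hc : (t%:C%C)^* = t%:C%C :> C by rewrite conjc_complex conjc_real.
rewrite /n2 adjD adjZ hc mmDl !mmDr !rtrD !(mmZl, mmZr) !rtrZ.
have -> : rtr (Y ^† ** X) = rtr (X ^† ** Y) by rewrite -rtr_adj adjM adjK.
ring.
Qed.

Lemma discr_le (a b r : R) : 0 <= a -> 0 <= b ->
  (forall t, 0 <= a + 2 * t * r + t ^+ 2 * b) -> r ^+ 2 <= a * b.
Proof.
move=> a0 b0 h; have [b00|bn0] := eqVneq b 0.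
  have [->|rn0] := eqVneq r 0; first by rewrite expr0n /= mulr_ge0.
  (* For b = 0 the polynomial is affine in t, and this t gives it the value -1. *)
  have := h (- (a + 1) / (2 * r)); rewrite b00 mulr0 addr0.
  have -> : 2 * (- (a + 1) / (2 * r)) * r = - (a + 1) by field.
  lra.
have bp : 0 < b by rewrite lt_neqAle eq_sym bn0.
have := h (- r / b).
have -> : a + 2 * (- r / b) * r + (- r / b) ^+ 2 * b = (a * b - r ^+ 2) / b by field.
by rewrite pmulr_lge0 ?invr_gt0 // subr_ge0.
Qed.

Lemma cauchy_schwarz T U (X Y : rop T U) :
  rtr (X ^† ** Y) <= Num.sqrt (n2 X) * Num.sqrt (n2 Y).
Proof.
rewrite -sqrtrM ?n2_ge0 //.
apply: (le_trans (ler_norm _)); rewrite -sqrtr_sqr ler_wsqrtr //.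
apply: discr_le; rewrite ?n2_ge0 // => t.
by rewrite -n2_expand n2_ge0.
Qed.

Lemma hs_triangle T U (X Y : rop T U) :
  Num.sqrt (n2 (X + Y)) <= Num.sqrt (n2 X) + Num.sqrt (n2 Y).
Proof.
rewrite -(@ler_pXn2r _ 2) ?nnegrE ?addr_ge0 ?sqrtr_ge0 //.
rewrite sqr_sqrtr ?n2_ge0 //.
have -> : X + Y = X + (1 : R)%:C%C *: Y by rewrite scale1r.
rewrite n2_expand sqrrD !sqr_sqrtr ?n2_ge0 //.
have := cauchy_schwarz X Y; lra.
Qed.

Lemma n2M_le T U V (K : rop U T) (Z : rop T V) :
  test (K ^† ** K) -> n2 (K ** Z) <= n2 Z.
Proof.
move=> hK; rewrite /n2 adjM -mmA (mmA (K ^†)) rtrC -mmA.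
have -> : rtr (Z ^† ** Z) = rtr (Z ** Z ^†) by rewrite rtrC.
by apply: test_le1 => //; rewrite -{1}(adjK Z); exact: psd_gram.
Qed.

Lemma test_sqr T (X : rop T T) : test X -> test ((sqrtm X) ^† ** sqrtm X).
Proof. by move=> hX; rewrite sqrtm_adj sqrtm_sqr; case: hX. Qed.

Lemma test_proj_gram T (P : rop T T) : P ^† = P -> P ** P = P -> test (P ^† ** P).
Proof. by move=> h1 h2; rewrite h1 h2; exact: proj_test. Qed.

Lemma n2_compl T (rho P : rop T T) : psd rho -> rtr rho = 1 ->
  P ^† = P -> P ** P = P ->
  n2 ((Id - P) ** sqrtm rho) = 1 - rtr (rho ** P).
Proof.
move=> h1 h2 hP1 hP2; have [_ hPC] := proj_test hP1 hP2.
have e : (Id - P) ^† ** (Id - P) = Id - P.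
  by rewrite adjB adj1 hP1 mmBl !mmBr !mm1l mm1 hP2 subrr subr0.
rewrite /n2 adjM sqrtm_adj -mmA (mmA ((Id - P)^†)) e rtrC -mmA (sqrtm_sqr h1).
by rewrite rtrC mmBr mm1 rtrB h2.
Qed.

(* Gentle measurement: P1 P2 barely changes sqrt rho in Hilbert-Schmidt norm. *)
Lemma gentle T (rho P1 P2 A : rop T T) (eta : R) : psd rho -> rtr rho = 1 ->
  P1 ^† = P1 -> P1 ** P1 = P1 -> P2 ^† = P2 -> P2 ** P2 = P2 ->
  1 - eta <= rtr (rho ** P1) -> 1 - eta <= rtr (rho ** P2) -> test A ->
  `|rtr (A ** rho) - rtr (A ** (P1 ** P2 ** rho ** P2 ** P1))| <= 4 * Num.sqrt eta.
Proof.
move=> h1 h2 hP1 hP1' hP2 hP2' e1 e2 hA.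
pose S := sqrtm rho; pose K := sqrtm A.
have hK : test (K ^† ** K) by exact: test_sqr.
have KK : K ^† ** K = A by rewrite sqrtm_adj (sqrtm_sqr hA.1).
have SS : S ** S ^† = rho by rewrite sqrtm_adj sqrtm_sqr.
have na : n2 (K ** S) = rtr (A ** rho).
  by rewrite /n2 adjM -mmA (mmA (K ^†)) KK rtrC -mmA SS.
have nb : n2 (K ** (P1 ** P2 ** S)) = rtr (A ** (P1 ** P2 ** rho ** P2 ** P1)).
  rewrite /n2 adjM -mmA (mmA (K ^†)) KK rtrC -mmA -SS.
  by rewrite !adjM hP1 hP2 !mmA.
have hS : n2 S = 1 by rewrite /n2 rtrC SS.
have la : n2 (K ** S) <= 1 by rewrite -hS; exact: n2M_le.
have lb : n2 (K ** (P1 ** P2 ** S)) <= 1.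
  apply: le_trans (n2M_le _ hK) _; rewrite -mmA.
  apply: le_trans (n2M_le _ (test_proj_gram hP1 hP1')) _.
  by rewrite -hS; apply: n2M_le; exact: test_proj_gram.
(* S - P1 P2 S is the sum of (1 - P1) S and P1 (1 - P2) S, each of norm at most sqrt eta. *)
have key : Num.sqrt (n2 (K ** S - K ** (P1 ** P2 ** S))) <= 2 * Num.sqrt eta.
  have -> : K ** S - K ** (P1 ** P2 ** S) =
            K ** ((Id - P1) ** S + P1 ** ((Id - P2) ** S)).
    by rewrite -mmBr; congr (_ ** _); rewrite !mmBl !mmBr !mm1l !mmA addrA subrK.
  apply: le_trans (ler_wsqrtr (n2M_le _ hK)) _.
  apply: le_trans (hs_triangle _ _) _.
  have -> : 2 * Num.sqrt eta = Num.sqrt eta + Num.sqrt eta by ring.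
  apply: lerD; apply: ler_wsqrtr.
    by rewrite n2_compl //; lra.
  apply: le_trans (n2M_le _ (test_proj_gram hP1 hP1')) _.
  by rewrite n2_compl //; lra.
set a := K ** S in na la key; set b := K ** (P1 ** P2 ** S) in nb lb key.
have t1 : Num.sqrt (n2 a) <= Num.sqrt (n2 (a - b)) + Num.sqrt (n2 b).
  by apply: le_trans (hs_triangle _ _); rewrite subrK.
have t2 : Num.sqrt (n2 b) <= Num.sqrt (n2 (a - b)) + Num.sqrt (n2 a).
  have -> : n2 (a - b) = n2 (b - a) by rewrite /n2 -(opprB b a) adjN; congr rtr;
    apply: en_inj => s t; rewrite !enM; apply: eq_bigr => u _; rewrite !enN mulrNN.
  by apply: le_trans (hs_triangle _ _); rewrite subrK.
have a1 : Num.sqrt (n2 a) <= 1 by rewrite -sqrtr1 ler_wsqrtr.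
have b1 : Num.sqrt (n2 b) <= 1 by rewrite -sqrtr1 ler_wsqrtr.
(* The difference of the squared norms is the difference of the norms, at most 2 sqrt eta, times
   their sum, at most 2: hence the constant 4. *)
rewrite -na -nb -(sqr_sqrtr (n2_ge0 a)) -(sqr_sqrtr (n2_ge0 b)).
have pa := sqrtr_ge0 (n2 a); have pb := sqrtr_ge0 (n2 b); have pe := sqrtr_ge0 eta.
rewrite ler_norml; apply/andP; split; nra.
Qed.

Lemma trnormE T (X : rop T T) : trnorm X = rtr (sqrtm (X ^† ** X)).
Proof. by rewrite /trnorm trE mmE adjmxE. Qed.

Lemma trnorm_ge0 T (X : rop T T) : 0 <= trnorm X.
Proof. by rewrite trnormE; apply: rtr_psd; exact: sqrtm_psd. Qed.

Lemma rtr_dg T (f : T -> R) : rtr (dg (fun t => (f t)%:C%C)) = \sum_t f t.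
Proof. by rewrite /rtr tr_en Re_sum; apply: eq_bigr => t _; rewrite en_dg eqxx. Qed.

(** In an eigenbasis of X^† X each diagonal entry of X is at most the norm of its column, and the
    squared norm of that column is the eigenvalue. *)
Lemma rtr_le_trnorm T (X : rop T T) : rtr X <= trnorm X.
Proof.
rewrite trnormE sqrtmE; have [P [d [[h1 h2] d0 hX ->]]] := psdP (psd_gram X).
rewrite -mmA rtrC -mmA h1 mm1 rtr_dg.
have -> : rtr X = rtr (P ** X ** P ^†) by rewrite rtrC mmA h2 mm1l.
rewrite /rtr tr_en Re_sum; apply: ler_sum => t _.
apply: (le_trans (ler_norm _)); rewrite -sqrtr_sqr ler_wsqrtr //.
rewrite -lecR; set Z := P ** X ** P ^†.
have -> : (d t)%:C%C = en (Z ^† ** Z) t t.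
  suff -> : Z ^† ** Z = dg (fun t => (d t)%:C%C) by rewrite en_dg eqxx.
  rewrite /Z !adjE !mmA -(mmA _ (P ^†) P) h2 mm1 -(mmA P) hX !mmA h1 mm1l.
  by rewrite -mmA h1 mm1.
rewrite enM (bigD1 t) //= enA; apply: (@le_trans _ _ (en Z t t * (en Z t t)^*)).
  by rewrite conj_normCK lecR lerDl sqr_ge0.
rewrite mulrC lerDl; apply: sumr_ge0 => u _; rewrite enA mulrC.
exact: mul_conjC_ge0.
Qed.

Lemma fidE T (rho sigma : rop T T) :
  fid rho sigma = trnorm (sqrtm rho ** sqrtm sigma) ^+ 2.
Proof. by rewrite /fid mmE. Qed.

(** P is the spectral projection of A - B on its positive eigenvalues, so the two products are the
    positive and the negative part of A - B. *)
Lemma hermDiff T (A B : rop T T) : A ^† = A -> B ^† = B -> exists P : rop T T,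
  [/\ test P, psd (P ** (A - B)) & psd ((P - Id) ** (A - B))].
Proof.
move=> hA hB; have [Q [d [[h1 h2] hX _]]] := diagP (A - B).
have {}hX := hX _; rewrite adjB hA hB in hX; have {}hX := hX erefl.
pose g t : R := if 0 < d t then 1 else 0.
have gd f : Q ^† ** dg f ** Q ** (A - B) = Q ^† ** dg (fun t => f t * (d t)%:C%C) ** Q.
  by rewrite hX !mmA -(mmA _ Q) h1 mm1 -(mmA _ (dg _) (dg _)) dgM.
have hId : Id = Q ^† ** dg (fun => 1) ** Q by rewrite dg1 mm1 h2.
exists (Q ^† ** dg (fun t => (g t)%:C%C) ** Q); split.
- split; first by apply: psd_conj'; apply: dg_psd => t; rewrite /g; case: ifP.
  rewrite hId -mmBl -mmBr dgB.
  rewrite (eq_dg (g := fun t => (1 - g t)%:C%C)); last by move=> t; rewrite rmorphB.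
  by apply: psd_conj'; apply: dg_psd => t; rewrite subr_ge0 /g; case: ifP.
- rewrite gd (eq_dg (g := fun t => (g t * d t)%:C%C)); last by move=> t; rewrite rmorphM.
  apply: psd_conj'; apply: dg_psd => t; rewrite /g; case: ltP => h; rewrite ?mul0r ?mul1r //.
  exact: ltW.
- rewrite {1}hId -mmBl -mmBr dgB gd.
  rewrite (eq_dg (g := fun t => ((g t - 1) * d t)%:C%C)); last first.
    by move=> t; rewrite rmorphM rmorphB.
  apply: psd_conj'; apply: dg_psd => t; rewrite /g; case: ltP => h.
    by rewrite subrr mul0r.
  by rewrite sub0r mulN1r oppr_ge0.
Qed.

(* Powers-Stormer: the spectral projection P of sqrt rho - sqrt sigma on its
   positive part satisfies
   tr (sqrt rho - sqrt sigma)^2 <= tr (2P - 1) (rho - sigma). *)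
Lemma fid_ge T (rho sigma : rop T T) (delta : R) :
  psd rho -> psd sigma -> rtr rho = 1 -> rtr sigma = 1 -> delta <= 1 ->
  (forall A, test A -> rtr (A ** rho) - rtr (A ** sigma) <= delta) ->
  (1 - delta) ^+ 2 <= fid rho sigma.
Proof.
move=> h1 h2 t1 t2 d1 hT.
pose A := sqrtm rho; pose B := sqrtm sigma.
have hA : A ^† = A by exact: sqrtm_adj.
have hB : B ^† = B by exact: sqrtm_adj.
have AA : A ** A = rho by exact: sqrtm_sqr.
have BB : B ** B = sigma by exact: sqrtm_sqr.
have [P [tP pP nP]] := hermDiff hA hB.
suff k : 1 - delta <= rtr (A ** B).
  rewrite fidE ler_pXn2r ?nnegrE ?subr_ge0 ?trnorm_ge0 //.
  exact: le_trans k (rtr_le_trnorm _).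
(* Pair the positive part of A - B with B and the negative part with A. In the sum of the two traces
   the cross terms cancel by [c1], leaving tr P (rho - sigma) - 1 + tr AB >= 0. *)
have e1 := rtr_psdM pP (sqrtm_psd sigma); have e2 := rtr_psdM nP (sqrtm_psd rho).
rewrite -/B in e1; rewrite -/A in e2; clearbody A B.
have e3 := hT P tP; rewrite -AA -BB in e3.
have e4 : rtr (A ** B) = rtr (B ** A) by rewrite rtrC.
have c1 : rtr (P ** A ** B) = rtr (P ** B ** A).
  by rewrite -rtr_adj !adjM hA hB (psd_herm tP.1) mmA rtrC mmA.
rewrite mmBr mmBl !rtrB in e1; rewrite mmBl mm1l mmBr !mmBl !rtrB in e2.
rewrite !mmA in e3.
rewrite AA t1 in e2.
move: e1 e2 e3 e4 c1 => {hT pP nP}.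
move: (rtr (P ** A ** B)) (rtr (P ** B ** A)) (rtr (P ** B ** B)) (rtr (P ** A ** A)).
move: (rtr (A ** B)) (rtr (B ** A)) => x1 x2 x3 x4 x5 x6; clear -d1; lra.
Qed.

(* The partial isometry U of the polar decomposition of sqrt rho sqrt sigma
   turns the trace norm into a trace, split by A and 1 - A and bounded by
   Cauchy-Schwarz. *)
Lemma fid_le T (rho sigma A : rop T T) : psd rho -> psd sigma ->
  rtr rho = 1 -> rtr sigma = 1 -> test A ->
  Num.sqrt (fid rho sigma) <=
  Num.sqrt (rtr (A ** sigma)) + Num.sqrt (rtr ((Id - A) ** rho)).
Proof.
move=> h1 h2 t1 t2 hA.
rewrite fidE sqrtr_sqr ger0_norm ?trnorm_ge0 //.
pose r := sqrtm rho; pose s := sqrtm sigma; rewrite -/r -/s.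
have hr : r ^† = r by exact: sqrtm_adj.
have hs : s ^† = s by exact: sqrtm_adj.
have regroup : r ** r = rho by exact: sqrtm_sqr.
have ss : s ** s = sigma by exact: sqrtm_sqr.
move: r s hr hs regroup ss => r s hr hs regroup ss.
rewrite trnormE sqrtmE.
have [P [d [[hP1 hP2] d0 hX ->]]] := psdP (psd_gram (r ** s)).
(* G is the pseudo-inverse of the modulus of r s, so that U (r s) is this modulus; the value 0 on
   the kernel makes U a partial isometry, not a unitary. *)
pose g t : R := if 0 < d t then (Num.sqrt (d t))^-1 else 0.
pose G := P ^† ** dg (fun t => (g t)%:C%C) ** P.
pose U := G ** (r ** s) ^†.
have dgRM (f1 f2 : T -> R) : (P ^† ** dg (fun t => (f1 t)%:C%C) ** P) **
    (P ^† ** dg (fun t => (f2 t)%:C%C) ** P)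
    = P ^† ** dg (fun t => (f1 t * f2 t)%:C%C) ** P.
  rewrite !mmA -(mmA _ P) hP1 mm1 -(mmA _ (dg _) (dg _)) dgM.
  by congr (_ ** _ ** _); apply: eq_dg => t; rewrite rmorphM.
have hG : G ^† = G by rewrite /G !adjE dg_adjr mmA.
have UX : U ** (r ** s) = P ^† ** dg (fun t => (Num.sqrt (d t))%:C%C) ** P.
  rewrite /U -mmA hX dgRM; congr (_ ** _ ** _); apply: eq_dg => t; congr (_%:C%C).
  rewrite /g; case: ltP => h; last first.
    by have -> : d t = 0 by [apply/le_anti; rewrite d0 h]; rewrite mul0r sqrtr0.
  by rewrite -{2}(sqr_sqrtr (d0 t)) expr2 mulKf // sqrtr_eq0 -ltNge.
have UUU : U ** U ^† ** U = U.
  have hU : U ^† = (r ** s) ** G by rewrite /U adjM adjK hG.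
  transitivity (G ** ((r ** s) ^† ** (r ** s)) ** G ** G ** (r ** s) ^†).
    by rewrite hU /U !mmA.
  rewrite hX /U {1 2 3}/G !dgRM; congr (_ ** _); rewrite /G.
  congr (_ ** _ ** _); apply: eq_dg => t; congr (_%:C%C).
  rewrite /g; case: ltP => h; last by rewrite !mul0r.
  rewrite -{2}(sqr_sqrtr (d0 t)) expr2 mulKf ?mulfV ?mul1r // sqrtr_eq0 -ltNge //.
clearbody U.
have tU : test (U ^† ** U).
  by apply: proj_test; rewrite ?adjM ?adjK // -!mmA (mmA U) UUU.
have bound (B : rop T T) : test B ->
    rtr (U ** (r ** B ** s)) <= Num.sqrt (rtr (B ** rho)) * Num.sqrt (rtr (B ** sigma)).
  move=> hB; pose K := sqrtm B.
  have KK : K ^† ** K = B by rewrite sqrtm_adj (sqrtm_sqr hB.1).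
  have -> : U ** (r ** B ** s) = (K ** r ** U ^†) ^† ** (K ** s).
    by rewrite !adjM adjK hr -KK !mmA.
  apply: le_trans (cauchy_schwarz _ _) _.
  have -> : n2 (K ** s) = rtr (B ** sigma).
    by rewrite /n2 adjM -mmA (mmA (K ^†)) KK rtrC -mmA hs ss.
  apply: ler_wpM2r; first exact: sqrtr_ge0.
  apply: ler_wsqrtr.
  have -> : n2 (K ** r ** U ^†) = n2 (U ** (K ** r) ^†).
    by rewrite /n2 rtrC !adjM !adjK !mmA.
  apply: le_trans (n2M_le _ tU) _.
  by rewrite /n2 adjK rtrC adjM -mmA (mmA (K^†)) KK rtrC -mmA hr regroup.
rewrite -UX.
have -> : U ** (r ** s) = U ** (r ** A ** s) + U ** (r ** (Id - A) ** s).
  by rewrite -mmDr -mmDl -mmDr addrC subrK mm1.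
(* Each term is a product of two square roots at most 1, one of which is dropped: the rho factor for
   A, the sigma factor for 1 - A. *)
rewrite rtrD; apply: lerD.
  apply: le_trans (bound _ hA) _; rewrite -[leRHS]mul1r; apply: ler_wpM2r.
    exact: sqrtr_ge0.
  by rewrite -sqrtr1 ler_wsqrtr // -t1; exact: test_le1.
have hA' := testC hA.
apply: le_trans (bound _ hA') _; rewrite -[leRHS]mulr1; apply: ler_wpM2l.
  exact: sqrtr_ge0.
by rewrite -sqrtr1 ler_wsqrtr // -t2; exact: test_le1.
Qed.

End Norms.

(** * Tensor products over n copies *)

HB.lock Definition tpw (R : realType) (n : nat) (T U : finType) (X : 'I_n -> rop R T U)
  : rop R {ffun 'I_n -> T} {ffun 'I_n -> U} :=
  mk (fun p q : {ffun _ -> _} => \prod_k en (X k) (p k) (q k)).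

Section TensorPower.
Variable R : realType.
Local Notation C := (R[i]).
Local Notation rop := (rop R).
Implicit Types T U V : finType.
Variable n : nat.

Lemma en_tpw T U (X : 'I_n -> rop T U) (p : {ffun 'I_n -> T}) (q : {ffun 'I_n -> U}) :
  en (tpw X) p q = \prod_k en (X k) (p k) (q k).
Proof. by rewrite tpw.unlock en_mk. Qed.

Lemma tpwM T U V (X : 'I_n -> rop T U) (Y : 'I_n -> rop U V) :
  tpw X ** tpw Y = tpw (fun k => X k ** Y k).
Proof.
apply: en_inj => p q; rewrite enM en_tpw.
under [RHS]eq_bigr do rewrite enM.
rewrite bigA_distr_bigA /=; apply: eq_bigr => u _.
by rewrite !en_tpw -big_split.
Qed.

Lemma tpwA T U (X : 'I_n -> rop T U) : (tpw X) ^† = tpw (fun k => (X k) ^†).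
Proof.
apply: en_inj => p q; rewrite enA !en_tpw rmorph_prod.
by apply: eq_bigr => k _; rewrite enA.
Qed.

Lemma tpw_dg T (f : T -> C) :
  tpw (fun _ : 'I_n => dg f) = dg (fun p : {ffun 'I_n -> T} => \prod_k f (p k)).
Proof.
apply: en_inj => p q; rewrite en_tpw en_dg; have [<-|/eqP pq] := eqVneq p q.
  by apply: eq_bigr => k _; rewrite en_dg eqxx.
have /existsP [k hk] : [exists k, p k != q k].
  by rewrite -negb_forall; apply/negP => /forallP h; apply: pq; apply/ffunP => k; apply/eqP.
by rewrite (bigD1 k) //= en_dg (negPf hk) mul0r.
Qed.

Lemma tpw1 T : tpw (fun _ : 'I_n => Id : rop T T) = Id.
Proof. by rewrite -dg1 tpw_dg -dg1; apply: eq_dg => p; rewrite big1. Qed.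

Lemma ctr_tpw T (X : 'I_n -> rop T T) : ctr (tpw X) = \prod_k ctr (X k).
Proof.
rewrite tr_en; under [RHS]eq_bigr do rewrite tr_en.
by rewrite bigA_distr_bigA; apply: eq_bigr => p _; rewrite en_tpw.
Qed.

Lemma unit2_tpw T U (P : rop T U) : unit2 P -> unit2 (tpw (fun _ : 'I_n => P)).
Proof. by case=> h1 h2; split; rewrite tpwA tpwM ?h1 ?h2 tpw1. Qed.

Lemma psd_tpw T (X : rop T T) : psd X -> psd (tpw (fun _ : 'I_n => X)).
Proof.
move=> /psd_ex [Y [hY ->]]; rewrite -tpwM.
have -> : tpw (fun _ : 'I_n => Y) ** tpw (fun _ : 'I_n => Y)
   = (tpw (fun _ : 'I_n => Y)) ^† ** tpw (fun _ : 'I_n => Y) by rewrite tpwA hY.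
exact: psd_gram.
Qed.

Lemma rtr_tpw1 T (X : rop T T) : psd X -> rtr X = 1 -> rtr (tpw (fun _ : 'I_n => X)) = 1.
Proof.
move=> h1 h2; rewrite /rtr ctr_tpw (ge0_Re (tr_psd h1)) -/(rtr X) h2.
by rewrite big1.
Qed.

(** The variance of a sum of independent centred variables: the expectation of a cross term factors,
    and one factor is the mean 0. *)
Lemma second_moment T (p g : T -> R) : \sum_t p t = 1 -> \sum_t p t * g t = 0 ->
  \sum_(x : {ffun 'I_n -> T}) (\prod_k p (x k)) * (\sum_k g (x k)) ^+ 2
  = n%:R * \sum_t p t * g t ^+ 2.
Proof.
move=> p1 g0.
(* Padding g (x k) with factors 1 makes it a product over all coordinates, so that the sum over x
   factors. *)
pose c (k i : 'I_n) (t : T) := if i == k then g t else 1.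
have mom k l : \sum_(x : {ffun 'I_n -> T}) (\prod_i p (x i)) * (g (x k) * g (x l))
             = if k == l then \sum_t p t * g t ^+ 2 else 0.
  have pick1 (x : {ffun 'I_n -> T}) k' : g (x k') = \prod_i c k' i (x i).
    rewrite (bigD1 k') //= /c eqxx big1 ?mulr1 // => i /negPf hi; by rewrite hi.
  transitivity (\prod_i \sum_t p t * (c k i t * c l i t)).
    rewrite bigA_distr_bigA; apply: eq_bigr => x _.
    by rewrite (pick1 x k) (pick1 x l) -!big_split.
  case: eqP => [->|/eqP kl].
    rewrite (bigD1 l) //= /c eqxx [X in _ * X]big1 ?mulr1 => [|i /negPf hi].
      by apply: eq_bigr => t _; rewrite expr2.
    by rewrite hi -[RHS]p1; apply: eq_bigr => t _; rewrite !mulr1.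
  rewrite (bigD1 k) //= /c eqxx (negPf kl).
  by under eq_bigr do rewrite mulr1; rewrite g0 mul0r.
transitivity (\sum_k \sum_l \sum_(x : {ffun 'I_n -> T})
                (\prod_i p (x i)) * (g (x k) * g (x l))).
  under [RHS]eq_bigr do rewrite exchange_big.
  rewrite exchange_big /=; apply: eq_bigr => x _.
  rewrite expr2 mulr_suml mulr_sumr; apply: eq_bigr => k _.
  by rewrite !mulr_sumr.
transitivity (\sum_(k < n) \sum_t p t * g t ^+ 2).
  apply: eq_bigr => k _; rewrite (bigD1 k) //= mom eqxx -[RHS]addr0; congr (_ + _).
  apply: big1 => l kl.
  by rewrite mom eq_sym (negPf kl).
by rewrite sumr_const card_ord mulr_natl.
Qed.

End TensorPower.

(** * Typical projections *)

Section Typical.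
Variable R : realType.
Local Notation C := (R[i]).
Local Notation rop := (rop R).
Implicit Types T U V : finType.

Definition pow2 (x : R) : R := expR (x * ln 2).

Lemma ln2_gt0 : 0 < ln 2 :> R.
Proof. by rewrite ln_gt0 // ltr1n. Qed.

Lemma pow2D x y : pow2 (x + y) = pow2 x * pow2 y.
Proof. by rewrite /pow2 mulrDl expRD. Qed.

Lemma pow2_gt0 x : 0 < pow2 x.
Proof. exact: expR_gt0. Qed.

Lemma pow20 : pow2 0 = 1.
Proof. by rewrite /pow2 mul0r expR0. Qed.

Lemma pow2N x : pow2 (- x) = (pow2 x)^-1.
Proof. by rewrite /pow2 mulNr expRN. Qed.

Lemma pow2_log2 (x : R) : 0 < x -> pow2 (log2 x) = x.
Proof.
by move=> h; rewrite /pow2 /log2 divfK ?lnK ?posrE // gt_eqF // ln2_gt0.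
Qed.

Lemma log2_pow2 (x : R) : log2 (pow2 x) = x.
Proof. by rewrite /log2 /pow2 expRK mulfK // gt_eqF // ln2_gt0. Qed.

Lemma ler_pow2 x y : (pow2 x <= pow2 y) = (x <= y).
Proof. by rewrite /pow2 ler_expR ler_pM2r // ln2_gt0. Qed.

Lemma ler_log2 (x y : R) : 0 < x -> x <= y -> log2 x <= log2 y.
Proof.
move=> h1 h2; rewrite -ler_pow2 !pow2_log2 //; exact: lt_le_trans h2.
Qed.

Lemma pow2_sum I (r : seq I) (f : I -> R) :
  pow2 (\sum_(i <- r) f i) = \prod_(i <- r) pow2 (f i).
Proof. by elim/big_rec2: _ => [|i x y _ <-]; rewrite ?pow20 ?pow2D. Qed.

(* supp rho is contained in supp sigma *)
Definition dominated T (rho sigma : rop T T) :=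
  exists2 c : R, 0 <= c & lel rho (c%:C%C *: sigma).

Lemma psd_diag_ge0 T (X : rop T T) t : psd X -> 0 <= en X t t.
Proof.
move=> h; have := psd_qf (fun s => (s == t)%:R) h; rewrite /qf.
rewrite (bigD1 t) //= (bigD1 t) //= eqxx mul1r conjC1 mulr1.
rewrite big1 => [|s /negPf ->]; last by rewrite conjC0 mulr0.
rewrite big1 ?addr0 // => s /negPf ->.
by rewrite big1 // => u _; rewrite !mul0r.
Qed.

(** Measuring rho in an eigenbasis of sigma gives a random eigenvalue mu whose logarithm has mean tr
    rho log sigma. P projects on the sequences of n outcomes whose average logarithm is within delta
    of this mean; Chebyshev bounds the probability of the others. P commutes with sigma^n, whose
    eigenvalues on its range are pinched between the two exponentials. *)
Lemma typical T (rho sigma : rop T T) (delta eta : R) :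
  psd rho -> rtr rho = 1 -> psd sigma -> dominated rho sigma ->
  0 < delta -> 0 < eta ->
  exists n0, forall n, (n0 <= n)%N -> exists P : rop {ffun 'I_n -> T} {ffun 'I_n -> T},
   [/\ [/\ P ^† = P, P ** P = P & 1 - eta <= rtr (tpw (fun _ : 'I_n => rho) ** P)],
       lel (P ** tpw (fun _ : 'I_n => sigma) ** P) (tpw (fun _ : 'I_n => sigma)),
       lel (P ** tpw (fun _ : 'I_n => sigma) ** P)
           ((pow2 (n%:R * (rtr (rho ** logm sigma) + delta)))%:C%C *: P)
     & lel ((pow2 (n%:R * (rtr (rho ** logm sigma) - delta)))%:C%C *: P)
           (P ** tpw (fun _ : 'I_n => sigma) ** P)].
Proof.
move=> hr r1 hs [c c0 hc] delta0 eta0.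
have [P [mu [hP mu0 hS hf]]] := psdP hs; have [hP1 hP2] := hP.
pose p t := complex.Re (en (P ** rho ** P ^†) t t).
have pE t : en (P ** rho ** P ^†) t t = (p t)%:C%C.
  by apply: ge0_Re; apply: psd_diag_ge0; exact: psd_conj.
have p0 t : 0 <= p t by rewrite -ler0c -pE; apply: psd_diag_ge0; exact: psd_conj.
(* By domination p vanishes where mu does, so the conventional value of the logarithm at 0 never
   counts. *)
have pmu t : p t <= c * mu t.
  have := psd_diag_ge0 t (lel_conj P hc); rewrite enB pE.
  have -> : P ** (c%:C%C *: sigma) ** P ^† = c%:C%C *: dg (fun t => (mu t)%:C%C).
    by rewrite hS mmZr mmZl !mmA hP1 mm1l -mmA hP1 mm1.
  by rewrite enZ en_dg eqxx mulr1n -rmorphM subr_ge0 lecR.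
have p1 : \sum_t p t = 1.
  rewrite -r1 /p -Re_sum -tr_en -/(rtr _) rtrC mmA hP2 mm1l //.
pose h t := if 0 < mu t then log2 (mu t) else 0.
pose m := rtr (rho ** logm sigma).
have mE : m = \sum_t p t * h t.
  rewrite /m logmE hf !mmA rtrC !mmA /rtr tr_en Re_sum.
  apply: eq_bigr => t _; rewrite en_dgr pE.
  by rewrite -rmorphM.
pose g t := h t - m.
have g0 : \sum_t p t * g t = 0.
  by under eq_bigr do rewrite mulrBr; rewrite sumrB -mulr_suml p1 mul1r -mE subrr.
pose var := \sum_t p t * g t ^+ 2.
have var0 : 0 <= var by apply: sumr_ge0 => t _; rewrite mulr_ge0 ?sqr_ge0.
(* Chebyshev bounds the rejected probability by var / (n delta^2), which is at most eta from here
   on. *)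
exists (Num.truncn (var / (delta ^+ 2 * eta))).+1 => n hn.
have n0 : (0 < n)%N by exact: leq_trans hn.
have nR : 0 < n%:R :> R by rewrite ltr0n.
have hn' : var <= n%:R * (delta ^+ 2 * eta).
  rewrite -ler_pdivrMr ?mulr_gt0 ?exprn_gt0 //; apply: ltW.
  apply: lt_le_trans (truncnS_gt _) _; by rewrite ler_nat.
pose ind (x : {ffun 'I_n -> T}) : bool :=
  [forall k, 0 < mu (x k)] && (`|\sum_k g (x k)| <= n%:R * delta).
pose D := dg (fun x => ((ind x)%:R : R)%:C%C).
pose Pn := tpw (fun _ : 'I_n => P); have [hPn1 hPn2] : unit2 Pn by exact: unit2_tpw.
pose prodmu (x : {ffun 'I_n -> T}) := \prod_k mu (x k).
have sigE : tpw (fun _ : 'I_n => sigma) = Pn ^† ** dg (fun x => (prodmu x)%:C%C) ** Pn.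
  rewrite /Pn tpwA (_ : dg _ = tpw (fun _ : 'I_n => dg (fun t => (mu t)%:C%C))).
    by rewrite !tpwM -hS.
  by rewrite tpw_dg; apply: eq_dg => x; rewrite rmorph_prod.
have conjM (f1 f2 : {ffun 'I_n -> T} -> R) :
    (Pn ^† ** dg (fun x => (f1 x)%:C%C) ** Pn) ** (Pn ^† ** dg (fun x => (f2 x)%:C%C) ** Pn)
    = Pn ^† ** dg (fun x => (f1 x * f2 x)%:C%C) ** Pn.
  rewrite !mmA -(mmA _ Pn) hPn1 mm1 -(mmA _ (dg _) (dg _)) dgM.
  by congr (_ ** _ ** _); apply: eq_dg => x; rewrite rmorphM.
have conj_le (f1 f2 : {ffun 'I_n -> T} -> R) : (forall x, f1 x <= f2 x) ->
    lel (Pn ^† ** dg (fun x => (f1 x)%:C%C) ** Pn) (Pn ^† ** dg (fun x => (f2 x)%:C%C) ** Pn).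
  move=> hle; rewrite /lel -mmBl -mmBr dgB; apply: psd_conj'.
  rewrite (eq_dg (g := fun x => (f2 x - f1 x)%:C%C)) => [|x]; last by rewrite rmorphB.
  by apply: dg_psd => x; rewrite subr_ge0.
have conjZ (k : R) (f1 : {ffun 'I_n -> T} -> R) :
    k%:C%C *: (Pn ^† ** dg (fun x => (f1 x)%:C%C) ** Pn)
    = Pn ^† ** dg (fun x => (k * f1 x)%:C%C) ** Pn.
  rewrite -mmZl -mmZr dgZ; congr (_ ** _ ** _).
  by apply: eq_dg => x; rewrite rmorphM.
have prodE x : ind x -> pow2 (n%:R * (m - delta)) <= prodmu x <= pow2 (n%:R * (m + delta)).
  case/andP => /forallP pos; have -> : prodmu x = pow2 (\sum_k g (x k) + n%:R * m).
    rewrite /prodmu; have -> : n%:R * m = \sum_(k < n) m.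
      by rewrite sumr_const card_ord mulr_natl.
    rewrite -big_split /= pow2_sum; apply: eq_bigr => k _.
    by rewrite /g subrK /h pos pow2_log2.
  by rewrite ler_norml => /andP [h1 h2]; rewrite !ler_pow2; apply/andP; split; lra.
have pm0 x : 0 <= prodmu x by apply: prodr_ge0.
exists (Pn ^† ** D ** Pn); split; first split.
- by rewrite !adjE dg_adjr mmA.
- rewrite conjM; congr (_ ** _ ** _); apply: eq_dg => x.
  by case: (ind x); rewrite ?mulr1 ?mulr0.
- have -> : rtr (tpw (fun _ : 'I_n => rho) ** (Pn ^† ** D ** Pn))
          = \sum_(x : {ffun 'I_n -> T}) (\prod_k p (x k)) * (ind x)%:R.
    rewrite !mmA rtrC !mmA.
    have -> : Pn ** tpw (fun _ : 'I_n => rho) ** Pn ^† = tpw (fun _ : 'I_n => P ** rho ** P ^†).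
      by rewrite /Pn tpwA !tpwM.
    rewrite /rtr tr_en Re_sum; apply: eq_bigr => x _; rewrite en_dgr en_tpw.
    under eq_bigr do rewrite pE.
    by rewrite -rmorph_prod -rmorphM.
  have tot : \sum_(x : {ffun 'I_n -> T}) \prod_k p (x k) = 1.
    by rewrite -(bigA_distr_bigA (fun _ t => p t)) big1.
  rewrite lerBlDl -lerBlDr -{1}tot -sumrB.
  have dn0 : 0 < (n%:R * delta) ^+ 2 by rewrite exprn_gt0 ?mulr_gt0.
  apply: (@le_trans _ _ ((n%:R * var) / (n%:R * delta) ^+ 2)); last first.
    rewrite ler_pdivrMr // exprMn; apply: le_trans (ler_wpM2l (ltW nR) hn') _.
    have -> : n%:R * (n%:R * (delta ^+ 2 * eta)) = eta * (n%:R ^+ 2 * delta ^+ 2) by ring.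
    exact: lexx.
  rewrite -(second_moment _ p1 g0) mulr_suml; apply: ler_sum => x _.
  have pp0 : 0 <= \prod_k p (x k) by apply: prodr_ge0.
  case: (boolP (ind x)) => [_|].
    rewrite mulr1 subrr; apply: mulr_ge0; last by rewrite invr_ge0 sqr_ge0.
    by apply: mulr_ge0 => //; exact: sqr_ge0.
  rewrite mulr0 subr0 negb_and => /orP[|].
    rewrite negb_forall => /existsP [k hk].
    have -> : \prod_k p (x k) = 0; last by rewrite !mul0r.
    rewrite (bigD1 k) //=; have -> : p (x k) = 0; last by rewrite mul0r.
    apply/le_anti; rewrite p0 andbT; apply: le_trans (pmu _) _.
    have -> : mu (x k) = 0; last by rewrite mulr0.
    by apply/le_anti; rewrite mu0 andbT leNgt.
  rewrite -ltNge => hlt; rewrite -[leLHS]mulr1 -mulrA; apply: ler_wpM2l => //.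
  rewrite ler_pdivlMr // mul1r -(real_normK (num_real (\sum_k g (x k)))).
  have nd0 : 0 <= n%:R * delta by rewrite mulr_ge0 // ltW.
  by rewrite ler_pXn2r ?nnegrE ?nd0 ?normr_ge0 // (ltW hlt).
- rewrite sigE !conjM; apply: conj_le => x; case: (ind x); rewrite ?mulr1 ?mul1r //.
  by rewrite mulr0.
- rewrite sigE !conjM conjZ; apply: conj_le => x; case: (boolP (ind x)) => hx.
    by rewrite !mulr1 mul1r; case/andP: (prodE x hx).
  by rewrite !mulr0.
- rewrite sigE !conjM conjZ; apply: conj_le => x; case: (boolP (ind x)) => hx.
    by rewrite !mulr1 mul1r; case/andP: (prodE x hx).
  by rewrite !mulr0.
Qed.

End Typical.

(** * Smoothing, strong converse and data processing *)

Section Stein.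
Variable R : realType.
Local Notation C := (R[i]).
Local Notation rop := (rop R).
Implicit Types T U V : finType.

Local Notation "X ^⊗ n" := (tpw (fun _ : 'I_n => X)) (at level 29).

(* Meaningful only for dominated rho sigma: logm vanishes on the kernel. *)
Definition dre T (rho sigma : rop T T) : R := rtr (rho ** logm rho) - rtr (rho ** logm sigma).

Lemma dominated_refl T (rho : rop T T) : dominated rho rho.
Proof. by exists 1 => //; rewrite scale1r; exact: lel_refl. Qed.

Lemma lelZl T (k1 k2 : R) (X : rop T T) : psd X -> k1 <= k2 -> lel (k1%:C%C *: X) (k2%:C%C *: X).
Proof. by move=> h k12; rewrite /lel -scalerBl -rmorphB; apply: psdZ; rewrite ?subr_ge0. Qed.

(* The smoothed state P1 P2 rho^n P2 P1, with P2 and P1 typical for rho and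
   sigma, is the source of the strong converse. *)
Lemma smoothing T (rho sigma : rop T T) (delta eta : R) :
  psd rho -> rtr rho = 1 -> psd sigma -> dominated rho sigma ->
  0 < delta -> 0 < eta ->
  exists n0, forall n, (n0 <= n)%N -> exists F : rop {ffun 'I_n -> T} {ffun 'I_n -> T},
  [/\ psd F, lel F ((pow2 (n%:R * (dre rho sigma + delta)))%:C%C *: sigma ^⊗ n)
    & forall A, test A -> `|rtr (A ** rho ^⊗ n) - rtr (A ** F)| <= eta].
Proof.
move=> hr r1 hs hd delta0 eta0.
have d2 : 0 < delta / 2 by rewrite divr_gt0.
(* The error 4 sqrt eta' of [gentle] is then exactly eta. *)
pose eta' := (eta / 4) ^+ 2.
have e2 : 0 < eta' by rewrite exprn_gt0 // divr_gt0.
have e4 : 4 * Num.sqrt eta' = eta.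
  by rewrite /eta' sqrtr_sqr ger0_norm; [field|apply: divr_ge0 => //; exact: ltW].
have [n1 t1] := typical hr r1 hs hd d2 e2.
have [n2 t2] := typical hr r1 hr (dominated_refl rho) d2 e2.
exists (maxn n1 n2) => n; rewrite geq_max => /andP [hn1 hn2].
have [P1 [[a1 a2 a3] a4 _ a6]] := t1 n hn1.
have [P2 [[b1 b2 b3] _ b5 _]] := t2 n hn2.
have [_ tP1] := proj_test a1 a2; have [pP2 tP2] := proj_test b1 b2.
exists (P1 ** P2 ** rho ^⊗ n ** P2 ** P1); split.
- have := psd_conj (P1 ** P2) (psd_tpw n hr).
  by rewrite adjM a1 b1 mmA.
- set a := pow2 (n%:R * (rtr (rho ** logm rho) + delta / 2)) in b5.
  set b := pow2 (n%:R * (rtr (rho ** logm sigma) - delta / 2)) in a6.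
  (* The chain is F <= a P1 P2 P1 <= a P1 <= (a/b) P1 sigma^n P1 <= (a/b) sigma^n, and a/b is the
     announced factor. *)
  have s1 := lel_conj P1 b5; rewrite a1 !mmA in s1.
  have s2 : lel (P1 ** (a%:C%C *: P2) ** P1) (a%:C%C *: P1).
    rewrite mmZr mmZl; apply: lelZ; first exact/ltW/pow2_gt0.
    by have := lel_conj P1 tP2; rewrite a1 mm1 a2.
  have s3 : lel (a%:C%C *: P1) ((a / b)%:C%C *: (P1 ** sigma ^⊗ n ** P1)).
    have -> : a%:C%C *: P1 = (a / b)%:C%C *: (b%:C%C *: P1).
      by rewrite scalerA -rmorphM divfK // gt_eqF // pow2_gt0.
    by apply: lelZ => //; rewrite divr_ge0 // ltW // pow2_gt0.
  have -> : pow2 (n%:R * (dre rho sigma + delta)) = a / b.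
    by rewrite /a /b -pow2N -pow2D; congr pow2; rewrite /dre; move: (rtr _) (rtr _) => x y; clear; field.
  apply: lel_trans s1 _; apply: lel_trans s2 _; apply: lel_trans s3 _.
  by apply: lelZ => //; rewrite divr_ge0 // ltW // pow2_gt0.
move=> A hA; rewrite -e4.
exact: (gentle (psd_tpw n hr) (rtr_tpw1 n hr r1) a1 a2 b1 b2 a3 b3 hA).
Qed.

(** The achievability half of Stein's lemma, with the test P1 P2 P1. The trace of P2 is at most 1/a
    because a P2 <= rho^n, while the sigma-typical P1 caps the eigenvalues of sigma^n at b. *)
Lemma direct T (rho sigma : rop T T) (delta eta : R) :
  psd rho -> rtr rho = 1 -> psd sigma -> dominated rho sigma ->
  0 < delta -> 0 < eta ->
  exists n0, forall n, (n0 <= n)%N -> exists A : rop {ffun 'I_n -> T} {ffun 'I_n -> T},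
  [/\ test A, 1 - eta <= rtr (A ** rho ^⊗ n)
    & rtr (A ** sigma ^⊗ n) <= pow2 (- (n%:R * (dre rho sigma - delta)))].
Proof.
move=> hr r1 hs hd delta0 eta0.
have d2 : 0 < delta / 2 by rewrite divr_gt0.
pose eta' := (eta / 4) ^+ 2.
have e2 : 0 < eta' by rewrite exprn_gt0 // divr_gt0.
have e4 : 4 * Num.sqrt eta' = eta.
  by rewrite /eta' sqrtr_sqr ger0_norm; [field|apply: divr_ge0 => //; exact: ltW].
have [n1 t1] := typical hr r1 hs hd d2 e2.
have [n2 t2] := typical hr r1 hr (dominated_refl rho) d2 e2.
exists (maxn n1 n2) => n; rewrite geq_max => /andP [hn1 hn2].
have [P1 [[a1 a2 a3] _ a5 _]] := t1 n hn1.
have [P2 [[b1 b2 b3] b4 _ b6]] := t2 n hn2.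
have tP1 := proj_test a1 a2; have tP2 := proj_test b1 b2.
have hrn := psd_tpw n hr; have r1n := rtr_tpw1 n hr r1.
exists (P1 ** P2 ** P1); split; first exact: test_conj.
- have := gentle hrn r1n b1 b2 a1 a2 b3 a3 (test1 R _); rewrite e4 !mm1l r1n.
  rewrite ler_norml => /andP [_]; suff -> : rtr (P2 ** P1 ** rho ^⊗ n ** P1 ** P2)
    = rtr (P1 ** P2 ** P1 ** rho ^⊗ n) by lra.
  by rewrite rtrC !mmA b2 rtrC !mmA.
- have -> : rtr (P1 ** P2 ** P1 ** sigma ^⊗ n) = rtr (P2 ** (P1 ** sigma ^⊗ n ** P1)).
    by rewrite -!mmA rtrC !mmA.
  apply: le_trans (lel_rtr tP2.1 a5) _; rewrite mmZr rtrZ.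
  set b := pow2 (n%:R * (rtr (rho ** logm sigma) + delta / 2)).
  set a := pow2 (n%:R * (rtr (rho ** logm rho) - delta / 2)) in b6.
  have hP2 : rtr (P2 ** P1) <= a^-1.
    rewrite rtrC; apply: le_trans (test_le1 tP1 tP2.1) _.
    have := lel_rtr (psd1 R _) (lel_trans b6 b4).
    by rewrite !mm1l rtrZ r1n mulrC -ler_pdivlMr ?pow2_gt0 // mul1r.
  apply: le_trans (ler_wpM2l (ltW (pow2_gt0 _)) hP2) _.
  have -> : - (n%:R * (dre rho sigma - delta)) =
     n%:R * (rtr (rho ** logm sigma) + delta / 2) + - (n%:R * (rtr (rho ** logm rho) - delta / 2)).
    by rewrite /dre; move: (rtr _) (rtr _) => x y; clear; field.
  by rewrite pow2D pow2N.
Qed.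

(** The smoothed operator stands in for rho^n at the price eta, and it lies below a multiple of
    sigma^n. Nothing is assumed on the acceptance probability, so the bound is effective at every
    error below 1. *)
Lemma strong_converse T (rho sigma : rop T T) (delta eta : R) :
  psd rho -> rtr rho = 1 -> psd sigma -> dominated rho sigma ->
  0 < delta -> 0 < eta ->
  exists n0, forall n, (n0 <= n)%N -> forall A : rop {ffun 'I_n -> T} {ffun 'I_n -> T},
  test A -> rtr (A ** rho ^⊗ n) - eta <= pow2 (n%:R * (dre rho sigma + delta)) * rtr (A ** sigma ^⊗ n).
Proof.
move=> hr r1 hs hd d0 e0; have [n0 h] := smoothing hr r1 hs hd d0 e0.
exists n0 => n /h [F [hF1 hF2 hF3]] A hA.
have := hF3 A hA; rewrite ler_norml => /andP [_].
have := lel_rtr hA.1 hF2; rewrite mmZr rtrZ; lra.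
Qed.

(* Data processing, obtained operationally: a test between rho^n and sigma^n
   pulls back to one between rho'^n and sigma'^n. *)
Lemma dre_mono T U (rho' sigma' : rop T T) (rho sigma : rop U U) :
  psd rho' -> rtr rho' = 1 -> psd sigma' -> dominated rho' sigma' ->
  psd rho -> rtr rho = 1 -> psd sigma -> dominated rho sigma ->
  (forall n (A : rop {ffun 'I_n -> U} {ffun 'I_n -> U}), test A ->
     exists B : rop {ffun 'I_n -> T} {ffun 'I_n -> T},
     [/\ test B, rtr (B ** rho' ^⊗ n) = rtr (A ** rho ^⊗ n)
       & rtr (B ** sigma' ^⊗ n) = rtr (A ** sigma ^⊗ n)]) ->
  dre rho sigma <= dre rho' sigma'.
Proof.
move=> hr' r1' hs' hd' hr r1 hs hd hT; rewrite leNgt; apply/negP => hlt.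
pose D := dre rho sigma; pose D' := dre rho' sigma'.
(* With this slack the two exponents differ by 2 n delta, at least 2 for the chosen n, whereas the
   errors 1/8 leave an acceptance of 3/4 that would have to be at most 1/2. *)
pose delta := (D - D') / 4.
have d0 : 0 < delta by rewrite divr_gt0 // subr_gt0.
have q0 : 0 < 8^-1 :> R by rewrite invr_gt0.
have [n1 h1] := direct hr r1 hs hd d0 q0.
have [n2 h2] := strong_converse hr' r1' hs' hd' d0 q0.
pose n := maxn (maxn n1 n2) (Num.truncn (delta^-1)).+1.
have [A [tA e1 e2]] := h1 n (leq_trans (leq_maxl _ _) (leq_maxl _ _)).
have [B [tB f1 f2]] := hT n A tA.
have := h2 n (leq_trans (leq_maxr _ _) (leq_maxl _ _)) B tB.
rewrite f1 f2 -/D' => hh.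
have hn : 1 <= n%:R * delta.
  rewrite -ler_pdivrMr // mul1r; apply/ltW.
  by apply: lt_le_trans (truncnS_gt _) _; rewrite ler_nat leq_maxr.
have k1 : pow2 (n%:R * (D' + delta)) * rtr (A ** sigma ^⊗ n) <=
          pow2 (n%:R * (D' + delta)) * pow2 (- (n%:R * (D - delta))).
  by apply: ler_wpM2l; rewrite // ltW // pow2_gt0.
have k2 : pow2 (n%:R * (D' + delta)) * pow2 (- (n%:R * (D - delta))) <= pow2 (- 1).
  rewrite -pow2D ler_pow2.
  have -> : n%:R * (D' + delta) + - (n%:R * (D - delta)) = - (2 * (n%:R * delta)).
    by rewrite /delta; field.
  by rewrite lerN2; move: hn; clear; lra.
have k3 : pow2 (- 1) = 2^-1 :> R.
  by rewrite pow2N /pow2 mul1r lnK // posrE.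
have := le_trans hh (le_trans k1 k2); rewrite k3; lra.
Qed.

(** The terms of an expanded power have different factors, which is why [tpw] takes a family of
    matrices. *)
Lemma tpw_sum n T U (J : finType) (F : J -> rop T U) :
  tpw (fun _ : 'I_n => \sum_j F j) = \sum_(f : {ffun 'I_n -> J}) tpw (fun k => F (f k)).
Proof.
apply: en_inj => p q; rewrite en_tpw en_sum.
under eq_bigr do rewrite en_sum.
by rewrite bigA_distr_bigA; apply: eq_bigr => f _; rewrite en_tpw.
Qed.

Definition kraus T U (J : finType) (K : J -> rop U T) (X : rop T T) : rop U U :=
  \sum_j K j ** X ** (K j) ^†.

Lemma kraus_tpw n T U (J : finType) (K : J -> rop U T) (X : rop T T) :
  (kraus K X) ^⊗ n = kraus (fun f : {ffun 'I_n -> J} => tpw (fun k => K (f k))) (X ^⊗ n).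
Proof. by rewrite tpw_sum; apply: eq_bigr => f _; rewrite tpwA !tpwM. Qed.

Lemma psd_kraus T U (J : finType) (K : J -> rop U T) (X : rop T T) :
  psd X -> psd (kraus K X).
Proof. by move=> h; apply: psd_sum => j _; exact: psd_conj. Qed.

Definition krausA T U (J : finType) (K : J -> rop U T) (A : rop U U) : rop T T :=
  \sum_j (K j) ^† ** A ** K j.

Lemma kraus_adj T U (J : finType) (K : J -> rop U T) (A : rop U U) (X : rop T T) :
  ctr (krausA K A ** X) = ctr (A ** kraus K X).
Proof.
rewrite mm_suml mm_sumr !tr_sum; apply: eq_bigr => j _.
by rewrite -!mmA trC !mmA.
Qed.

Lemma test_krausA T U (J : finType) (K : J -> rop U T) (A : rop U U) :
  \sum_j (K j) ^† ** K j = Id -> test A -> test (krausA K A).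
Proof.
move=> hK [h1 h2]; split; first by apply: psd_sum => j _; exact: psd_conj'.
rewrite -hK -sumrB; apply: psd_sum => j _.
have -> : (K j) ^† ** K j - (K j) ^† ** A ** K j = (K j) ^† ** (Id - A) ** K j.
  by rewrite mmBr mm1 mmBl.
exact: psd_conj'.
Qed.

Lemma dominated_kraus T U (J : finType) (K : J -> rop U T) (rho sigma : rop T T) :
  dominated rho sigma -> dominated (kraus K rho) (kraus K sigma).
Proof.
move=> [c c0 hc]; exists c => //; rewrite /lel /kraus scaler_sumr -sumrB.
apply: psd_sum => j _; have := lel_conj (K j) hc.
by rewrite /lel mmZr mmZl.
Qed.

Lemma rtr_kraus T U (J : finType) (K : J -> rop U T) (X : rop T T) :
  \sum_j (K j) ^† ** K j = Id -> rtr (kraus K X) = rtr X.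
Proof.
move=> hK; rewrite /rtr -[kraus K X]mm1l -kraus_adj /krausA.
by under eq_bigr do rewrite mm1; rewrite hK mm1l.
Qed.

(** The adjoint of the n-fold map carries tests to tests: completeness of the Kraus operators makes
    it unital. *)
Lemma dre_kraus T U (J : finType) (K : J -> rop U T) (rho sigma : rop T T) :
  \sum_j (K j) ^† ** K j = Id ->
  psd rho -> rtr rho = 1 -> psd sigma -> dominated rho sigma ->
  dre (kraus K rho) (kraus K sigma) <= dre rho sigma.
Proof.
move=> hK hr r1 hs hd; apply: dre_mono => //.
- exact: psd_kraus.
- by rewrite rtr_kraus.
- exact: psd_kraus.
- exact: dominated_kraus.
move=> n A tA; exists (krausA (fun f : {ffun 'I_n -> J} => tpw (fun k => K (f k))) A).
rewrite /rtr !kraus_adj !kraus_tpw; split=> //.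
apply: test_krausA => //.
rewrite -(tpw1 R n T) -hK tpw_sum; apply: eq_bigr => f _.
by rewrite tpwA tpwM.
Qed.

Lemma n2_eq0 T U (X : rop T U) : n2 X = 0 -> X = 0.
Proof.
move=> h; have h' : ctr (X ^† ** X) = 0 by rewrite (ge0_Re (tr_gram X)) -/(rtr _) -/(n2 X) h.
apply: en_inj => s t; rewrite en0; move: h'; rewrite tr_en.
have nn t' : 0 <= en (X ^† ** X) t' t'.
  by rewrite enM; apply: sumr_ge0 => s' _; rewrite enA mulrC mul_conjC_ge0.
move/eqP; rewrite psumr_eq0 // => /allP /(_ t (mem_index_enum _)) /=.
rewrite enM psumr_eq0 => [|s' _]; last by rewrite enA mulrC mul_conjC_ge0.
move=> /allP /(_ s (mem_index_enum _)) /=; rewrite enA mulrC.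
by rewrite mul_conjC_eq0 => /eqP.
Qed.

Lemma psd_anti T (X : rop T T) : psd X -> psd (- X) -> X = 0.
Proof.
move=> h1 h2; have [Y [hY hX]] := psd_ex h1.
suff Y0 : Y = 0 by rewrite hX Y0 mm0.
apply: n2_eq0; rewrite /n2 hY -hX; apply/le_anti; rewrite (rtr_psd h1) andbT.
by rewrite -oppr_ge0 -rtrN; exact: rtr_psd.
Qed.

(** For X = Y^2 the hypothesis says that K Y (K Y)^† vanishes, hence K Y = 0. *)
Lemma psd_kernel T U (K : rop U T) (X : rop T T) : psd X -> K ** X ** K ^† = 0 -> K ** X = 0.
Proof.
move=> /psd_ex [Y [hY ->]] h.
have h0 : K ** Y = 0.
  suff : (K ** Y) ^† = 0 by move/(congr1 (@adj _ _ _)); rewrite adjK adj0.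
  apply: n2_eq0; rewrite /n2 adjK adjM hY !mmA -(mmA K) h.
  exact: rtr0.
by rewrite mmA h0 mm0l.
Qed.

Lemma dominated_ker T (rho sigma : op R T) : psd rho -> dominated rho sigma ->
  (kermx sigma <= kermx rho)%MS.
Proof.
move=> hr [c c0 hc]; apply/sub_kermxP; set K := kermx sigma.
have hK : (K : rop T T) ** sigma = 0 by rewrite mm.unlock mulmx_ker.
suff : (K : rop T T) ** rho = 0 by rewrite mm.unlock.
apply: psd_kernel => //; apply: psd_anti; first exact: psd_conj.
by have := lel_conj (K : rop T T) hc; rewrite mmZr hK scaler0 mm0l /lel sub0r.
Qed.

Lemma psd_le_tr T (X : rop T T) : psd X -> lel X ((rtr X)%:C%C *: Id).
Proof.
move=> hX; have [P [d [[h1 h2] d0 hS _]]] := psdP hX.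
have tX : rtr X = \sum_t d t by rewrite {1}hS rtrC mmA h1 mm1l rtr_dg.
rewrite /lel tX hS -h2 -{1}(mm1 (P ^†)) -dg1 -mmZl -mmZr -mmBl -mmBr dgZ dgB.
apply: psd_conj'; rewrite (eq_dg (g := fun t => (\sum_t d t - d t)%:C%C)).
  by apply: dg_psd => t; rewrite (bigD1 t) //= addrC addrK sumr_ge0.
by move=> t; rewrite mulr1 rmorphB.
Qed.

(** rho is unchanged by compression to the support of sigma, where it is at most tr rho times the
    support projection, and this projection is at most a multiple of sigma. *)
Lemma ker_dominated T (rho sigma : op R T) : psd rho -> psd sigma ->
  (kermx sigma <= kermx rho)%MS -> dominated rho sigma.
Proof.
move=> hr hs /sub_kermxP hk; have [P [mu [[h1 h2] mu0 hS _]]] := psdP hs.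
pose S := dg (fun t => ((mu t != 0)%:R : R)%:C%C).
pose N := P ^† ** dg (fun t => ((mu t == 0)%:R : R)%:C%C) ** P.
have hN0 : N ** rho = 0.
  have : N ** sigma = 0.
    rewrite hS /N !mmA -(mmA _ P) h1 mm1 -(mmA _ (dg _) (dg _)) dgM.
    suff -> : dg (fun t => ((mu t == 0)%:R : R)%:C%C * (mu t)%:C%C) = 0 by rewrite mm0 mm0l.
    apply: en_inj => s t; rewrite en_dg en0; case: eqP => [->|_].
      by rewrite mulr0 mul0rn.
    by rewrite mul0r mul0rn.
  rewrite mm.unlock => /eqP; rewrite -sub_kermx => /submxP [M ->].
  by rewrite -mulmxA hk mulmx0.
have hN : Id - N = P ^† ** S ** P.
  rewrite /N -h2 -{1}(mm1 (P ^†)) -dg1 -mmBl -mmBr dgB; congr (_ ** _ ** _).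
  by apply: eq_dg => t; case: eqP => _ /=; rewrite ?subrr ?subr0.
have hrho : rho = (Id - N) ** rho ** (Id - N)^†.
  have hNa : N ^† = N by rewrite /N !adjE dg_adjr mmA.
  have hrN : rho ** N = 0.
    by have := congr1 (@adj _ _ _) hN0; rewrite adjM hNa (psd_herm hr) adj0.
  by rewrite adjB adj1 hNa mmBl hN0 subr0 mm1l mmBr hrN subr0 mm1.
(* As 0^-1 = 0, the sum runs over the nonzero eigenvalues only; it bounds the largest inverse among
   them. *)
pose c := rtr rho * \sum_t (mu t)^-1.
have s0 t : 0 <= (mu t)^-1 by rewrite invr_ge0.
have t0 : 0 <= rtr rho by exact: rtr_psd.
exists c; first by rewrite mulr_ge0 // sumr_ge0.
rewrite hrho; apply: lel_trans (lel_conj _ (psd_le_tr hr)) _.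
rewrite mmZr mm1 mmZl hN hS /lel.
have -> : P ^† ** S ** P ** (P ^† ** S ** P) ^† = P ^† ** S ** P.
  rewrite !adjE dg_adjr !mmA -(mmA _ P) h1 mm1 -(mmA _ S S) dgM.
  by congr (_ ** _ ** _); apply: eq_dg => t; case: eqP => _ /=; rewrite ?mulr1 ?mulr0.
rewrite -mmZl -mmZr -mmZl -mmZr -mmBl -mmBr /S !dgZ dgB; apply: psd_conj'.
rewrite (eq_dg (g := fun t => (c * mu t - rtr rho * (mu t != 0)%:R)%:C%C)); last first.
  by move=> t; rewrite rmorphB !rmorphM.
apply: dg_psd => t; case: (eqVneq (mu t) 0) => [->|nz] /=; first by rewrite !mulr0 subrr.
rewrite mulr1 subr_ge0 /c -mulrA -[leLHS]mulr1; apply: ler_wpM2l => //.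
rewrite (bigD1 t) //= mulrDl mulVf // lerDl mulr_ge0 // sumr_ge0 //.
Qed.

Lemma relentE T (rho sigma : op R T) : psd rho -> dominated rho sigma ->
  relent rho sigma = (dre rho sigma)%:E.
Proof.
move=> hr hd; rewrite /relent dominated_ker // trE mmE.
by rewrite mmBr -/(rtr _) rtrB.
Qed.

Lemma relent_fin T (rho sigma : op R T) : psd rho -> psd sigma ->
  relent rho sigma != +oo%E -> dominated rho sigma.
Proof.
move=> hr hs; rewrite /relent; case: ifP => // h _; exact: ker_dominated.
Qed.

End Stein.

(** * Relabelling of systems, duality of the positive cone, Kronecker products *)

Section Reindex.
Variable R : realType.
Local Notation C := (R[i]).
Local Notation rop := (rop R).
Implicit Types T U V : finType.

Lemma munitE T (s t : T) : munit R s t = mk (fun x y => ((x == s) && (y == t))%:R).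
Proof. by rewrite /munit mkopE. Qed.

Lemma en_munit T (s t x y : T) : en (munit R s t) x y = ((x == s) && (y == t))%:R.
Proof. by rewrite munitE en_mk. Qed.

Lemma sum_pick T (f : T -> C) (s : T) : \sum_x f x * (x == s)%:R = f s.
Proof.
rewrite (bigD1 s) //= eqxx mulr1 big1 ?addr0 // => x /negPf ->; exact: mulr0.
Qed.

Lemma sum_pick_sym T (f : T -> C) (s : T) : \sum_x f x * (s == x)%:R = f s.
Proof. by under eq_bigr do rewrite eq_sym; exact: sum_pick. Qed.

Lemma sum_pick2 T U (f : T -> U -> C) (s : T) (t : U) :
  \sum_x \sum_y f x y * ((x == s) && (y == t))%:R = f s t.
Proof.
transitivity (\sum_x f x t * (x == s)%:R); last exact: (sum_pick (f^~ t)).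
apply: eq_bigr => x _; rewrite -(sum_pick (fun y => f x y * (x == s)%:R) t).
by apply: eq_bigr => y _; rewrite -mulrA -natrM mulnb.
Qed.

Lemma sum_pick2_sym T U (f : T -> U -> C) (s : T) (t : U) :
  \sum_x \sum_y f x y * ((s == x) && (t == y))%:R = f s t.
Proof.
rewrite -[RHS]sum_pick2; apply: eq_bigr => x _; apply: eq_bigr => y _.
by rewrite (eq_sym s) (eq_sym t).
Qed.

Lemma sum_pair T U (F : T * U -> C) : \sum_p F p = \sum_i \sum_j F (i, j).
Proof. by rewrite pair_bigA; apply: eq_bigr; case. Qed.

Lemma op_decomp T (X : rop T T) : X = \sum_s \sum_t en X s t *: munit R s t.
Proof.
apply: en_inj => x y; rewrite en_sum -[LHS](sum_pick2_sym (en X)).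
by apply: eq_bigr => s _; rewrite en_sum; apply: eq_bigr => t _; rewrite enZ en_munit.
Qed.

(** For bijective f this identifies two systems and respects products and traces. For arbitrary f it
    is conjugation by the 0-1 matrix of f, so it still preserves positivity. *)
Definition reidx T U (f : T -> U) (X : rop U U) : rop T T :=
  mk (fun s t => en X (f s) (f t)).

Lemma en_reidx T U (f : T -> U) X s t : en (reidx f X) s t = en X (f s) (f t).
Proof. exact: en_mk. Qed.

Lemma reidx_psd T U (f : T -> U) X : psd X -> psd (reidx f X).
Proof.
move=> h; pose V : rop T U := mk (fun s u => (u == f s)%:R).
suff -> : reidx f X = V ** X ** V ^† by exact: psd_conj.
apply: en_inj => s t; rewrite en_reidx enM -(sum_pick (fun u => en X (f s) u) (f t)).
apply: eq_bigr => u _; rewrite enA en_mk conjC_nat enM; congr (_ * _).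
rewrite -[LHS](sum_pick (fun u' => en X u' u) (f s)).
by apply: eq_bigr => u' _; rewrite en_mk mulrC.
Qed.

Lemma reidxB T U (f : T -> U) X Y : reidx f (X - Y) = reidx f X - reidx f Y.
Proof. by apply: en_inj => s t; rewrite enB !en_reidx enB. Qed.

Lemma reidxZ T U (f : T -> U) a X : reidx f (a *: X) = a *: reidx f X.
Proof. by apply: en_inj => s t; rewrite enZ !en_reidx enZ. Qed.

Lemma reidx_sum T U (f : T -> U) I (r : seq I) (F : I -> rop U U) :
  reidx f (\sum_(i <- r) F i) = \sum_(i <- r) reidx f (F i).
Proof.
apply: en_inj => s t; rewrite en_reidx !en_sum.
by apply: eq_bigr => i _; rewrite en_reidx.
Qed.

Lemma reidxK T U (f : T -> U) (g : U -> T) X : cancel g f -> reidx g (reidx f X) = X.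
Proof. by move=> h; apply: en_inj => s t; rewrite !en_reidx !h. Qed.

Lemma lel_reidx T U (f : T -> U) X Y : lel X Y -> lel (reidx f X) (reidx f Y).
Proof. by move=> h; rewrite /lel -reidxB; exact: reidx_psd. Qed.

Lemma reidx_adj T U (f : T -> U) X : (reidx f X) ^† = reidx f (X ^†).
Proof. by apply: en_inj => s t; rewrite enA !en_reidx enA. Qed.

Section Bij.
Variables (T U : finType) (f : T -> U).
Hypothesis hf : bijective f.

Lemma reidx1 : reidx f Id = Id.
Proof. by apply: en_inj => s t; rewrite en_reidx !en1 (bij_eq hf). Qed.

Lemma reidxM X Y : reidx f (X ** Y) = reidx f X ** reidx f Y.
Proof.
apply: en_inj => s t; rewrite en_reidx !enM (reindex f) /=; last exact: onW_bij.
by apply: eq_bigr => u _; rewrite !en_reidx.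
Qed.

Lemma ctr_reidx X : ctr (reidx f X) = ctr X.
Proof.
rewrite !tr_en [RHS](reindex f) /=; last exact: onW_bij.
by apply: eq_bigr => u _; rewrite !en_reidx.
Qed.

Lemma rtr_reidx X : rtr (reidx f X) = rtr X.
Proof. by rewrite /rtr ctr_reidx. Qed.

Lemma test_reidx A : test A -> test (reidx f A).
Proof. by case=> h1 h2; split; [|rewrite -reidx1 -reidxB]; exact: reidx_psd. Qed.

End Bij.

Lemma ctrM_en T (X Y : rop T T) : ctr (X ** Y) = \sum_s \sum_t en X s t * en Y t s.
Proof. by rewrite tr_en; apply: eq_bigr => s _; rewrite enM. Qed.

(** Polarisation on vectors supported on {s, t}: coefficients (1,0) and (0,1) kill the diagonal,
    (1,1) and (1,i) the two off-diagonal entries. *)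
Lemma qf_eq0 T (Y : rop T T) : (forall v, qf Y v = 0) -> Y = 0.
Proof.
move=> h; apply: en_inj => s t; rewrite en0.
pose e (a b : C) (x : T) : C := a * (x == s)%:R + b * (x == t)%:R.
have qe a b : qf Y (e a b) = a * a^* * en Y s s + a * b^* * en Y s t
                           + b * a^* * en Y t s + b * b^* * en Y t t.
  rewrite /qf /e.
  have conjn (n : nat) : (n%:R : C)^* = n%:R by exact: conjC_nat.
  transitivity (\sum_x \sum_y ((a * a^* * en Y x y) * ((x == s) && (y == s))%:R
      + (a * b^* * en Y x y) * ((x == s) && (y == t))%:R
      + (b * a^* * en Y x y) * ((x == t) && (y == s))%:R
      + (b * b^* * en Y x y) * ((x == t) && (y == t))%:R)).
    apply: eq_bigr => x _; apply: eq_bigr => y _.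
    rewrite rmorphD /= !conjM !conjn -!mulnb !natrM; ring.
  under eq_bigr do rewrite !big_split /=.
  by rewrite !big_split /= !sum_pick2.
have hss : en Y s s = 0.
  by have := h (e 1 0); rewrite qe conjC1 conjC0 !(mulr0, mul0r, mul1r, addr0).
have htt : en Y t t = 0.
  by have := h (e 0 1); rewrite qe conjC1 conjC0 !(mulr0, mul0r, mul1r, addr0, add0r).
have h1 := h (e 1 1); rewrite qe hss htt conjC1 !(mulr1, mul1r, mulr0, add0r, addr0) in h1.
have h2 := h (e 1 'i%C); rewrite qe hss htt conjC1 !(mulr1, mul1r, mulr0, add0r, addr0) in h2.
have ci : ('i%C : C)^* = - 'i%C.
  by apply/eqP; rewrite conjc_complex eq_complex /= oppr0 !eqxx.
have i0 : ('i%C : C) != 0 by rewrite eq_complex /= negb_and oner_eq0 orbT.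
have h3 : en Y t s = en Y s t.
  apply: (mulfI i0); apply/eqP; rewrite -subr_eq0; apply/eqP.
  by rewrite -[RHS]h2 ci; ring.
have h4 : 2 * en Y s t = 0 by rewrite -[RHS]h1 h3; ring.
by move/eqP: h4; rewrite mulf_eq0 pnatr_eq0 /= => /eqP.
Qed.

Lemma qf_adj T (X : rop T T) v : qf (X ^†) v = (qf X v)^*.
Proof.
rewrite /qf rmorph_sum exchange_big /=; apply: eq_bigr => s _.
rewrite rmorph_sum; apply: eq_bigr => t _.
by rewrite enA /= !conjM conjK; ring.
Qed.

(** Over the complex numbers hermiticity is automatic: a real-valued form makes the form of X^† - X
    vanish. *)
Lemma psd_qf_intro T (X : rop T T) : (forall v, 0 <= qf X v) -> psd X.
Proof.
move=> h; apply: psd_intro => //; apply/eqP; rewrite -subr_eq0; apply/eqP.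
apply: qf_eq0 => v.
have -> : qf (X ^† - X) v = qf (X ^†) v - qf X v.
  rewrite /qf -sumrB; apply: eq_bigr => s _; rewrite -sumrB.
  by apply: eq_bigr => t _; rewrite enB; ring.
by rewrite qf_adj (ge0_Re (h v)) conjc_complex conjc_real subrr.
Qed.

Definition ketbra T (v : T -> C) : rop T T := mk (fun s t => (v s)^* * v t).

Lemma ketbra_psd T (v : T -> C) : psd (ketbra v).
Proof.
have -> : ketbra v = (mk (fun (_ : unit) t => v t) : rop unit T) ^†
                     ** (mk (fun (_ : unit) t => v t)).
  apply: en_inj => s t; rewrite en_mk enM (bigD1 tt) //= big1 ?addr0.
    by rewrite enA !en_mk.
  by case.
exact: psd_gram.
Qed.

Lemma ctr_ketbra T (X : rop T T) v : ctr (X ** ketbra v) = qf X v.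
Proof.
rewrite ctrM_en /qf; apply: eq_bigr => s _; apply: eq_bigr => t _.
by rewrite en_mk; ring.
Qed.

Lemma psd_dual T (X : rop T T) : (forall Y, psd Y -> 0 <= ctr (X ** Y)) -> psd X.
Proof.
move=> h; apply: psd_qf_intro => v; rewrite -ctr_ketbra; apply: h; exact: ketbra_psd.
Qed.

(** Turns an acceptance probability, known only as a linear functional, into an operator; tests are
    pulled back through superchannels this way, without computing an adjoint. *)
Lemma riesz T (phi : rop T T -> C) :
  (forall a X Y, phi (a *: X + Y) = a * phi X + phi Y) ->
  exists L : rop T T, forall X, phi X = ctr (L ** X).
Proof.
move=> lphi; exists (mk (fun s t => phi (munit R t s))) => X.
have phi0 : phi 0 = 0.
  have := lphi (-1) 0 0; rewrite scaler0 addr0 mulN1r => ->; ring.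
have phiD X1 X2 : phi (X1 + X2) = phi X1 + phi X2.
  by rewrite -{1}(scale1r X1) lphi mul1r.
have phis I (r : seq I) (F : I -> rop T T) : phi (\sum_(i <- r) F i) = \sum_(i <- r) phi (F i).
  by elim/big_rec2: _ => [|i x y _ <-] //; rewrite phiD.
have phiZ a X1 : phi (a *: X1) = a * phi X1.
  by rewrite -[a *: X1]addr0 lphi phi0 addr0.
rewrite {1}(op_decomp X) phis ctrM_en exchange_big /=; apply: eq_bigr => s _.
by rewrite phis; apply: eq_bigr => t _; rewrite phiZ en_mk mulrC.
Qed.

Definition trp T (X : rop T T) : rop T T := mk (fun s t => en X t s).

Lemma trp_psd T (X : rop T T) : psd X -> psd (trp X).
Proof.
move=> /psd_ex [Y [hY ->]].
pose Z : rop T T := mk (fun u s => (en Y u s)^*).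
have -> : trp (Y ** Y) = Z ^† ** Z; last exact: psd_gram.
apply: en_inj => s t; rewrite en_mk -{1}hY !enM; apply: eq_bigr => u _.
by rewrite !enA !en_mk conjK mulrC.
Qed.

Definition kron T1 T2 U1 U2 (X : rop T1 U1) (Y : rop T2 U2) :
  rop (T1 * T2) (U1 * U2) :=
  mk (fun p q => en X p.1 q.1 * en Y p.2 q.2).

Lemma en_kron T1 T2 U1 U2 (X : rop T1 U1) (Y : rop T2 U2) p q :
  en (kron X Y) p q = en X p.1 q.1 * en Y p.2 q.2.
Proof. exact: en_mk. Qed.

Lemma kronM T1 T2 U1 U2 V1 V2 (X : rop T1 U1) (Y : rop T2 U2) (X' : rop U1 V1) (Y' : rop U2 V2) :
  kron X Y ** kron X' Y' = kron (X ** X') (Y ** Y').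
Proof.
apply: en_inj => p q; rewrite enM en_kron !enM mulr_suml.
rewrite sum_pair; apply: eq_bigr => i _; rewrite mulr_sumr; apply: eq_bigr => j _.
by rewrite !en_kron /=; ring.
Qed.

Lemma kron_adj T1 T2 U1 U2 (X : rop T1 U1) (Y : rop T2 U2) : (kron X Y) ^† = kron (X ^†) (Y ^†).
Proof. by apply: en_inj => p q; rewrite enA !en_kron !enA conjM. Qed.

Lemma kron1 T U : kron Id Id = Id :> rop (T * U) (T * U).
Proof. by apply: en_inj => -[a b] [c d]; rewrite en_kron !en1 -natrM mulnb. Qed.

Lemma kron_psd T U (X : rop T T) (Y : rop U U) : psd X -> psd Y -> psd (kron X Y).
Proof.
move=> /psd_ex [A [hA ->]] /psd_ex [B [hB ->]].
have -> : kron (A ** A) (B ** B) = (kron A B) ^† ** kron A B by rewrite kron_adj hA hB kronM.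
exact: psd_gram.
Qed.

Lemma ctr_kron T U (X : rop T T) (Y : rop U U) : ctr (kron X Y) = ctr X * ctr Y.
Proof.
rewrite !tr_en mulr_suml sum_pair.
by apply: eq_bigr => i _; rewrite mulr_sumr; apply: eq_bigr => j _; rewrite en_kron.
Qed.

Lemma tens_kron T U (X : op R T) (Y : op R U) : tens X Y = kron X Y.
Proof. by rewrite tensE. Qed.

End Reindex.

(** * Choi matrices *)

Section Choi.
Variable R : realType.
Local Notation C := (R[i]).
Local Notation rop := (rop R).
Implicit Types T U V S O K E : finType.

Definition lin S O (M : op R S -> op R O) :=
  forall a X Y, M (a *: X + Y) = a *: M X + M Y.

Lemma lin_sum S O (M : op R S -> op R O) : lin M ->
  forall I (r : seq I) (F : I -> op R S), M (\sum_(i <- r) F i) = \sum_(i <- r) M (F i).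
Proof.
move=> l I r F.
have M0 : M 0 = 0 by have := l (-1) 0 0; rewrite scaler0 addr0 scaleN1r => ->; rewrite addNr.
elim/big_rec2: _ => [|i x y _ <-] //.
by rewrite -{1}(scale1r (F i)) l scale1r.
Qed.

Lemma linZ S O (M : op R S -> op R O) a X : lin M -> M (a *: X) = a *: M X.
Proof.
move=> l; have M0 : M 0 = 0.
  by have := l (-1) 0 0; rewrite scaler0 addr0 scaleN1r => ->; rewrite addNr.
by rewrite -[a *: X]addr0 l M0 addr0.
Qed.

Definition J S O (M : op R S -> op R O) : rop (S * O) (S * O) :=
  mk (fun p q => en (M (munit R p.1 q.1)) p.2 q.2).

Lemma en_J S O (M : op R S -> op R O) p q : en (J M) p q = en (M (munit R p.1 q.1)) p.2 q.2.
Proof. exact: en_mk. Qed.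

(** The inverse of [J] on linear maps. Channels are built from it out of operators, such as a
    smoothed Choi state. *)
Definition app S O (X : rop (S * O) (S * O)) : op R S -> op R O :=
  fun Z => mk (fun o o' => \sum_s \sum_t en Z s t * en X (s, o) (t, o')).

Lemma en_app S O (X : rop (S * O) (S * O)) Z o o' :
  en (app X Z) o o' = \sum_s \sum_t en Z s t * en X (s, o) (t, o').
Proof. exact: en_mk. Qed.

Lemma app_lin S O (X : rop (S * O) (S * O)) : lin (app X).
Proof.
move=> a Y Z; apply: en_inj => o o'; rewrite enD enZ !en_app mulr_sumr -big_split.
apply: eq_bigr => s _; rewrite mulr_sumr -big_split; apply: eq_bigr => t _ /=.
by rewrite enD enZ; ring.
Qed.

Lemma J_app S O (X : rop (S * O) (S * O)) : J (app X) = X.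
Proof.
apply: en_inj => -[s o] [t o']; rewrite en_J en_app /=.
rewrite -[RHS](sum_pick2 (fun x y => en X (x, o) (y, o'))).
by apply: eq_bigr => x _; apply: eq_bigr => y _; rewrite en_munit mulrC.
Qed.

Lemma app_J S O (M : op R S -> op R O) Z : lin M -> app (J M) Z = M Z.
Proof.
move=> l; apply: en_inj => o o'; rewrite en_app {2}(op_decomp Z) lin_sum // en_sum.
apply: eq_bigr => s _; rewrite lin_sum // en_sum; apply: eq_bigr => t _.
by rewrite linZ // enZ en_J.
Qed.

(** The link product of quantum combs, contracting S. With a state on the left it applies a map to
    half of it ([tensmap_link]), with a Choi matrix it composes maps ([J_comp]), so a single
    positivity lemma covers both. *)
Definition link K S O (X : rop (K * S) (K * S)) (Y : rop (S * O) (S * O))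
  : rop (K * O) (K * O) :=
  mk (fun a b => \sum_s \sum_t en X (a.1, s) (b.1, t) * en Y (s, a.2) (t, b.2)).

Lemma en_link K S O (X : rop (K * S) (K * S)) (Y : rop (S * O) (S * O)) a b :
  en (link X Y) a b = \sum_s \sum_t en X (a.1, s) (b.1, t) * en Y (s, a.2) (t, b.2).
Proof. exact: en_mk. Qed.

Lemma link_psd K S O (X : rop (K * S) (K * S)) (Y : rop (S * O) (S * O)) :
  psd X -> psd Y -> psd (link X Y).
Proof.
move=> /psd_ex [A [hA ->]] /psd_ex [B [hB ->]].
pose G : rop ((K * S) * (S * O)) (K * O) :=
  mk (fun w a => \sum_s en A w.1 (a.1, s) * en B w.2 (s, a.2)).
suff -> : link (A ** A) (B ** B) = G ^† ** G by exact: psd_gram.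
apply: en_inj => a b; rewrite en_link enM.
transitivity (\sum_(w : (K * S) * (S * O)) \sum_s \sum_t
   ((en A w.1 (a.1, s))^* * (en B w.2 (s, a.2))^*) * (en A w.1 (b.1, t) * en B w.2 (t, b.2))).
  rewrite [RHS]exchange_big /=; apply: eq_bigr => s _.
  rewrite [RHS]exchange_big /=; apply: eq_bigr => t _.
  rewrite -{1}hA -{1}hB !enM mulr_suml.
  rewrite [RHS]sum_pair; apply: eq_bigr => w1 _; rewrite mulr_sumr; apply: eq_bigr => w2 _.
  by rewrite !enA; ring.
apply: eq_bigr => w _; rewrite enA !en_mk rmorph_sum mulr_suml; apply: eq_bigr => s _.
by rewrite mulr_sumr; apply: eq_bigr => t _; rewrite /= conjM.
Qed.

Lemma linkD K S O (X : rop (K * S) (K * S)) a (Y Z : rop (S * O) (S * O)) :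
  link X (a *: Y + Z) = a *: link X Y + link X Z.
Proof.
apply: en_inj => p q; rewrite enD enZ !en_link mulr_sumr -big_split.
apply: eq_bigr => s _; rewrite mulr_sumr -big_split; apply: eq_bigr => t _ /=.
by rewrite enD enZ; ring.
Qed.

Lemma tensmap_link K S O (M : op R S -> op R O) (X : op R (K * S)) :
  tensmap (@idfun (op R K)) M X = link X (J M).
Proof.
apply: en_inj => -[k o] [k' o']; rewrite en_tensmap en_link /=.
rewrite sum_pair exchange_big /=; apply: eq_bigr => s _.
transitivity (\sum_x \sum_y (\sum_t en X (x, s) (y, t) * en (M (munit R s t)) o o')
     * ((k == x) && (k' == y))%:R).
  apply: eq_bigr => x _.
  rewrite sum_pair; apply: eq_bigr => y _; rewrite mulr_suml; apply: eq_bigr => t _.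
  by rewrite en_munit; ring.
rewrite (sum_pick2_sym (fun x y => \sum_t en X (x, s) (y, t) * en (M (munit R s t)) o o')).
by apply: eq_bigr => t _; rewrite en_J.
Qed.

Definition tp S O (M : op R S -> op R O) := forall X, ctr (M X) = ctr X.

Lemma is_channelI S O (M : op R S -> op R O) : lin M -> psd (J M) -> tp M -> is_channel M.
Proof.
move=> l p t; split=> // [X|k X hX]; first by rewrite !trE.
by rewrite tensmap_link; exact: link_psd.
Qed.

Lemma channel_lin S O (M : op R S -> op R O) : is_channel M -> lin M.
Proof. by case. Qed.

Lemma channel_tp S O (M : op R S -> op R O) : is_channel M -> tp M.
Proof. by case=> _ h _ X; rewrite -!trE. Qed.

Definition maxent S : rop (S * S) (S * S) := mk (fun p q => ((p.1 == p.2) && (q.1 == q.2))%:R).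

Lemma maxent_psd S : psd (maxent S).
Proof.
have -> : maxent S = ketbra (fun p : S * S => (p.1 == p.2)%:R).
  by apply: en_inj => p q; rewrite !en_mk conjC_nat -natrM mulnb.
exact: ketbra_psd.
Qed.

Lemma J_id S : J (@idfun (op R S)) = maxent S.
Proof.
apply: en_inj => -[a b] [c d]; rewrite en_J en_mk en_munit /=.
by rewrite (eq_sym b) (eq_sym d).
Qed.

(** Complete positivity is applied to the unnormalised maximally entangled operator. Its reference
    system is numbered, because [is_channel] only speaks of references ['I_k]. *)
Lemma channel_J S O (M : op R S -> op R O) : is_channel M -> psd (J M).
Proof.
move=> [l _ h].
have := h #|S| (reidx (fun p => (enum_val p.1, p.2)) (maxent S)) (reidx_psd _ (maxent_psd S)).
rewrite tensmap_link => /(reidx_psd (fun p : S * O => (enum_rank p.1, p.2))).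
suff -> : reidx (fun p : S * O => (enum_rank p.1, p.2))
  (link (reidx (fun p : 'I_#|S| * S => (enum_val p.1, p.2)) (maxent S)) (J M)) = J M by [].
apply: en_inj => -[s o] [t o']; rewrite en_reidx en_link /=.
rewrite -[RHS](sum_pick2_sym (fun x y => en (J M) (x, o) (y, o'))).
apply: eq_bigr => x _; apply: eq_bigr => y _.
by rewrite en_reidx en_mk /= !enum_rankK mulrC.
Qed.

Lemma J_comp S O V (F : op R S -> op R O) (G : op R O -> op R V) :
  lin G -> J (G \o F) = link (J F) (J G).
Proof.
move=> l; apply: en_inj => p q; rewrite en_J en_link /= -(app_J _ l) en_app.
by apply: eq_bigr => x _; apply: eq_bigr => y _; rewrite !en_J.
Qed.

Lemma tensmap_lin T1 T2 U1 U2 (F : op R T1 -> op R U1) (G : op R T2 -> op R U2) :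
  lin (tensmap F G).
Proof.
move=> a X Y; apply: en_inj => u u'; rewrite enD enZ !en_tensmap mulr_sumr -big_split.
apply: eq_bigr => p _; rewrite mulr_sumr -big_split; apply: eq_bigr => q _ /=.
by rewrite enD enZ; ring.
Qed.

Lemma en_J_tensmap T1 T2 U1 U2 (F : op R T1 -> op R U1) (G : op R T2 -> op R U2) p q :
  en (J (tensmap F G)) p q = en (J F) (p.1.1, p.2.1) (q.1.1, q.2.1)
                           * en (J G) (p.1.2, p.2.2) (q.1.2, q.2.2).
Proof.
rewrite en_J en_tensmap !en_J /=.
rewrite -[RHS](sum_pick2 (fun x y => en (F (munit R x.1 y.1)) p.2.1 q.2.1
   * en (G (munit R x.2 y.2)) p.2.2 q.2.2) p.1 q.1).
by apply: eq_bigr => x _; apply: eq_bigr => y _; rewrite en_munit mulrC.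
Qed.

Lemma J_tensmap_psd T1 T2 U1 U2 (F : op R T1 -> op R U1) (G : op R T2 -> op R U2) :
  psd (J F) -> psd (J G) -> psd (J (tensmap F G)).
Proof.
move=> hF hG; suff -> : J (tensmap F G) =
   reidx (fun p => ((p.1.1, p.2.1), (p.1.2, p.2.2))) (kron (J F) (J G)).
  by apply: reidx_psd; exact: kron_psd.
by apply: en_inj => p q; rewrite en_J_tensmap en_reidx en_kron.
Qed.

Lemma tensmap_tp T1 T2 U1 U2 (F : op R T1 -> op R U1) (G : op R T2 -> op R U2) :
  tp F -> tp G -> tp (tensmap F G).
Proof.
move=> hF hG X; rewrite !tr_en.
have trm T (s t : T) : ctr (munit R s t) = (s == t)%:R.
  rewrite tr_en -(sum_pick_sym (fun x => (x == t)%:R) s).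
  by apply: eq_bigr => x _; rewrite en_munit -natrM mulnb (eq_sym s) andbC.
transitivity (\sum_p \sum_q en X p q * (ctr (F (munit R p.1 q.1)) * ctr (G (munit R p.2 q.2)))).
  under eq_bigr do rewrite en_tensmap; rewrite exchange_big /=; apply: eq_bigr => p _.
  rewrite exchange_big /=; apply: eq_bigr => q _; rewrite -mulr_sumr; congr (_ * _).
  rewrite !tr_en mulr_suml sum_pair.
  by apply: eq_bigr => i _; rewrite mulr_sumr.
apply: eq_bigr => p _; rewrite -[RHS](sum_pick_sym (en X p) p); apply: eq_bigr => q _.
by rewrite hF hG !trm -natrM mulnb; congr (_ * _%:R).
Qed.

End Choi.

(** * Testing channels *)

Section ChannelTests.
Variable R : realType.
Local Notation C := (R[i]).
Local Notation rop := (rop R).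
Implicit Types T U V S O K E : finType.

(* tau^T (x) 1: on Choi matrices it computes the trace of the output on tau. *)
Definition Kt S O (tau : rop S S) : rop (S * O) (S * O) :=
  mk (fun p q => en tau q.1 p.1 * (q.2 == p.2)%:R).

Lemma ctr_Kt S O (tau : rop S S) (X : rop (S * O) (S * O)) :
  ctr (Kt O tau ** X) = ctr (app X tau).
Proof.
rewrite ctrM_en exchange_big sum_pair tr_en /= exchange_big; apply: eq_bigr => o _.
rewrite en_app /=; apply: eq_bigr => s _; rewrite sum_pair; apply: eq_bigr => t _.
rewrite -[RHS](sum_pick_sym (fun o' => en tau s t * en X (s, o) (t, o')) o).
by apply: eq_bigr => o' _; rewrite en_mk /=; ring.
Qed.

(* (L, tau) represents the experiment feeding a state with marginal tau into a
   channel M and testing the output: the acceptance probability is tr (L J_M). *)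
Definition ctest S O (L : rop (S * O) (S * O)) (tau : rop S S) :=
  [/\ psd L, psd (Kt O tau - L) & ctr tau = 1].

Definition swp T U (p : T * U) : U * T := (p.2, p.1).

(** Both sides are one sum over two indices of each of K, S and O, up to the renaming [h]. The
    adjoint of linking with rho is thus again a link product, hence positive. *)
Lemma link_dual K S O (rho : rop (K * S) (K * S)) (A : rop (K * O) (K * O))
    (X : rop (S * O) (S * O)) :
  ctr (link (reidx (@swp S K) (trp rho)) A ** X) = ctr (A ** link rho X).
Proof.
rewrite !ctrM_en.
transitivity (\sum_(w : ((S * O) * (S * O)) * (K * K))
   en rho (w.2.2, w.1.2.1) (w.2.1, w.1.1.1) * en A (w.2.1, w.1.1.2) (w.2.2, w.1.2.2)
   * en X w.1.2 w.1.1).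
  rewrite [RHS]sum_pair [RHS]sum_pair; apply: eq_bigr => p _; apply: eq_bigr => q _.
  rewrite [RHS]sum_pair en_link mulr_suml; apply: eq_bigr => k _.
  by rewrite mulr_suml; apply: eq_bigr => k' _; rewrite en_reidx en_mk.
transitivity (\sum_(w : ((K * O) * (K * O)) * (S * S))
   en rho (w.1.2.1, w.2.1) (w.1.1.1, w.2.2) * en A w.1.1 w.1.2
   * en X (w.2.1, w.1.2.2) (w.2.2, w.1.1.2)); last first.
  rewrite [LHS]sum_pair [LHS]sum_pair; apply: eq_bigr => a _; apply: eq_bigr => b _.
  rewrite [LHS]sum_pair en_link mulr_sumr; apply: eq_bigr => s _.
  by rewrite mulr_sumr; apply: eq_bigr => t _ /=; ring.
pose h (w : ((K * O) * (K * O)) * (S * S)) : ((S * O) * (S * O)) * (K * K) :=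
  (((w.2.2, w.1.1.2), (w.2.1, w.1.2.2)), (w.1.1.1, w.1.2.1)).
pose g (w : ((S * O) * (S * O)) * (K * K)) : ((K * O) * (K * O)) * (S * S) :=
  (((w.2.1, w.1.1.2), (w.2.2, w.1.2.2)), (w.1.2.1, w.1.1.1)).
rewrite (reindex h); last by exists g => -[[[? ?] [? ?]] [? ?]] _.
by apply: eq_bigr => -[[[? ?] [? ?]] [? ?]] _.
Qed.

Lemma link_psd_dual K S O (rho : rop (K * S) (K * S)) (A : rop (K * O) (K * O)) :
  psd rho -> psd A -> psd (link (reidx (@swp S K) (trp rho)) A).
Proof. by move=> h1 h2; apply: link_psd => //; apply: reidx_psd; exact: trp_psd. Qed.

Definition marg K S (rho : rop (K * S) (K * S)) : rop S S :=
  mk (fun s t => \sum_k en rho (k, s) (k, t)).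

Lemma ctr_marg K S (rho : rop (K * S) (K * S)) : ctr (marg rho) = ctr rho.
Proof.
rewrite !tr_en sum_pair exchange_big; apply: eq_bigr => s _.
by rewrite en_mk.
Qed.

(** Linking with the identity instead of A gives [Kt] of the marginal, so the complement is the link
    with 1 - A. *)
Lemma state_ctest K S O (rho : rop (K * S) (K * S)) (A : rop (K * O) (K * O)) :
  psd rho -> ctr rho = 1 -> test A ->
  ctest (link (reidx (@swp S K) (trp rho)) A) (marg rho).
Proof.
move=> h1 h2 [a1 a2]; split; [exact: link_psd_dual| |by rewrite ctr_marg].
suff -> : Kt O (marg rho) - link (reidx (@swp S K) (trp rho)) A
   = link (reidx (@swp S K) (trp rho)) (Id - A) by exact: link_psd_dual.
have -> : Id - A = (-1) *: A + Id by rewrite scaleN1r addrC.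
rewrite linkD scaleN1r addrC; congr (_ + _); apply: en_inj => p q; rewrite en_link !en_mk mulr_suml.
apply: eq_bigr => k _.
rewrite -[LHS](sum_pick_sym (fun k' => en rho (k', q.1) (k, p.1) * (q.2 == p.2)%:R) k).
apply: eq_bigr => k' _; rewrite en_reidx en_mk en1 /= xpair_eqE.
by rewrite -mulrA -natrM mulnb andbC (eq_sym q.2).
Qed.

Lemma ctr_tensmap K S O (rho : rop (K * S) (K * S)) (A : rop (K * O) (K * O))
    (M : op R S -> op R O) :
  ctr (link (reidx (@swp S K) (trp rho)) A ** J M) = ctr (A ** tensmap (@idfun (op R K)) M rho).
Proof. by rewrite tensmap_link link_dual. Qed.

Lemma supapp_app_lin S' S O O' (e : nat) (P : op R S' -> op R ('I_e * S))
    (Q : op R ('I_e * O) -> op R O') a (X Y : rop (S * O) (S * O)) :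
  lin Q -> J (supapp P Q (app (a *: X + Y))) =
           a *: J (supapp P Q (app X)) + J (supapp P Q (app Y)).
Proof.
move=> hQ; apply: en_inj => p q; rewrite enD enZ !en_J /supapp !tensmap_link.
by rewrite !J_app linkD hQ enD enZ.
Qed.

Lemma supapp_psd S' S O O' (e : nat) (P : op R S' -> op R ('I_e * S))
    (Q : op R ('I_e * O) -> op R O') (M : op R S -> op R O) :
  lin Q -> psd (J P) -> psd (J Q) -> psd (J M) -> psd (J (supapp P Q M)).
Proof.
move=> l hP hQ hM.
have -> : J (supapp P Q M) = J (Q \o (tensmap (@idfun (op R 'I_e)) M \o P)) by [].
rewrite J_comp //; apply: link_psd => //; rewrite J_comp; last exact: tensmap_lin.
apply: link_psd => //; apply: J_tensmap_psd => //; rewrite J_id; exact: maxent_psd.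
Qed.

Lemma supapp_lin S' S O O' (e : nat) (P : op R S' -> op R ('I_e * S))
    (Q : op R ('I_e * O) -> op R O') (M : op R S -> op R O) :
  lin P -> lin Q -> lin (supapp P Q M).
Proof. by move=> l1 l2 a X Y; rewrite /supapp l1 tensmap_lin l2. Qed.

Lemma supapp_channel S' S O O' (e : nat) (P : op R S' -> op R ('I_e * S))
    (Q : op R ('I_e * O) -> op R O') (M : op R S -> op R O) :
  is_channel P -> is_channel Q -> is_channel M -> is_channel (supapp P Q M).
Proof.
move=> hP hQ hM; apply: is_channelI.
- by apply: supapp_lin; exact: channel_lin.
- by apply: supapp_psd; [exact: channel_lin|exact: channel_J..].
- move=> X; rewrite /supapp (channel_tp hQ) tensmap_tp ?(channel_tp hP) //.
  exact: channel_tp.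
Qed.

Lemma appD S O (X Y : rop (S * O) (S * O)) a Z :
  app (a *: X + Y) Z = a *: app X Z + app Y Z.
Proof.
apply: en_inj => o o'; rewrite enD enZ !en_app mulr_sumr -big_split.
apply: eq_bigr => s _; rewrite mulr_sumr -big_split; apply: eq_bigr => t _ /=.
by rewrite enD enZ; ring.
Qed.

(** L represents the acceptance probability as a functional of the Choi matrix of M; its positivity
    follows by duality. For the complement, Q preserves the trace, so accepting everything pulls
    back to accepting everything, with the marginal on S of P tau' as new input. *)
Lemma ctest_pullback S' S O O' (e : nat) (P : op R S' -> op R ('I_e * S))
    (Q : op R ('I_e * O) -> op R O') (L' : rop (S' * O') (S' * O')) tau' :
  is_channel P -> is_channel Q -> ctest L' tau' ->
  exists L tau, ctest L tau /\
    forall M : op R S -> op R O, lin M -> ctr (L ** J M) = ctr (L' ** J (supapp P Q M)).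
Proof.
move=> hP hQ [l1 l2 l3].
have lQ := channel_lin hQ; have lP := channel_lin hP.
have [L hL] := riesz (phi := fun X => ctr (L' ** J (supapp P Q (app X)))) (fun a X Y =>
  eq_trans (congr1 (fun Z => ctr (L' ** Z)) (supapp_app_lin P a X Y lQ))
   (eq_trans (congr1 (fun Z => ctr Z) (mmDr L' _ _)) (eq_trans (trD _ _)
     (congr1 (fun Z => Z + _) (eq_trans (congr1 (fun Z => ctr Z) (mmZr _ _ _)) (trZ _ _)))))).
have pos X : psd X -> psd (J (supapp P Q (app X))).
  by move=> hX; apply: supapp_psd; rewrite ?J_app //; exact: channel_J.
exists L, (marg (P tau')); split.
  split.
  - by apply: psd_dual => X hX; rewrite -hL; exact: tr_psdM l1 (pos _ hX).
  - apply: psd_dual => X hX; rewrite mmBl trD trN -hL ctr_Kt.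
    have -> : ctr (app X (marg (P tau'))) = ctr (Kt O' tau' ** J (supapp P Q (app X))).
      rewrite ctr_Kt app_J; last exact: supapp_lin.
      rewrite /supapp (channel_tp hQ) tensmap_link J_app !tr_en sum_pair exchange_big.
      apply: eq_bigr => o _; rewrite en_app; under [RHS]eq_bigr do rewrite en_link.
      rewrite [RHS]exchange_big; apply: eq_bigr => s _.
      rewrite [RHS]exchange_big; apply: eq_bigr => t _ /=.
      by rewrite en_mk mulr_suml.
    rewrite -trN -trD -mmBl; exact: tr_psdM l2 (pos _ hX).
  - by rewrite ctr_marg (channel_tp hP).
move=> M lM; rewrite -hL; congr (ctr (L' ** _)).
by apply: en_inj => p q; rewrite !en_J /supapp !tensmap_link J_app.
Qed.

Lemma sum_enum_val V (F : V -> C) : \sum_(i : 'I_#|V|) F (enum_val i) = \sum_v F v.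
Proof. by rewrite sum_ord; apply: eq_bigr => v _; rewrite enum_rankK. Qed.

Section Branch.
Variables (Y' Y X' X K : finType) (omega : rop (K * X') (K * X')).
Hypothesis homega : psd omega.
Hypothesis tomega : ctr omega = 1.

Local Notation E := ((Y' * K)%type : finType).
Local Notation ev := (@enum_val E predT).

(** The preparation stores the input Z and the reference part of omega in the memory and sends the
    rest of omega into the channel. The memory Y' K is numbered because memories of superchannels
    are ordinals. *)
Definition brP (Z : op R Y') : op R ('I_(#|E|) * X') :=
  reidx (fun p : 'I_(#|E|) * X' => ((ev p.1).1, ((ev p.1).2, p.2))) (kron Z omega).

Lemma brP_channel : is_channel brP.
Proof.
apply: is_channelI.
- move=> a Z1 Z2; apply: en_inj => p q.
  by rewrite enD enZ !en_reidx !en_kron enD enZ mulrDl mulrA.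
- suff -> : J brP = reidx (fun p : Y' * ('I_(#|E|) * X') =>
      (((ev p.2.1).1, p.1), ((ev p.2.1).2, p.2.2))) (kron (maxent R Y') omega).
    by apply: reidx_psd; apply: kron_psd => //; exact: maxent_psd.
  by apply: en_inj => p q; rewrite en_J en_reidx !en_reidx !en_kron en_munit en_mk.
- move=> Z; rewrite tr_en sum_pair.
  pose F (v : E) : C := \sum_x en Z v.1 v.1 * en omega (v.2, x) (v.2, x).
  transitivity (\sum_i F (ev i)).
    by apply: eq_bigr => i _; apply: eq_bigr => x _; rewrite en_reidx en_kron.
  rewrite sum_enum_val sum_pair -[RHS]mulr1 -tomega !tr_en mulr_suml.
  apply: eq_bigr => y _; rewrite mulr_sumr [RHS]sum_pair; apply: eq_bigr => k _.
  by apply: eq_bigr => x _.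
Qed.

(** The branch of outcome B: it weighs the memory's K part and the channel output by the effect B
    and returns the stored Z. Its Choi matrix is an identity channel on Y' beside the transposed
    effect. *)
Definition brT (B : rop (K * X) (K * X)) : op R ('I_(#|E|) * X) -> op R Y' :=
  app (reidx (fun p : ('I_(#|E|) * X) * Y' => (((ev p.1.1).1, p.2), ((ev p.1.1).2, p.1.2)))
    (kron (maxent R Y') (trp B))).

Lemma brTE B (W : op R ('I_(#|E|) * X)) z z' :
  en (brT B W) z z' = \sum_k \sum_k' \sum_x \sum_x'
    en W (enum_rank (z, k), x) (enum_rank (z', k'), x') * en B (k', x') (k, x).
Proof.
pose F (v w : E) : C := \sum_x \sum_x' en W (enum_rank v, x) (enum_rank w, x')
    * ((v.1 == z) && (w.1 == z'))%:R * en B (w.2, x') (v.2, x).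
rewrite en_app.
transitivity (\sum_i \sum_j F (ev i) (ev j)).
  rewrite sum_pair; apply: eq_bigr => i _.
  under eq_bigr do rewrite sum_pair; rewrite exchange_big; apply: eq_bigr => j _.
  apply: eq_bigr => x _; apply: eq_bigr => x' _.
  by rewrite en_reidx en_kron !en_mk !enum_valK /=; ring.
under eq_bigr do rewrite sum_enum_val.
rewrite (sum_enum_val (fun v => \sum_w F v w)) sum_pair exchange_big; apply: eq_bigr => k _.
under eq_bigr do rewrite sum_pair exchange_big; rewrite exchange_big.
apply: eq_bigr => k' _.
rewrite -[RHS](sum_pick2 (fun y y' => \sum_x \sum_x' en W (enum_rank (y, k), x)
   (enum_rank (y', k'), x') * en B (k', x') (k, x)) z z').
apply: eq_bigr => y _; apply: eq_bigr => y' _; rewrite mulr_suml; apply: eq_bigr => x _.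
by rewrite mulr_suml; apply: eq_bigr => x' _ /=; ring.
Qed.

Lemma brT_psd B : psd B -> psd (J (brT B)).
Proof.
move=> h; rewrite J_app; apply: reidx_psd; apply: kron_psd; first exact: maxent_psd.
exact: trp_psd.
Qed.

Lemma brTD B1 B2 W : brT (B1 + B2) W = brT B1 W + brT B2 W.
Proof.
apply: en_inj => z z'; rewrite enD !brTE.
rewrite -big_split; apply: eq_bigr => k _ /=; rewrite -big_split; apply: eq_bigr => k' _ /=.
rewrite -big_split; apply: eq_bigr => x _ /=; rewrite -big_split; apply: eq_bigr => x' _ /=.
by rewrite enD mulrDr.
Qed.

Lemma brT1_tp : tp (brT Id).
Proof.
move=> W; rewrite !tr_en.
transitivity (\sum_z \sum_k \sum_x en W (enum_rank (z, k), x) (enum_rank (z, k), x)).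
  apply: eq_bigr => z _; rewrite brTE; apply: eq_bigr => k _.
  rewrite exchange_big; apply: eq_bigr => x _.
  rewrite -(sum_pick2_sym (fun k' x' => en W (enum_rank (z, k), x) (enum_rank (z, k'), x')) k x).
  apply: eq_bigr => k' _; apply: eq_bigr => x' _.
  by rewrite en1 xpair_eqE (eq_sym k) (eq_sym x).
rewrite [RHS]sum_pair -(sum_pair (fun v : E => \sum_x en W (enum_rank v, x) (enum_rank v, x))).
rewrite -sum_enum_val; apply: eq_bigr => i _; apply: eq_bigr => x _.
by rewrite enum_valK.
Qed.

Lemma brT_meas B (M : op R X' -> op R X) Z :
  brT B (tensmap (@idfun (op R 'I_(#|E|))) M (brP Z)) =
  ctr (B ** tensmap (@idfun (op R K)) M omega) *: Z.
Proof.
apply: en_inj => z z'; rewrite brTE enZ ctrM_en.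
rewrite [X in _ = X * _]exchange_big [X in _ = X * _]sum_pair [RHS]mulr_suml.
apply: eq_bigr => k _.
transitivity (\sum_k' \sum_x \sum_x' en (tensmap (@idfun (op R K)) M omega) (k, x) (k', x')
   * en B (k', x') (k, x) * en Z z z').
  apply: eq_bigr => k' _; apply: eq_bigr => x _; apply: eq_bigr => x' _.
  rewrite !tensmap_link !en_link !mulr_suml; apply: eq_bigr => s _.
  rewrite !mulr_suml; apply: eq_bigr => t _.
  by rewrite en_reidx en_kron /= !enum_rankK /=; ring.
rewrite exchange_big mulr_suml; apply: eq_bigr => x _ /=.
rewrite sum_pair mulr_suml; apply: eq_bigr => k' _.
rewrite mulr_suml; apply: eq_bigr => x' _; ring.
Qed.

(* Measure the test A on (id (x) M)(omega) and apply K1 or K0 accordingly. *)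
Lemma branch (A : rop (K * X) (K * X)) (K1 K0 : op R Y' -> op R Y) :
  test A -> is_channel K1 -> is_channel K0 -> (0 < #|Y'|)%N -> (0 < #|K|)%N ->
  exists (e : nat) (P : op R Y' -> op R ('I_e * X')) (Q : op R ('I_e * X) -> op R Y),
    is_superchannel P Q /\ forall M Z, supapp P Q M Z =
      ctr (A ** tensmap (@idfun (op R K)) M omega) *: K1 Z
    + ctr ((Id - A) ** tensmap (@idfun (op R K)) M omega) *: K0 Z.
Proof.
move=> [hA hA'] h1 h0 y0 k0.
have l1 := channel_lin h1; have l0 := channel_lin h0.
have lT B : lin (brT B) by exact: app_lin.
exists #|E|, brP, (fun W => K1 (brT A W) + K0 (brT (Id - A) W)); split; last first.
  by move=> M Z; rewrite /supapp !brT_meas (linZ _ _ l1) (linZ _ _ l0).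
split; first by rewrite card_prod muln_gt0 y0.
  exact: brP_channel.
apply: is_channelI.
- move=> a W1 W2; rewrite !lT l1 l0 scalerDr !addrA; congr (_ + _).
  by rewrite -!addrA; congr (_ + _); rewrite addrC.
- have -> : J (fun W => K1 (brT A W) + K0 (brT (Id - A) W)) =
      J (K1 \o brT A) + J (K0 \o brT (Id - A)).
    by apply: en_inj => p q; rewrite enD !en_J enD.
  by apply: psdD; rewrite J_comp //; apply: link_psd; by [exact: brT_psd|exact: channel_J].
- move=> W; rewrite trD (channel_tp h1) (channel_tp h0) -trD -brTD.
  by rewrite addrC subrK brT1_tp.
Qed.

End Branch.

End ChannelTests.

(** * Purified distance through tests; replacement channels and maximally entangled inputs *)

Section OneShotTools.
Variable R : realType.
Local Notation C := (R[i]).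
Local Notation rop := (rop R).
Implicit Types T U V S O K E : finType.

Lemma stateE T (X : op R T) : state X <-> psd X /\ ctr X = 1.
Proof. by rewrite /state trE. Qed.

Lemma rtr1 T (X : rop T T) : ctr X = 1 -> rtr X = 1.
Proof. by rewrite /rtr => ->. Qed.

Lemma chan_out_psd K S O (M : op R S -> op R O) (rho : op R (K * S)) :
  is_channel M -> psd rho -> psd (tensmap (@idfun (op R K)) M rho).
Proof. by move=> h hr; rewrite tensmap_link; apply: link_psd => //; exact: channel_J. Qed.

Lemma chan_out_tr K S O (M : op R S -> op R O) (rho : op R (K * S)) :
  is_channel M -> ctr rho = 1 -> ctr (tensmap (@idfun (op R K)) M rho) = 1.
Proof. by move=> h hr; rewrite tensmap_tp //; exact: channel_tp. Qed.

(** By [fid_ge] every output fidelity is at least (1 - delta)^2 >= 1 - 2 delta >= 1 - eps^2. *)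
Lemma pdist_bound S O (M1 M2 : op R S -> op R O) (eps delta : R) :
  is_channel M1 -> is_channel M2 -> 0 <= eps -> delta <= 1 -> 2 * delta <= eps ^+ 2 ->
  (forall r (rho : op R ('I_r * S)) A, psd rho -> ctr rho = 1 -> test A ->
     rtr (A ** tensmap (@idfun (op R 'I_r)) M1 rho)
     - rtr (A ** tensmap (@idfun (op R 'I_r)) M2 rho) <= delta) ->
  (pdist M1 M2 <= eps%:E)%E.
Proof.
move=> c1 c2 e0 d1 de h; apply: ge_ereal_sup => _ [r [rho [r0 /stateE [hr tr1] ->]]].
rewrite lee_fin.
set X := tensmap _ M1 rho; set Y := tensmap _ M2 rho.
have : (1 - delta) ^+ 2 <= fid X Y.
  apply: fid_ge => //; try exact: chan_out_psd; try exact/rtr1/chan_out_tr.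
  by move=> A hA; exact: h.
move=> hf; rewrite -(ger0_norm e0) -sqrtr_sqr ler_wsqrtr //.
have := sqr_ge0 delta; move: hf de; clear; rewrite sqrrB; lra.
Qed.

Lemma link_reidx (K K' S O : finType) (f : K' -> K) (X : rop (K * S) (K * S)) (Y : rop (S * O) (S * O)) :
  link (reidx (fun p : K' * S => (f p.1, p.2)) X) Y = reidx (fun p : K' * O => (f p.1, p.2)) (link X Y).
Proof.
apply: en_inj => a b; rewrite en_reidx !en_link; apply: eq_bigr => s _.
by apply: eq_bigr => t _; rewrite en_reidx.
Qed.

Lemma bij_pair1 (K K' S : finType) (f : K' -> K) : bijective f ->
  bijective (fun p : K' * S => (f p.1, p.2)).
Proof.
case=> g h1 h2; exists (fun p => (g p.1, p.2)) => -[a b] /=; by rewrite ?h1 ?h2.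
Qed.

(** [fid_le] for outputs of fidelity at least 1 - eps^2, after numbering the reference K as [pdist]
    requires. *)
Lemma pdist_test K S O (M1 M2 : op R S -> op R O) (eps : R) (rho : op R (K * S)) A :
  is_channel M1 -> is_channel M2 -> 0 <= eps -> (pdist M1 M2 <= eps%:E)%E ->
  (0 < #|K|)%N -> psd rho -> ctr rho = 1 -> test A ->
  Num.sqrt (1 - eps ^+ 2) <=
    Num.sqrt (rtr (A ** tensmap (@idfun (op R K)) M2 rho))
    + Num.sqrt (1 - rtr (A ** tensmap (@idfun (op R K)) M1 rho)).
Proof.
move=> c1 c2 e0 hp k0 hr tr1 hA.
have bK := enum_val_bij K.
pose f (U : finType) (p : 'I_#|K| * U) : K * U := (enum_val p.1, p.2).
have bf U : bijective (@f U) by exact: bij_pair1.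
pose rho' : op R ('I_#|K| * S) := reidx (@f S) rho.
have hr' : psd rho' by exact: reidx_psd.
have tr' : ctr rho' = 1 by rewrite (ctr_reidx (bf S)).
pose X (M : op R S -> op R O) := tensmap (@idfun (op R 'I_#|K|)) M rho'.
have XE M : X M = reidx (@f O) (tensmap (@idfun (op R K)) M rho).
  by rewrite /X !tensmap_link link_reidx.
have hA' : test (reidx (@f O) A) := test_reidx (bf O) hA.
have fl : 1 - eps ^+ 2 <= fid (X M1) (X M2).
  have : ((Num.sqrt (1 - fid (X M1) (X M2)))%:E <= pdist M1 M2)%E.
    by apply: ereal_sup_ubound; exists #|K|, rho'; split=> //; apply/stateE.
  move=> /le_trans /(_ hp); rewrite lee_fin => hs.
  (* If 1 - F were negative its square root would be 0 by convention and carry no information, but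
     then F > 1 and the bound holds. *)
  case: (lerP 0 (1 - fid (X M1) (X M2))) => [p|n]; last first.
    by have := sqr_ge0 eps; move: n; clear; lra.
  have : 1 - fid (X M1) (X M2) <= eps ^+ 2.
    by rewrite -(sqr_sqrtr p) ler_pXn2r ?nnegrE ?sqrtr_ge0.
  by clear; lra.
apply: le_trans (ler_wsqrtr fl) _.
have q1 : psd (X M1) by exact: chan_out_psd.
have q2 : psd (X M2) by exact: chan_out_psd.
have t1 : rtr (X M1) = 1 by exact/rtr1/chan_out_tr.
have t2 : rtr (X M2) = 1 by exact/rtr1/chan_out_tr.
have := fid_le q1 q2 t1 t2 hA'.
by rewrite mmBl mm1l rtrB t1 !XE -!(reidxM (bf O)) !(rtr_reidx (bf O)).
Qed.

Lemma rep_piE T U (X : op R T) : rep_pi U X = (ctr X / #|U|%:R) *: Id.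
Proof. by rewrite /rep_pi trE idtE. Qed.

Lemma rep_pi_lin T U : lin (@rep_pi R T U).
Proof. by move=> a X Y; rewrite !rep_piE trD trZ mulrDl scalerDl -mulrA scalerA. Qed.

Lemma ctr_munit T (s t : T) : ctr (munit R s t) = (s == t)%:R.
Proof.
rewrite tr_en -(sum_pick_sym (fun x => (x == t)%:R) s).
by apply: eq_bigr => x _; rewrite en_munit -natrM mulnb (eq_sym s) andbC.
Qed.

Lemma J_rep_pi T U : J (@rep_pi R T U) = (#|U|%:R)^-1 *: Id.
Proof.
apply: en_inj => -[s o] [t o']; rewrite en_J rep_piE ctr_munit !enZ !en1 /=.
by rewrite xpair_eqE -mulnb natrM; ring.
Qed.

Lemma natrC (n : nat) : (n%:R : C) = (n%:R : R)%:C%C.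
Proof. by rewrite rmorph_nat. Qed.

Lemma invC (k : R) : (k%:C%C)^-1 = (k^-1)%:C%C.
Proof. by rewrite fmorphV. Qed.

Lemma J_rep_pi_psd T U : psd (J (@rep_pi R T U)).
Proof. by rewrite J_rep_pi natrC invC; apply: psdZ; rewrite ?invr_ge0 //; exact: psd1. Qed.

Lemma ctr_Id T : ctr (Id : rop T T) = #|T|%:R.
Proof.
rewrite tr_en; under eq_bigr do rewrite en1 eqxx.
by rewrite sumr_const -mulr_natl mulr1.
Qed.

Lemma rep_pi_channel T U : (0 < #|U|)%N -> is_channel (@rep_pi R T U).
Proof.
move=> u0; apply: is_channelI; [exact: rep_pi_lin|exact: J_rep_pi_psd|].
move=> X; rewrite rep_piE trZ ctr_Id divfK // pnatr_eq0 -lt0n //.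
Qed.

Lemma tensmap_channel T1 T2 U1 U2 (F : op R T1 -> op R U1) (G : op R T2 -> op R U2) :
  is_channel F -> is_channel G -> is_channel (tensmap F G).
Proof.
move=> hF hG; apply: is_channelI; first exact: tensmap_lin.
  by apply: J_tensmap_psd; exact: channel_J.
by apply: tensmap_tp; exact: channel_tp.
Qed.

Lemma id_channel T : is_channel (@idfun (op R T)).
Proof. by apply: is_channelI => //; rewrite J_id; exact: maxent_psd. Qed.

Lemma link_maxent S O (X : rop (S * O) (S * O)) : link (maxent R S) X = X.
Proof.
apply: en_inj => -[s o] [t o']; rewrite en_link.
rewrite -[RHS](sum_pick2_sym (fun x y => en X (x, o) (y, o')) s t).
by apply: eq_bigr => x _; apply: eq_bigr => y _; rewrite en_mk mulrC.
Qed.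

Lemma linkZl K S O a (X : rop (K * S) (K * S)) (Y : rop (S * O) (S * O)) :
  link (a *: X) Y = a *: link X Y.
Proof.
apply: en_inj => p q; rewrite enZ !en_link mulr_sumr; apply: eq_bigr => s _.
by rewrite mulr_sumr; apply: eq_bigr => t _; rewrite enZ mulrA.
Qed.

Lemma link_maxent_r K S (X : rop (K * S) (K * S)) : link X (maxent R S) = X.
Proof.
apply: en_inj => -[k o] [k' o']; rewrite en_link.
rewrite -[RHS](sum_pick2 (fun x y => en X (k, x) (k', y)) o o').
by apply: eq_bigr => x _; apply: eq_bigr => y _; rewrite en_mk.
Qed.

Lemma J_inj S O (M1 M2 : op R S -> op R O) : lin M1 -> lin M2 -> J M1 = J M2 -> M1 =1 M2.
Proof. by move=> l1 l2 h X; rewrite -(app_J X l1) h app_J. Qed.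

Lemma J_ext S O (M1 M2 : op R S -> op R O) : M1 =1 M2 -> J M1 = J M2.
Proof. by move=> h; apply: en_inj => p q; rewrite !en_J h. Qed.

Lemma tensmap_id T U : tensmap (@idfun (op R T)) (@idfun (op R U)) =1 idfun.
Proof.
apply: J_inj; [exact: tensmap_lin|by []|].
apply: en_inj => p q; rewrite en_J_tensmap !J_id !en_mk -natrM mulnb.
by case: p q => [[a b] [c d]] [[a' b'] [c' d']] /=; rewrite !xpair_eqE andbACA.
Qed.

Lemma ctr_maxent S : ctr (maxent R S) = #|S|%:R.
Proof.
rewrite tr_en sum_pair -ctr_Id tr_en; apply: eq_bigr => s _.
rewrite en1 eqxx -[RHS](sum_pick_sym (fun=> 1) s).
by apply: eq_bigr => t _; rewrite en_mk andbb mul1r.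
Qed.

Definition mes S : rop (S * S) (S * S) := ((#|S|%:R : R)^-1)%:C%C *: maxent R S.

Lemma mes_psd S : psd (mes S).
Proof. by apply: psdZ; rewrite ?invr_ge0 //; exact: maxent_psd. Qed.

Lemma ctr_mes S : (0 < #|S|)%N -> ctr (mes S) = 1.
Proof.
move=> s0; rewrite trZ ctr_maxent natrC -rmorphM mulVf // pnatr_eq0 -lt0n //.
Qed.

Lemma maxent_sqr S : maxent R S ** maxent R S = (#|S|%:R) *: maxent R S.
Proof.
apply: en_inj => p q; rewrite enM enZ !en_mk -ctr_maxent tr_en mulr_suml.
by apply: eq_bigr => r _; rewrite !en_mk -!natrM !mulnb; case: eqP; case: eqP; case: eqP.
Qed.

Lemma mes_proj S : (0 < #|S|)%N -> mes S ** mes S = mes S.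
Proof.
move=> s0; rewrite /mes mmZl mmZr maxent_sqr natrC !scalerA -!rmorphM.
by rewrite -mulrA mulVf ?mulr1 // pnatr_eq0 -lt0n.
Qed.

Lemma mes_test S : (0 < #|S|)%N -> test (mes S).
Proof. by move=> s0; apply: proj_test; [exact: psd_herm (mes_psd S)|exact: mes_proj]. Qed.

Lemma maxent_le S : lel (maxent R S) ((#|S|%:R : R)%:C%C *: Id).
Proof.
have := psd_le_tr (maxent_psd R S).
by rewrite {1}/rtr ctr_maxent natrC.
Qed.

(** The unnormalised maximally entangled operator has trace m, so it is at most m times the
    identity, and the Choi matrix of R_m is the identity over m. *)
Lemma id_le_rep (m : nat) T U (Q : op R T -> op R U) : (0 < m)%N -> psd (J Q) ->
  lel (J (tensmap (@idfun (op R 'I_m)) Q))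
      ((m%:R ^+ 2 : R)%:C%C *: J (tensmap (@rep_pi R 'I_m 'I_m) Q)).
Proof.
move=> m0 hQ; rewrite /lel.
suff -> : (m%:R ^+ 2 : R)%:C%C *: J (tensmap (@rep_pi R 'I_m 'I_m) Q)
    - J (tensmap (@idfun (op R 'I_m)) Q)
  = reidx (fun p => ((p.1.1, p.2.1), (p.1.2, p.2.2)))
     (kron ((m%:R : R)%:C%C *: Id - maxent R 'I_m) (J Q)).
  by apply: reidx_psd; apply: kron_psd => //; have := maxent_le 'I_m; rewrite card_ord.
apply: en_inj => p q; rewrite enB enZ !en_J_tensmap J_id J_rep_pi card_ord en_reidx en_kron.
rewrite enB !enZ mulrBl -!mulrA; congr (_ - _).
rewrite mulrA natrC invC -rmorphM; congr (_%:C%C * _).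
by rewrite expr2 -mulrA mulfV ?mulr1 // pnatr_eq0 -lt0n.
Qed.

Lemma test_kron1 T U (A : rop T T) : test A -> test (kron A (Id : rop U U)).
Proof.
move=> [h1 h2]; split; first by apply: kron_psd => //; exact: psd1.
have -> : Id - kron A Id = kron (Id - A) (Id : rop U U).
  by rewrite -kron1; apply: en_inj => p q; rewrite enB !en_kron enB mulrBl.
by apply: kron_psd => //; exact: psd1.
Qed.

Definition assocr T U V (p : T * (U * V)) : (T * U) * V := ((p.1, p.2.1), p.2.2).

Lemma assocr_bij T U V : bijective (@assocr T U V).
Proof. by exists (fun p => (p.1.1, (p.1.2, p.2))) => [[a [b c] ]|[ [a b] c] ]. Qed.

Lemma tensmap_assoc K S1 S2 O1 O2 (G : op R S1 -> op R O1) (H : op R S2 -> op R O2)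
    (X : op R (K * S1)) (w : op R S2) : lin H ->
  tensmap (@idfun (op R K)) (tensmap G H) (reidx (@assocr K S1 S2) (kron X w))
  = reidx (@assocr K O1 O2) (kron (tensmap (@idfun (op R K)) G X) (H w)).
Proof.
move=> lH; rewrite !tensmap_link -(app_J w lH); apply: en_inj => -[k [x y]] [l [x1 y1]].
rewrite en_link en_reidx en_kron en_link en_app sum_pair mulr_suml; apply: eq_bigr => s _.
rewrite mulr_suml; under [RHS]eq_bigr do rewrite mulr_sumr.
rewrite [RHS]exchange_big; apply: eq_bigr => d _.
rewrite sum_pair; apply: eq_bigr => t _; rewrite mulr_sumr; apply: eq_bigr => e _.
by rewrite en_reidx en_kron en_J_tensmap /=; ring.
Qed.

(** As an input for a channel on C'D' it entangles C' maximally with the reference and puts w on D'.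
    With w = 1 it is also the effect that projects on the maximally entangled state and ignores D;
    it accepts id_m with probability 1 and R_m with probability m^-2. *)
Definition mesin (m : nat) T (w : op R T) : op R ('I_m * ('I_m * T)) :=
  reidx (@assocr 'I_m 'I_m T) (kron (mes 'I_m) w).

Lemma mesin_psd m T (w : op R T) : psd w -> psd (mesin m w).
Proof. by move=> h; apply: reidx_psd; apply: kron_psd => //; exact: mes_psd. Qed.

Lemma ctr_mesin m T (w : op R T) : (0 < m)%N -> ctr w = 1 -> ctr (mesin m w) = 1.
Proof.
move=> m0 h; rewrite ctr_reidx; last exact: assocr_bij.
by rewrite ctr_kron h ctr_mes ?card_ord // mulr1.
Qed.

Lemma mesin_test m T : (0 < m)%N -> test (mesin m (Id : op R T)).
Proof.
move=> m0; apply: test_reidx; first exact: assocr_bij.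
by apply: test_kron1; apply: mes_test; rewrite card_ord.
Qed.

Lemma mesin_val m T U (G : op R 'I_m -> op R 'I_m) (Q : op R T -> op R U) w : lin Q ->
  ctr (mesin m (Id : op R U) ** tensmap (@idfun (op R 'I_m)) (tensmap G Q) (mesin m w))
  = ctr (mes 'I_m ** tensmap (@idfun (op R 'I_m)) G (mes 'I_m)) * ctr (Q w).
Proof.
move=> lQ; rewrite tensmap_assoc // -reidxM ?ctr_reidx; try exact: assocr_bij.
by rewrite kronM ctr_kron mm1l.
Qed.

Lemma mesin_id m T U (Q : op R T -> op R U) w : (0 < m)%N -> is_channel Q -> ctr w = 1 ->
  ctr (mesin m (Id : op R U) ** tensmap (@idfun (op R 'I_m)) (tensmap (@idfun (op R 'I_m)) Q) (mesin m w)) = 1.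
Proof.
move=> m0 hQ hw; rewrite mesin_val ?(channel_tp hQ) ?hw; last exact: channel_lin.
by rewrite tensmap_id mes_proj ?card_ord // ctr_mes ?card_ord // mulr1.
Qed.

Lemma mesin_rep m T U (Q : op R T -> op R U) w : (0 < m)%N -> is_channel Q -> ctr w = 1 ->
  ctr (mesin m (Id : op R U) ** tensmap (@idfun (op R 'I_m)) (tensmap (@rep_pi R 'I_m 'I_m) Q) (mesin m w))
  = ((m%:R ^+ 2 : R)^-1)%:C%C.
Proof.
move=> m0 hQ hw; rewrite mesin_val ?(channel_tp hQ) ?hw; last exact: channel_lin.
have -> : tensmap (@idfun (op R 'I_m)) (@rep_pi R 'I_m 'I_m) (mes 'I_m)
   = ((m%:R ^+ 2 : R)^-1)%:C%C *: Id.
  rewrite tensmap_link J_rep_pi /mes linkZl link_maxent scalerA card_ord.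
  by rewrite natrC invC -rmorphM -invfM -expr2.
by rewrite mmZr mm1 trZ ctr_mes ?card_ord // !mulr1.
Qed.

End OneShotTools.

(** * Twirling, completion of channels and mixing of tests *)

HB.lock Definition nchoi (R : realType) (S O : finType) (M : op R S -> op R O) :
  rop R (S * O) (S * O) := ((#|S|%:R : R)^-1)%:C%C *: J M.

Section Twirl.
Variable R : realType.
Local Notation C := (R[i]).
Local Notation rop := (rop R).
Implicit Types T U V S O K E I : finType.

Lemma nchoiE S O (M : op R S -> op R O) : nchoi M = ((#|S|%:R : R)^-1)%:C%C *: J M.
Proof. by rewrite nchoi.unlock. Qed.

(** What the group average achieves on Choi matrices: whatever the input tau, its operator [Kt]
    becomes that of the maximally mixed input. No group appears, so the notion passes to tensor
    powers by algebra alone. *)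
Definition twirling I S O (x : I -> rop (S * O) (S * O)) :=
  [/\ (0 < #|I|)%N, forall i, unit2 (x i) &
      forall tau, krausA x (Kt O tau) = (#|I|%:R * ctr tau / #|S|%:R) *: Id].

Definition invar I T (x : I -> rop T T) (X : rop T T) := forall i, x i ** X ** (x i) ^† = X.

Lemma kraus_invar I T (x : I -> rop T T) X : invar x X -> kraus x X = #|I|%:R *: X.
Proof.
move=> h; rewrite /kraus; under eq_bigr do rewrite h.
by rewrite sumr_const scaler_nat.
Qed.

Lemma krausZ I T U (x : I -> rop U T) a X : kraus x (a *: X) = a *: kraus x X.
Proof. by rewrite /kraus scaler_sumr; apply: eq_bigr => i _; rewrite mmZr mmZl. Qed.

Lemma lel_kraus I T U (x : I -> rop U T) X Y : lel X Y -> lel (kraus x X) (kraus x Y).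
Proof.
move=> h; rewrite /lel /kraus -sumrB; apply: psd_sum => i _; exact: lel_conj.
Qed.

Lemma invarZ I T (x : I -> rop T T) a X : invar x X -> invar x (a *: X).
Proof. by move=> h i; rewrite mmZr mmZl h. Qed.

(** A is the adjoint twirl of L times |S| / |I|. It is at most 1 because L <= Kt tau and the twirl
    of Kt tau is |I| / |S| times the identity. *)
Lemma twirl_test I S O (x : I -> rop (S * O) (S * O)) L tau :
  (0 < #|S|)%N -> twirling x -> ctest L tau ->
  exists A, test A /\ forall X, rtr (A ** X) = #|S|%:R / #|I|%:R * rtr (L ** kraus x X).
Proof.
move=> s0 [i0 _ hx] [l1 l2 l3].
have sn : (#|S|%:R : R) != 0 by rewrite pnatr_eq0 -lt0n.
have in0 : (#|I|%:R : R) != 0 by rewrite pnatr_eq0 -lt0n.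
pose c : R := #|S|%:R / #|I|%:R.
have c0 : 0 <= c by rewrite divr_ge0.
exists (c%:C%C *: krausA x L); split.
  split; first by apply: (psdZ c0); apply: psd_sum => i _; exact: psd_conj'.
  have -> : Id - c%:C%C *: krausA x L = c%:C%C *: krausA x (Kt O tau - L).
    have -> : krausA x (Kt O tau - L) = krausA x (Kt O tau) - krausA x L.
      by rewrite /krausA -sumrB; apply: eq_bigr => i _; rewrite mmBr mmBl.
    rewrite scalerBr hx l3 scalerA.
    suff -> : c%:C%C * (#|I|%:R * 1 / #|S|%:R) = 1 :> C by rewrite scale1r.
    rewrite mulr1 !natrC invC -!rmorphM /c; congr (_%:C%C : C).
    by rewrite mulrA divfK // mulfV.
  by apply: (psdZ c0); apply: psd_sum => i _; exact: psd_conj'.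
by move=> X; rewrite mmZl rtrZ /rtr kraus_adj.
Qed.

(** On invariant Choi matrices the twirl is multiplication by |I|, so an experiment with any
    entangled input is matched by a test on the Choi state; this is teleportation simulation in dual
    form. *)
Lemma twirl_test_invar I S O (x : I -> rop (S * O) (S * O)) L tau :
  (0 < #|S|)%N -> twirling x -> ctest L tau ->
  exists A, test A /\ forall M, invar x (J M) -> rtr (A ** nchoi M) = rtr (L ** J M).
Proof.
move=> s0 hx hL; have [i0 _ _] := hx.
have [A [tA hA]] := twirl_test s0 hx hL; exists A; split=> // M hM.
rewrite hA nchoiE krausZ kraus_invar // natrC scalerA -rmorphM mmZr rtrZ !mulrA.
suff -> : #|S|%:R / #|I|%:R * (#|S|%:R)^-1 * #|I|%:R = 1 :> R by rewrite mul1r.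
by field; rewrite !pnatr_eq0 -!lt0n s0 i0.
Qed.

Lemma nchoi_tr S O (M : op R S -> op R O) : (0 < #|S|)%N -> is_channel M ->
  ctr (nchoi M) = 1.
Proof.
move=> s0 hM; rewrite nchoiE trZ -[J M]mm1l.
have -> : Id = Kt O (Id : rop S S).
  by apply: en_inj => -[a b] [c d]; rewrite en_mk !en1 xpair_eqE -natrM mulnb /= (eq_sym a) (eq_sym b).
rewrite ctr_Kt app_J; last exact: channel_lin.
by rewrite (channel_tp hM) ctr_Id natrC -rmorphM mulVf // pnatr_eq0 -lt0n.
Qed.

Lemma nchoi_psd S O (M : op R S -> op R O) : is_channel M -> psd (nchoi M).
Proof. by move=> h; rewrite nchoiE; apply: psdZ; rewrite ?invr_ge0 //; exact: channel_J. Qed.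

Lemma supapp_J S' S O O' (e : nat) (P : op R S' -> op R ('I_e * S))
    (Q : op R ('I_e * O) -> op R O') (M1 M2 : op R S -> op R O) :
  J M1 = J M2 -> supapp P Q M1 =1 supapp P Q M2.
Proof. by move=> h X; rewrite /supapp !tensmap_link h. Qed.

(** K0 is (b M - M1) / (b - 1), completely positive by [hle] and trace preserving because b - 1
    normalises it. *)
Lemma compl_channel S O (M1 M : op R S -> op R O) (b : R) :
  is_channel M1 -> is_channel M -> 1 < b -> lel (J M1) (b%:C%C *: J M) ->
  exists K0 : op R S -> op R O, is_channel K0 /\
    forall Z, M Z = (b^-1)%:C%C *: M1 Z + (1 - b^-1)%:C%C *: K0 Z.
Proof.
move=> h1 hM b1 hle; have l1 := channel_lin h1; have lM := channel_lin hM.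
have b0 : b != 0 by rewrite gt_eqF // (lt_trans ltr01).
have b10 : b - 1 != 0 by rewrite gt_eqF // subr_gt0.
have appZ (a c : C) Z : app (a *: (c *: J M - J M1)) Z = a *: (c *: M Z - M1 Z).
  rewrite -[a *: _]addr0 appD addrC -[- J M1]scaleN1r addrC.
  rewrite -[c *: J M]addr0 -addrA add0r appD.
  rewrite -[-1 *: J M1]addr0 appD !app_J // scaleN1r.
  have -> : app (0 : rop (S * O) (S * O)) Z = 0.
    apply: en_inj => u v; rewrite en_app en0 big1 // => s _; rewrite big1 // => t _.
    by rewrite en0 mulr0.
  by rewrite !addr0.
exists (app (((b - 1)^-1)%:C%C *: (b%:C%C *: J M - J M1))); split.
  apply: is_channelI; [exact: app_lin| |].
    by rewrite J_app; apply: psdZ hle; rewrite invr_ge0 subr_ge0 ltW.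
  move=> X; rewrite appZ trZ trD trN trZ (channel_tp h1) (channel_tp hM).
  rewrite -{2}(mul1r (ctr X)) -mulrBl mulrA -(rmorph1 (real_complex R)) -rmorphB -rmorphM.
  by rewrite mulVf // rmorph1 mul1r.
move=> Z; rewrite appZ scalerA -rmorphM.
have -> : (1 - b^-1) * (b - 1)^-1 = b^-1 by field; rewrite b0 b10.
rewrite scalerBr scalerA -rmorphM mulVf // scale1r addrC subrK //.
Qed.

(** R_m is completed from id_m with b = m^2. For m = 1 that divides by b - 1 = 0, but R_1 is already
    the identity. *)
Lemma rep_compl (m : nat) (T : finType) : (0 < m)%N ->
  exists K0 : op R ('I_m * T) -> op R ('I_m * T),
  is_channel K0 /\ forall Z, tensmap (@rep_pi R 'I_m 'I_m) (@idfun (op R T)) Z =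
    ((m%:R ^+ 2 : R)^-1)%:C%C *: Z + (1 - (m%:R ^+ 2 : R)^-1)%:C%C *: K0 Z.
Proof.
move=> m0; case: (leqP m 1) => m1.
  have -> : m = 1%N by apply/eqP; rewrite eqn_leq m1 m0.
  exists idfun; split; first exact: id_channel.
  move=> Z; rewrite expr1n invr1 subrr scale0r addr0 scale1r.
  rewrite -[RHS](@tensmap_id R); apply: J_inj; try exact: tensmap_lin.
  apply: en_inj => p q; rewrite !en_J_tensmap; congr (_ * _).
  rewrite J_id J_rep_pi enZ en1 en_mk card_ord invr1 mul1r.
  by case: p q => [[a b] [c d]] [[a2 b2] [c2 d2]] /=; rewrite !ord1.
have cid := @id_channel R ('I_m * T)%type.
have cR : is_channel (tensmap (@rep_pi R 'I_m 'I_m) (@idfun (op R T))).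
  by apply: tensmap_channel (@id_channel R T); apply: rep_pi_channel; rewrite card_ord.
have b1 : 1 < (m%:R ^+ 2 : R) by rewrite exprn_egt1 // ltr1n.
apply: (compl_channel cid cR b1).
have := id_le_rep m0 (channel_J (@id_channel R T)).
by rewrite (J_ext (@tensmap_id R _ _)).
Qed.

(** Exact conversion of the free channel needs an acceptance probability equal to b, not just below
    it. Accepting a suitable fraction of the rejected cases reaches b and can only raise the
    acceptance of X. *)
Lemma mix_test T (A X Y : rop T T) (b : R) : test A -> psd X -> rtr X = 1 ->
  rtr Y = 1 -> rtr (A ** Y) <= b -> b <= 1 ->
  exists A', [/\ test A', rtr (A' ** Y) = b & rtr (A ** X) <= rtr (A' ** X)].
Proof.
move=> [h1 h2] hX tX tY hb b1; set be := rtr (A ** Y) in hb.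
have [b1E|nb] := eqVneq be 1.
  exists A; split; [by split|by apply/le_anti; rewrite hb -b1E in b1 *|exact: lexx].
have d0 : 0 < 1 - be by rewrite subr_gt0 lt_neqAle nb (le_trans hb).
pose la := (b - be) / (1 - be).
have l0 : 0 <= la by apply: divr_ge0; [rewrite subr_ge0|exact: ltW].
have l1 : la <= 1 by rewrite /la ler_pdivrMr // mul1r lerD2r.
have mixE Z : rtr ((A + la%:C%C *: (Id - A)) ** Z) = rtr (A ** Z) + la * (rtr Z - rtr (A ** Z)).
  by rewrite mmDl mmZl mmBl mm1l rtrD rtrZ rtrB.
exists (A + la%:C%C *: (Id - A)); split.
- split; first by apply: psdD h1 (psdZ l0 h2).
  have -> : Id - (A + la%:C%C *: (Id - A)) = (1 - la)%:C%C *: (Id - A).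
    by rewrite rmorphB rmorph1 scalerBl scale1r opprD addrA.
  by apply: psdZ h2; rewrite subr_ge0.
- by rewrite mixE tY -/be /la divfK ?gt_eqF //; lra.
- rewrite mixE lerDl mulr_ge0 // tX subr_ge0 -tX; exact: test_le1.
Qed.

Lemma ctr_real T (A X : rop T T) : psd A -> psd X -> ctr (A ** X) = (rtr (A ** X))%:C%C.
Proof. by move=> h1 h2; apply: ge0_Re; exact: tr_psdM. Qed.

Lemma tensmap_mes S O (M : op R S -> op R O) :
  tensmap (@idfun (op R S)) M (mes R S) = nchoi M.
Proof. by rewrite nchoiE tensmap_link linkZl link_maxent. Qed.

Lemma tensmap_mix K S O (M M1 M2 : op R S -> op R O) (a b : C) rho :
  (forall Z, M Z = a *: M1 Z + b *: M2 Z) ->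
  tensmap (@idfun (op R K)) M rho =
  a *: tensmap (@idfun (op R K)) M1 rho + b *: tensmap (@idfun (op R K)) M2 rho.
Proof.
move=> h; rewrite !tensmap_link.
have -> : J M = a *: J M1 + (b *: J M2 + 0).
  by rewrite addr0; apply: en_inj => p q; rewrite enD !enZ !en_J h enD !enZ.
rewrite !linkD; have -> : link rho (0 : rop (S * O) (S * O)) = 0.
  apply: en_inj => u v; rewrite en_link en0 big1 // => s _; rewrite big1 // => t _.
  by rewrite en0 mulr0.
by rewrite addr0.
Qed.

Lemma supapp_lel S' S O O' (e : nat) (P : op R S' -> op R ('I_e * S))
    (Q : op R ('I_e * O) -> op R O') (M1 M2 : op R S -> op R O) (b : C) :
  is_channel P -> is_channel Q -> lel (J M1) (b *: J M2) ->
  lel (J (supapp P Q M1)) (b *: J (supapp P Q M2)).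
Proof.
move=> hP hQ h; have lQ := channel_lin hQ.
have e0 := supapp_app_lin P (-1) 0 0 lQ; rewrite scaler0 addr0 scaleN1r addNr in e0.
have e1 := supapp_app_lin P b (J M2) (-1 *: J M1 + 0) lQ.
have e2 := supapp_app_lin P (-1) (J M1) 0 lQ.
rewrite e2 e0 !addr0 !scaleN1r in e1.
rewrite /lel -(J_ext (supapp_J P Q (J_app (J M1)))) -(J_ext (supapp_J P Q (J_app (J M2)))) -e1.
apply: supapp_psd lQ (channel_J hP) (channel_J hQ) _.
by rewrite J_app.
Qed.

End Twirl.

(** * One-shot bounds *)

Section OneShot.
Variable R : realType.
Local Notation C := (R[i]).
Local Notation rop := (rop R).
Variables (A' B' A B : finType) (N : op R (A' * B') -> op R (A * B)).
Hypothesis hN : is_channel N.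
Hypothesis a0 : (0 < #|A|)%N.
Hypothesis s0 : (0 < #|{: A' * B'}|)%N.

Local Notation S := ((A' * B')%type).
Local Notation O := ((A * B)%type).
Local Notation RQ := (fun Q : op R B' -> op R B => tensmap (@rep_pi R A' A) Q).

Lemma RQ_channel Q : is_channel Q -> is_channel (RQ Q).
Proof. by move=> hQ; apply: tensmap_channel => //; exact: rep_pi_channel. Qed.

Lemma state0 (d : nat) : (0 < d)%N -> exists w : op R 'I_d, psd w /\ ctr w = 1.
Proof.
move=> d0; exists (((d%:R : R)^-1)%:C%C *: Id); split.
  by apply: psdZ; rewrite ?invr_ge0 //; exact: psd1.
by rewrite trZ ctr_Id card_ord natrC -rmorphM mulVf // pnatr_eq0 -lt0n.
Qed.

Lemma log2_half (m : nat) (b : R) : (0 < m)%N -> 0 < b -> m%:R ^+ 2 <= b ->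
  log2 (m%:R : R) <= log2 b / 2.
Proof.
move=> m0 b0 h; have mp : 0 < m%:R :> R by rewrite ltr0n.
have : log2 (m%:R ^+ 2) <= log2 b by apply: ler_log2 => //; rewrite exprn_gt0.
by rewrite /log2 lnXn // mulrnAl -mulr_natl; lra.
Qed.

(* A superchannel taking N to id_m and R (x) Q0 to R_m turns the maximally
   entangled test into a test of N against R (x) Q0. *)
Lemma dist_upper (I : finType) (x : I -> rop {: S * O} {: S * O}) (Q0 : op R B' -> op R B)
    (eps beta : R) : is_channel Q0 -> twirling x -> invar x (J N) -> invar x (J (RQ Q0)) ->
  0 <= eps -> 0 < beta ->
  (forall T, test T -> 1 - eps ^+ 2 <= rtr (T ** nchoi N) -> beta <= rtr (T ** nchoi (RQ Q0))) ->
  (dist1 eps N (@rep_pi R A' A) <= (log2 (beta^-1) / 2)%:E)%E.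
Proof.
move=> hQ0 hx iN iR e0 b0 hT.
apply: le_trans.
  by apply: ereal_inf_lbound; exists Q0; split; [exact: hQ0|reflexivity].
apply: ge_ereal_sup => _ [m [d' [d [e [Q' [P [Qs [[m0 d0' d0 hQ'] [e1 hP hQs] hR hp ->]]]]]]]].
rewrite lee_fin.
have [w [hw tw]] := state0 d0'.
have tin := ctr_mesin m0 tw; have pin := mesin_psd m hw.
have tst := mesin_test R 'I_d m0.
have cL := state_ctest pin tin tst.
have [L [tau [cL2 hL]]] := ctest_pullback hP hQs cL.
have [T [tT hT2]] := twirl_test_invar s0 hx cL2.
have val (M : op R S -> op R O) : is_channel M -> invar x (J M) -> rtr (T ** nchoi M) =
    rtr (mesin m (Id : op R 'I_d) ** tensmap (@idfun (op R 'I_m)) (supapp P Qs M) (mesin m w)).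
  move=> hM iM; rewrite hT2 // /rtr hL; last exact: channel_lin.
  by rewrite ctr_tensmap.
have e1N : 1 - eps ^+ 2 <= rtr (T ** nchoi N).
  rewrite val //.
  have idc : is_channel (tensmap (@Defs.idm R m) Q') by exact: tensmap_channel (id_channel R _) hQ'.
  have := pdist_test idc (supapp_channel hP hQs hN) e0 hp _ pin tin tst.
  rewrite card_ord => /(_ m0).
  have q : rtr (mesin m (Id : op R 'I_d) ** tensmap (@idfun (op R 'I_m))
      (tensmap (@Defs.idm R m) Q') (mesin m w)) = 1 := rtr1 (mesin_id m0 hQ' tw).
  rewrite q subrr sqrtr0 addr0.
  set r := rtr _; have r0 : 0 <= r.
    apply: rtr_psdM; first exact: tst.1.
    exact: chan_out_psd (supapp_channel hP hQs hN) pin.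
  case: (lerP 0 (1 - eps ^+ 2)) => [p|n _]; last exact: le_trans (ltW n) r0.
  by rewrite ler_sqrt.
have := hT T tT e1N; rewrite (val _ (RQ_channel hQ0) iR).
have -> : tensmap (@idfun (op R 'I_m)) (supapp P Qs (RQ Q0)) (mesin m w)
   = tensmap (@idfun (op R 'I_m)) (tensmap (@rep_pi R 'I_m 'I_m) Q') (mesin m w).
  by rewrite !tensmap_link (J_ext hR).
rewrite /rtr (mesin_rep m0 hQ' tw) /= => hb.
have mp : 0 < (m%:R ^+ 2 : R) by rewrite exprn_gt0 // ltr0n.
apply: log2_half => //; first by rewrite invr_gt0.
by rewrite -(invrK (m%:R ^+ 2)) lef_pV2 // posrE invr_gt0.
Qed.

Lemma mix_arith (u w p eta : R) : u <= 1 -> 0 <= w -> p <= 1 -> 1 - eta <= p ->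
  u - (p * u + (1 - p) * w) <= eta.
Proof.
move=> u1 w0 p1 pe.
have h1 : 0 <= (1 - p) * (1 - u) by rewrite mulr_ge0 ?subr_ge0.
have h2 : 0 <= (1 - p) * w by rewrite mulr_ge0 ?subr_ge0.
lra.
Qed.

(** Measure on the Choi state; keep the target's input on acceptance, apply the completion of id_m
    to R_m on rejection. For each Q the test is first raised to accept R (x) Q with probability
    exactly m^-2, which turns R (x) Q into R_m itself, with one-dimensional D' and D. *)
Lemma dist_lower (T : rop {: S * O} {: S * O}) (eta eps : R) (m : nat) :
  test T -> (0 < m)%N -> 1 - eta <= rtr (T ** nchoi N) ->
  (forall Q, is_channel Q -> rtr (T ** nchoi (RQ Q)) <= (m%:R ^+ 2)^-1) ->
  0 <= eps -> eta <= 1 -> 2 * eta <= eps ^+ 2 ->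
  ((log2 (m%:R : R))%:E <= dist1 eps N (@rep_pi R A' A))%E.
Proof.
move=> hT m0 hN1 hQ1 e0 eta1 he; apply: le_ereal_inf_tmp => _ [Q [hQ ->]].
apply: ereal_sup_ubound.
have mp : 1 <= (m%:R ^+ 2 : R) by rewrite exprn_ege1 // ler1n.
have b1 : (m%:R ^+ 2 : R)^-1 <= 1 by rewrite invf_le1 // (lt_le_trans ltr01).
have cRQ := RQ_channel hQ.
have pN := nchoi_psd hN; have pQ := nchoi_psd cRQ.
have tN := rtr1 (nchoi_tr s0 hN); have tQ := rtr1 (nchoi_tr s0 cRQ).
have [T' [[hT1 hT2] hTQ hTN]] := mix_test hT pN tN tQ (hQ1 Q hQ) b1.
have [K0 [cK0 hK0]] := @rep_compl R m 'I_1 m0.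
have y0 : (0 < #|{: 'I_m * 'I_1}|)%N by rewrite card_prod !card_ord muln1.
have [e [P [Qs [hPQ hB]]]] := branch (mes_psd R S) (ctr_mes R s0) (conj hT1 hT2)
   (@id_channel R ('I_m * 'I_1)%type) cK0 y0 s0.
have hB' M Z : is_channel M -> supapp P Qs M Z =
   (rtr (T' ** nchoi M))%:C%C *: Z + (1 - rtr (T' ** nchoi M))%:C%C *: K0 Z.
  move=> hM; have pM := nchoi_psd hM.
  rewrite hB tensmap_mes mmBl mm1l trD trN (nchoi_tr s0 hM) (ctr_real hT1 pM).
  by rewrite rmorphB rmorph1.
have [e1 hP hQs] := hPQ.
have cid : is_channel (tensmap (@Defs.idm R m) (@idfun (op R 'I_1))).
  exact: tensmap_channel (id_channel R _) (id_channel R _).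
exists m, 1%N, 1%N, e, idfun, P, Qs; split.
- by split; [exact: m0|exact: isT|exact: isT|exact: id_channel].
- exact: hPQ.
- by move=> Z; rewrite (hB' _ _ cRQ) hTQ hK0.
- apply: (pdist_bound cid (supapp_channel hP hQs hN) e0 eta1 he).
  move=> r rho D hr tr1 hD.
  have -> : tensmap (@idfun (op R 'I_r)) (tensmap (@Defs.idm R m) (@idfun (op R 'I_1))) rho = rho.
    by rewrite tensmap_link (J_ext (@tensmap_id R _ _)) J_id link_maxent_r.
  rewrite (tensmap_mix _ (fun Z => hB' N Z hN)).
  have -> : tensmap (@idfun (op R 'I_r)) (fun Z => Z) rho = rho by exact: tensmap_id.
  rewrite mmDr !mmZr rtrD !rtrZ.
  have q1 := test_le1 hD hr; rewrite (rtr1 tr1) in q1.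
  have q3 := rtr_psdM hD.1 (chan_out_psd cK0 hr).
  have q4 := test_le1 (conj hT1 hT2) pN; rewrite tN in q4.
  have q5 := le_trans hN1 hTN.
  apply: mix_arith q1 q3 q4 q5.
- by [].
Qed.

(** A superchannel preserves id_m <= m^2 R_m, so T accepts the simulated channel with probability at
    most m^2 beta, while closeness to N forces at least the square of the difference of the two
    roots. *)
Lemma cost_lower (T : rop {: S * O} {: S * O}) (eta eps beta : R) :
  test T -> 1 - eta <= rtr (T ** nchoi N) -> 0 < beta ->
  (forall Q, is_channel Q -> rtr (T ** nchoi (RQ Q)) <= beta) ->
  0 <= eps -> 0 < Num.sqrt (1 - eps ^+ 2) - Num.sqrt eta ->
  ((log2 ((Num.sqrt (1 - eps ^+ 2) - Num.sqrt eta) ^+ 2 / beta) / 2)%:E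
    <= cost1 eps N (@rep_pi R A' A))%E.
Proof.
move=> hT hN1 b0 hQ1 e0; set c := _ - Num.sqrt eta => c0.
apply: le_ereal_inf_tmp => _ [Q [hQ ->]].
apply: le_ereal_inf_tmp => _ [m [d' [d [e [Q' [P [Qs [[m0 d0' d0 hQ'] [e1 hP hQs] hR hp ->]]]]]]]].
rewrite lee_fin.
have cid : is_channel (tensmap (@Defs.idm R m) Q') by exact: tensmap_channel (id_channel R _) hQ'.
have cT := supapp_channel hP hQs cid.
have := pdist_test hN cT e0 hp s0 (mes_psd R S) (ctr_mes R s0) hT.
rewrite !tensmap_mes => hs.
set y := rtr (T ** nchoi (supapp _ _ _)) in hs.
have y0 : 0 <= y by exact: rtr_psdM hT.1 (nchoi_psd cT).
have cy : c ^+ 2 <= y.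
  rewrite -(sqr_sqrtr y0) ler_pXn2r ?nnegrE ?sqrtr_ge0 ?(ltW c0) // /c lerBlDr.
  apply: le_trans hs _; apply: lerD => //; apply: ler_wsqrtr.
  by move: hN1; lra.
have hle : lel (J (supapp P Qs (tensmap (@Defs.idm R m) Q')))
     ((m%:R ^+ 2 : R)%:C%C *: J (supapp P Qs (tensmap (@rep_pi R 'I_m 'I_m) Q'))).
  exact: supapp_lel hP hQs (id_le_rep m0 (channel_J hQ')).
have ym : y <= m%:R ^+ 2 * beta.
  have k0 : 0 <= (#|{: A' * B'}|%:R)^-1 :> R by rewrite invr_ge0 ler0n.
  have := lel_rtr hT.1 (lelZ k0 hle); rewrite (J_ext hR) scalerA mulrC -scalerA.
  rewrite -(nchoiE (supapp P Qs _)) -(nchoiE (RQ Q)) -/y mmZr rtrZ => /le_trans; apply.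
  by apply: ler_wpM2l; [rewrite sqr_ge0|exact: hQ1].
have mp : 0 < m%:R :> R by rewrite ltr0n.
have mE : log2 (m%:R : R) = log2 (m%:R ^+ 2 : R) / 2.
  by rewrite /log2 lnXn // -mulr_natl; field; rewrite gt_eqF // ln2_gt0.
rewrite mE ler_pM2r ?invr_gt0 //; apply: ler_log2.
  by rewrite divr_gt0 // exprn_gt0.
by rewrite ler_pdivrMr //; exact: le_trans cy ym.
Qed.

Lemma div_arith (u w v t eta : R) : 0 <= eta ->
  u - w <= eta -> 0 <= v -> v <= 1 -> t <= 1 + eta ->
  u - (w - v * (t - 1)) <= 2 * eta.
Proof.
move=> h h1 v0 v1 ht; have e0 : v * (t - 1) <= v * eta by apply: ler_wpM2l => //; lra.
have : v * eta <= eta by rewrite ler_piMl.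
lra.
Qed.

(* The simulating superchannel applies the twirl of F when the maximally
   entangled test accepts, and otherwise the channel that completes it to
   R (x) Q0. *)
Lemma cost_upper (I : finType) (x : I -> rop {: S * O} {: S * O}) (Q0 : op R B' -> op R B)
    (F : rop {: S * O} {: S * O}) (lam eta eps : R) (m : nat) :
  is_channel Q0 -> twirling x -> invar x (J N) -> invar x (J (RQ Q0)) ->
  psd F -> lel F (lam%:C%C *: nchoi (RQ Q0)) -> 0 <= lam ->
  (forall T, test T -> `|rtr (T ** nchoi N) - rtr (T ** F)| <= eta) ->
  eta <= 2^-1 -> 0 <= eps -> 4 * eta <= eps ^+ 2 -> (1 < m)%N -> 2 * lam <= m%:R ^+ 2 ->
  (cost1 eps N (@rep_pi R A' A) <= (log2 (m%:R : R))%:E)%E.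
Proof.
move=> hQ0 hx iN iR pF hF lam0 hT eta2 e0 he m1 hm.
have m0 : (0 < m)%N by exact: ltnW.
have [i0 hu htw] := hx.
pose d : R := #|{: A' * B'}|%:R; pose n : R := #|I|%:R.
have d0 : d != 0 by rewrite pnatr_eq0 -lt0n.
have n0 : n != 0 by rewrite pnatr_eq0 -lt0n.
pose t := rtr F.
have tN := rtr1 (nchoi_tr s0 hN).
have ht : `|1 - t| <= eta by have := hT _ (test1 R _); rewrite !mm1l tN.
have [t1 t2] : 1 - eta <= t /\ t <= 1 + eta.
  by move: ht; rewrite ler_norml => /andP [] *; split; lra.
have t0 : 0 < t by lra.
(* The twirl of F becomes the Choi matrix of a channel: twirling [Kt] contributes n / d and tr F
   contributes t, and k cancels both. *)
pose k : R := d / (t * n).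
have k0 : 0 <= k by rewrite divr_ge0 ?mulr_ge0 ?ler0n // ltW.
pose M1 : op R S -> op R O := app (k%:C%C *: kraus x F).
have JM1 : J M1 = k%:C%C *: kraus x F by exact: J_app.
have cM1 : is_channel M1.
  apply: is_channelI; [exact: app_lin|by rewrite JM1; apply: psdZ k0 (psd_kraus _ pF)|].
  move=> X; rewrite /M1 -ctr_Kt mmZr trZ -kraus_adj htw mmZl trZ mm1l.
  rewrite (ge0_Re (tr_psd pF)) -/(rtr F) -/t !natrC invC.
  have -> : k%:C%C * (#|I|%:R%:C%C * ctr X * (#|{: A' * B'}|%:R^-1)%:C%C * t%:C%C)
     = (k * n * d^-1 * t)%:C%C * ctr X by rewrite !rmorphM; ring.
  have -> : k * n * d^-1 * t = 1; last by rewrite rmorph1 mul1r.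
  by rewrite /k; field; rewrite d0 n0 gt_eqF.
have cRQ := RQ_channel hQ0.
have le1 : lel (J M1) ((m%:R ^+ 2 : R)%:C%C *: J (RQ Q0)).
  have eK : kraus x (lam%:C%C *: nchoi (RQ Q0)) = (lam * (d^-1 * n))%:C%C *: J (RQ Q0).
    rewrite krausZ nchoiE krausZ (kraus_invar iR) natrC.
    by rewrite !scalerA !rmorphM mulrA.
  have := lelZ k0 (lel_kraus x hF); rewrite eK -JM1 scalerA -rmorphM.
  have -> : k * (lam * (d^-1 * n)) = lam / t.
    by rewrite /k; field; rewrite d0 n0 gt_eqF.
  move=> /lel_trans; apply; apply: lelZl; first exact: channel_J.
  (* t >= 1 - eta >= 1/2, which the factor 2 in [hm] pays for. *)
  rewrite ler_pdivrMr //; apply: le_trans (_ : _ <= m%:R ^+ 2 * (1 - eta)) _; last first.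
    by apply: ler_wpM2l => //; exact: sqr_ge0.
  by move: (m%:R ^+ 2 : R) hm lam0 => u; nra.
have b1 : 1 < (m%:R ^+ 2 : R) by rewrite exprn_egt1 // ltr1n.
have [K0 [cK0 hK0]] := compl_channel cM1 cRQ b1 le1.
apply: le_trans.
  by apply: ereal_inf_lbound; exists Q0; split; [exact: hQ0|reflexivity].
apply: ereal_inf_lbound.
have [w [hw tw]] := state0 (ltn0Sn 0).
have km : (0 < #|'I_m|)%N by rewrite card_ord.
have [e [P [Qs [hPQ hB]]]] := branch (mesin_psd m hw) (ctr_mesin m0 tw)
   (mesin_test R 'I_1 m0) cM1 cK0 s0 km.
have [e1 hP hQs] := hPQ.
have cI := @id_channel R 'I_1.
have cid : is_channel (tensmap (@Defs.idm R m) (@idfun (op R 'I_1))).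
  exact: tensmap_channel (id_channel R _) cI.
have cR : is_channel (tensmap (@rep_pi R 'I_m 'I_m) (@idfun (op R 'I_1))).
  exact: tensmap_channel (rep_pi_channel R _ km) cI.
have outC M : is_channel M -> ctr (tensmap (@idfun (op R 'I_m)) M (mesin m w)) = 1.
  by move=> hM; exact: chan_out_tr hM (ctr_mesin m0 tw).
exists m, 1%N, 1%N, e, idfun, P, Qs; split.
- by split; [exact: m0|exact: isT|exact: isT|exact: cI].
- exact: hPQ.
- move=> Z; rewrite hB mmBl mm1l trD trN (outC _ _ cR) (mesin_rep m0 cI tw) hK0.
  by rewrite rmorphB rmorph1.
- have hid Z : supapp P Qs (tensmap (@Defs.idm R m) (@idfun (op R 'I_1))) Z = M1 Z.
  have v1 := mesin_id m0 cI tw.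
  by rewrite hB mmBl mm1l trD trN (outC _ _ cid) v1 subrr scale0r addr0 scale1r.
have c3 : is_channel (supapp P Qs (tensmap (@Defs.idm R m) (@idfun (op R 'I_1)))).
  exact: supapp_channel hP hQs cid.
have e1' : 2 * eta <= 1 by move: eta2; lra.
have e2' : 2 * (2 * eta) <= eps ^+ 2 by move: he; lra.
apply: (pdist_bound hN c3 e0 e1' e2').
move=> r rho D hr tr1 hD.
rewrite [X in _ - rtr (_ ** X)]tensmap_link (J_ext hid) -tensmap_link.
have [T [tT hTv]] := twirl_test s0 hx (state_ctest hr tr1 hD).
have vN : rtr (D ** tensmap (@idfun (op R 'I_r)) N rho) = rtr (T ** nchoi N).
  rewrite hTv nchoiE krausZ kraus_invar // natrC scalerA -rmorphM mmZr rtrZ /rtr ctr_tensmap.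
  rewrite mulrA -/d -/n; have -> : d / n * (d^-1 * n) = 1 by field; rewrite d0 n0.
  by rewrite mul1r.
have vM : rtr (D ** tensmap (@idfun (op R 'I_r)) M1 rho) = rtr (T ** F) / t.
  rewrite hTv {1}/rtr -ctr_tensmap JM1 mmZr -/(rtr _) rtrZ /k -/d -/n.
  by field; rewrite n0 gt_eqF.
rewrite vN vM.
have := hT T tT; rewrite ler_norml => /andP [_ h2].
have h3 : rtr (T ** F) <= t by exact: test_le1.
have h4 : 0 <= rtr (T ** F) by exact: rtr_psdM tT.1 pF.
(* One eta is the error of F, the other that of dividing by t; together they give the 2 eta of
   [pdist_bound]. *)
have -> : rtr (T ** F) / t = rtr (T ** F) - rtr (T ** F) / t * (t - 1).
  by field; rewrite gt_eqF.
have h5 : 0 <= rtr (T ** F) / t by rewrite divr_ge0 // ltW.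
have h6 : rtr (T ** F) / t <= 1 by rewrite ler_pdivrMr // mul1r.
exact: div_arith (le_trans (normr_ge0 _) ht) h2 h5 h6 t2.
- by [].
Qed.

End OneShot.

(** * Conditional entropy *)

Section Conditional.
Variable R : realType.
Local Notation C := (R[i]).
Local Notation rop := (rop R).
Implicit Types T U V : finType.

Local Notation "X ^⊗ n" := (tpw (fun _ : 'I_n => X)) (at level 29).

Lemma unit2_reidx T U (f : T -> U) (P : rop U U) : bijective f -> unit2 P ->
  unit2 (mk (fun u t => en P u (f t)) : rop U T).
Proof.
move=> bf [h1 h2]; split; apply: en_inj => s t; rewrite enM.
  rewrite -[in RHS]h1 enM [RHS](reindex f) /=; last exact: onW_bij.
  by apply: eq_bigr => u _; rewrite !enA !en_mk.
rewrite -(reidx1 R bf) en_reidx -[in RHS]h2 enM.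
by apply: eq_bigr => u _; rewrite !enA !en_mk.
Qed.

Lemma reidx_diag T U (f : T -> U) (P : rop U U) (d : U -> R) :
  reidx f (P ^† ** dg (fun t => (d t)%:C%C) ** P) =
  (mk (fun u t => en P u (f t)) : rop U T) ^† ** dg (fun t => (d t)%:C%C)
   ** (mk (fun u t => en P u (f t)) : rop U T).
Proof.
apply: en_inj => s t; rewrite en_reidx !enM; apply: eq_bigr => u _.
by rewrite !en_dgr !enA !en_mk.
Qed.

(** Relabelling a diagonalisation gives one by a unitary between different index types, which
    [mxfun_diag] admits. *)
Lemma mxfun_reidx T U (f : T -> U) g (X : rop U U) : bijective f -> psd X ->
  mxfun g (reidx f X) = reidx f (mxfun g X).
Proof.
move=> bf hX; have [P [d [hP d0 hS hf]]] := psdP hX.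
rewrite hf reidx_diag; apply: mxfun_diag; first exact: unit2_reidx.
by rewrite -reidx_diag -hS.
Qed.

Lemma dre_reidx T U (f : T -> U) (rho sigma : rop U U) : bijective f -> psd rho -> psd sigma ->
  dre (reidx f rho) (reidx f sigma) = dre rho sigma.
Proof.
move=> bf h1 h2; rewrite /dre !logmE !(mxfun_reidx _ bf) // -!(reidxM bf) !(rtr_reidx bf).
reflexivity.
Qed.

Lemma dominated_reidx T U (f : T -> U) (rho sigma : rop U U) :
  dominated rho sigma -> dominated (reidx f rho) (reidx f sigma).
Proof. by move=> [c c0 hc]; exists c => //; rewrite -reidxZ; exact: lel_reidx. Qed.

Lemma marg_psd T U (X : rop (T * U) (T * U)) : psd X -> psd (marg X).
Proof.
move=> h; have -> : marg X = \sum_(k : T) reidx (fun u : U => (k, u)) X.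
  by apply: en_inj => s t; rewrite en_mk en_sum; apply: eq_bigr => k _; rewrite en_reidx.
by apply: psd_sum => k _; exact: reidx_psd.
Qed.

Lemma ctr_kronId T U (X : rop (T * U) (T * U)) (Z : rop U U) :
  ctr (X ** kron Id Z) = ctr (marg X ** Z).
Proof.
rewrite !ctrM_en sum_pair exchange_big; apply: eq_bigr => u _ /=.
transitivity (\sum_t \sum_u' en X (t, u) (t, u') * en Z u' u).
  apply: eq_bigr => t _; rewrite sum_pair.
  rewrite -[RHS](sum_pick (fun t' => \sum_u' en X (t, u) (t', u') * en Z u' u) t).
  apply: eq_bigr => t' _; rewrite mulr_suml; apply: eq_bigr => u' _.
  by rewrite en_kron en1 /=; ring.
rewrite exchange_big; apply: eq_bigr => u' _.
by rewrite en_mk mulr_suml.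
Qed.

Lemma psd_tr0 T (X : rop T T) : psd X -> rtr X = 0 -> X = 0.
Proof.
move=> /psd_ex [Y [hY ->]] h; suff -> : Y = 0 by rewrite mm0.
by apply: n2_eq0; rewrite /n2 hY.
Qed.

Lemma rtr_kronId T U (X : rop (T * U) (T * U)) (Z : rop U U) :
  rtr (X ** kron Id Z) = rtr (marg X ** Z).
Proof. by rewrite /rtr ctr_kronId. Qed.

Section State.
Variables (X Y : finType) (Phi : rop (X * Y) (X * Y)).
Hypothesis hPhi : psd Phi.
Hypothesis tPhi : rtr Phi = 1.

Let PhiY := marg Phi.

Lemma PhiY_psd : psd PhiY. Proof. exact: marg_psd. Qed.

Lemma PhiY_tr : rtr PhiY = 1.
Proof. by rewrite /rtr ctr_marg. Qed.

Definition condent : R := rtr (PhiY ** logm PhiY) - rtr (Phi ** logm Phi).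

(** Phi is supported on X (x) supp Phi_Y: the expectation of 1 (x) (1 - Pi) in Phi is tr Phi_Y (1 -
    Pi) = 0, and a positive operator of zero trace vanishes. *)
Lemma supp_data : exists (P : rop Y Y) (d : Y -> R),
  [/\ unit2 P, forall t, 0 <= d t, PhiY = P ^† ** dg (fun t => (d t)%:C%C) ** P,
   logm PhiY = P ^† ** dg (fun t => (if 0 < d t then log2 (d t) else 0)%:C%C) ** P
   & let Pi := P ^† ** dg (fun t => (if 0 < d t then 1 else 0)%:C%C) ** P in
     Pi ^† = Pi /\ Phi = kron Id Pi ** Phi ** kron Id Pi].
Proof.
have [P [d [hP d0 hS hf]]] := psdP PhiY_psd; have [h1 h2] := hP.
exists P, d; split=> //; first by rewrite logmE hf.
set Pi := P ^† ** _ ** P => /=.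
have hPi : Pi ^† = Pi by rewrite /Pi !adjE dg_adjr mmA.
split=> //.
pose G : rop (X * Y) (X * Y) := kron Id (Id - Pi).
have hGa : (Id - Pi) ^† = Id - Pi by rewrite adjB adj1 hPi.
have hG : G ^† = G by rewrite /G kron_adj adj1 hGa.
have hId : Id - Pi = P ^† ** dg (fun t => (if 0 < d t then 0 else 1)%:C%C) ** P.
  rewrite -h2 -{1}(mm1 (P ^†)) -dg1 /Pi -mmBl -mmBr dgB; congr (_ ** _ ** _).
  by apply: eq_dg => t; case: ifP => _; rewrite ?subrr ?subr0.
have hGG : G ** G = G.
  rewrite /G kronM mm1; congr (kron _ _).
  rewrite hId !mmA -(mmA _ P) h1 mm1 -(mmA _ (dg _) (dg _)) dgM; congr (_ ** _ ** _).
  by apply: eq_dg => t; case: ifP => _; rewrite ?mulr0 ?mulr1.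
have g0 : G ** Phi = 0.
  apply: psd_kernel => //; apply: psd_tr0; first exact: psd_conj.
  rewrite hG rtrC mmA hGG rtrC rtr_kronId -/PhiY hS hId !mmA -(mmA _ P) h1 mm1.
  rewrite -(mmA _ (dg _) (dg _)) dgM (_ : dg _ = 0) ?mm0 ?mm0l ?rtr0 //.
  apply: en_inj => s t; rewrite en_dg en0; case: ifPn; rewrite ?mulr0 ?mul0rn //.
  rewrite -leNgt => ds; have -> : d s = 0 by apply/le_anti; rewrite d0 ds.
  by rewrite mul0r mul0rn.
have kE : kron Id Pi = Id - G.
  by apply: en_inj => p q; rewrite enB -kron1 !en_kron enB; ring.
have g1 : Phi ** G = 0.
  by have := congr1 (@adj _ _ _) g0; rewrite adjM hG (psd_herm hPhi) adj0.
by rewrite kE mmBl mm1l g0 subr0 mmBr mm1 g1 subr0.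
Qed.

Lemma kronZ T U a (A : rop T T) (B : rop U U) : kron A (a *: B) = a *: kron A B.
Proof. by apply: en_inj => p q; rewrite enZ !en_kron enZ; ring. Qed.

(** A state is at most 1; compressed to its support this gives Phi <= 1 (x) Pi, and Pi is at most
    Phi_Y times the sum of its inverse nonzero eigenvalues. *)
Lemma Phi_dominated (c : R) : 0 < c -> dominated Phi (c%:C%C *: kron Id PhiY).
Proof.
move=> c0; have [P [d [[h1 h2] d0 hS _ [hPi hPhi2]]]] := supp_data.
set Pi := P ^† ** _ ** P in hPi hPhi2.
pose k := \sum_t (d t)^-1.
have k0 : 0 <= k by apply: sumr_ge0 => t _; rewrite invr_ge0.
exists (k / c); first by rewrite divr_ge0 // ltW.
rewrite scalerA -rmorphM (divfK (lt0r_neq0 c0)).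
have kA : (kron (Id : rop X X) Pi) ^† = kron Id Pi by rewrite kron_adj adj1 hPi.
have h3 := psd_le_tr hPhi; rewrite tPhi scale1r in h3.
have h4 := lel_conj (kron Id Pi) h3.
rewrite kA -hPhi2 mm1 kronM mm1 in h4.
apply: (lel_trans h4); rewrite -kronZ.
have -> : Pi ** Pi = Pi.
  rewrite /Pi !mmA -(mmA _ P) h1 mm1 -(mmA _ (dg _) (dg _)) dgM; congr (_ ** _ ** _).
  by apply: eq_dg => t; case: ifP => _; rewrite ?mulr0 ?mulr1.
rewrite /lel; have -> : kron Id (k%:C%C *: PhiY) - kron Id Pi =
    kron (Id : rop X X) (k%:C%C *: PhiY - Pi).
  by apply: en_inj => p q; rewrite enB !en_kron enB mulrBr.
apply: kron_psd; first exact: psd1.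
rewrite hS /Pi -mmZl -mmZr -mmBl -mmBr dgZ dgB; apply: psd_conj'.
rewrite (eq_dg (g := fun t => (k * d t - (if 0 < d t then 1 else 0))%:C%C)).
  apply: dg_psd => t; case: ifPn => dt; last by rewrite subr0 mulr_ge0.
  rewrite subr_ge0 /k (bigD1 t) //= mulrDl mulVf ?gt_eqF // lerDl mulr_ge0 //.
  by apply: sumr_ge0 => s _; rewrite invr_ge0.
by move=> t; rewrite rmorphB rmorphM.
Qed.

(** The logarithm of c Phi_Y is log c on the support only, that is (log c) Pi + log Phi_Y, since
    [logm] vanishes on kernels; Pi has expectation 1 in Phi_Y. *)
Lemma dre_marg (c : R) : 0 < c -> dre Phi (c%:C%C *: kron Id PhiY) = - log2 c - condent.
Proof.
move=> c0; have [P [d [hP d0 hS hl [hPi hPhi2]]]] := supp_data.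
set Pi := P ^† ** _ ** P in hPi hPhi2.
have hKP : unit2 (kron (Id : rop X X) P).
  by case: hP => h1 h2; split; rewrite kron_adj adj1 kronM mm1 ?h1 ?h2 kron1.
have krdg (f : Y -> R) : kron (Id : rop X X) (P ^† ** dg (fun t => (f t)%:C%C) ** P) =
   (kron Id P) ^† ** dg (fun p : X * Y => (f p.2)%:C%C) ** kron Id P.
  have -> : dg (fun p : X * Y => (f p.2)%:C%C) = kron Id (dg (fun t => (f t)%:C%C)).
    apply: en_inj => -[a b] [a2 b2]; rewrite en_dg en_kron en1 en_dg /= xpair_eqE.
    by case: (a == a2); rewrite ?mul1r ?mul0r // mulr0n.
  by rewrite kron_adj adj1 !kronM !mm1.
pose fL t : R := if 0 < d t then log2 c + log2 (d t) else 0.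
have -> : dre Phi (c%:C%C *: kron Id PhiY) = rtr (Phi ** logm Phi) -
    rtr (Phi ** kron Id (P ^† ** dg (fun t => (fL t)%:C%C) ** P)).
  rewrite /dre; congr (_ - rtr (_ ** _)).
  rewrite (krdg fL) logmE.
  rewrite (mxfun_diag (P := kron Id P) (d := fun p : X * Y => c * d p.2) _ hKP).
    congr (_ ** _ ** _); apply: eq_dg => p; rewrite /fL pmulr_rgt0 //; case: ifP => // dp.
    by rewrite /log2 lnM ?posrE // mulrDl.
  rewrite hS (krdg d) -mmZl -mmZr dgZ; congr (_ ** _ ** _); apply: eq_dg => p.
  by rewrite rmorphM.
have -> : P ^† ** dg (fun t => (fL t)%:C%C) ** P = (log2 c)%:C%C *: Pi + logm PhiY.
  rewrite hl /Pi -mmZl -mmZr -mmDl -mmDr dgZ; congr (_ ** _ ** _).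
  apply: en_inj => s t; rewrite enD !en_dg -mulrnDl -rmorphM -rmorphD /fL.
  by case: ifP => _; rewrite ?mulr1 // mulr0 addr0.
rewrite rtr_kronId -/PhiY mmDr rtrD mmZr rtrZ.
have -> : rtr (PhiY ** Pi) = 1; last by rewrite /condent mulr1; lra.
have PP : Pi ** Pi = Pi.
  case: hP => h1 h2; rewrite /Pi !mmA -(mmA _ P) h1 mm1 -(mmA _ (dg _) (dg _)) dgM.
  by congr (_ ** _ ** _); apply: eq_dg => t; case: ifP => _; rewrite ?mulr0 ?mulr1.
rewrite -rtr_kronId -[RHS]tPhi [in RHS]hPhi2 [in RHS]rtrC !mmA kronM mm1 PP rtrC //.
Qed.

Variable n : nat.
Local Notation D := {ffun 'I_n -> (X * Y)%type}.

Definition split_pair (p : D) : {ffun 'I_n -> X} * {ffun 'I_n -> Y} :=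
  ([ffun k => (p k).1], [ffun k => (p k).2]).

Definition join_pair (q : {ffun 'I_n -> X} * {ffun 'I_n -> Y}) : D := [ffun k => (q.1 k, q.2 k)].

Lemma split_pairK : cancel split_pair join_pair.
Proof. by move=> p; apply/ffunP => k; rewrite !ffunE; case: (p k). Qed.

Lemma join_pairK : cancel join_pair split_pair.
Proof. by move=> [a b]; congr (_, _); apply/ffunP => k; rewrite !ffunE. Qed.

Lemma split_pair_bij : bijective split_pair. Proof. exact: Bijective split_pairK join_pairK. Qed.

(* 1 (x) Z, acting on the Y parts only *)
Definition emb (Z : rop {ffun 'I_n -> Y} {ffun 'I_n -> Y}) : rop D D := reidx split_pair (kron Id Z).

Lemma embM Z1 Z2 : emb Z1 ** emb Z2 = emb (Z1 ** Z2).
Proof. by rewrite /emb -(reidxM split_pair_bij) kronM mm1. Qed.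

Lemma emb_adj Z : (emb Z) ^† = emb (Z ^†).
Proof. by rewrite /emb reidx_adj kron_adj adj1. Qed.

Lemma emb_psd Z : psd Z -> psd (emb Z).
Proof. by move=> h; apply: reidx_psd; apply: kron_psd => //; exact: psd1. Qed.

Lemma marg_pow : marg (reidx join_pair (Phi ^⊗ n)) = PhiY ^⊗ n.
Proof.
apply: en_inj => s t; rewrite en_mk en_tpw /PhiY.
under [RHS]eq_bigr do rewrite en_mk.
rewrite bigA_distr_bigA; apply: eq_bigr => f _; rewrite en_reidx en_tpw.
by apply: eq_bigr => k _; rewrite !ffunE.
Qed.

Lemma rtr_emb Z : rtr (Phi ^⊗ n ** emb Z) = rtr (PhiY ^⊗ n ** Z).
Proof.
rewrite -marg_pow -rtr_kronId.
have -> : Phi ^⊗ n = reidx split_pair (reidx join_pair (Phi ^⊗ n)) by rewrite reidxK //; exact: split_pairK.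
rewrite /emb -(reidxM split_pair_bij) (rtr_reidx split_pair_bij) reidxK //.
exact: join_pairK.
Qed.

End State.

(* A test accepting Phi^n whose acceptance probability on pi_X^n (x) omega is
   small for every omega at once. *)
Lemma universal_test (X Y : finType) (Phi : rop (X * Y) (X * Y)) (delta eta : R) :
  psd Phi -> rtr Phi = 1 -> 0 < delta -> 0 < eta ->
  exists n0, forall n, (n0 <= n)%N ->
  exists A : rop {ffun 'I_n -> (X * Y)%type} {ffun 'I_n -> (X * Y)%type},
  [/\ test A, 1 - eta <= rtr (A ** Phi ^⊗ n)
    & forall w, psd w -> rtr (A ** emb X w) <= pow2 (n%:R * (condent Phi + delta)) * rtr w].
Proof.
move=> hPhi tPhi delta0 eta0.
have d2 : 0 < delta / 2 by rewrite divr_gt0.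
pose eta' := (eta / 4) ^+ 2.
have e2 : 0 < eta' by rewrite exprn_gt0 // divr_gt0.
have e4 : 4 * Num.sqrt eta' = eta.
  by rewrite /eta' sqrtr_sqr ger0_norm; [field|apply: divr_ge0 => //; exact: ltW].
have hY := PhiY_psd hPhi; have tY := PhiY_tr tPhi.
have [n1 t1] := typical hY tY hY (dominated_refl _) d2 e2.
have [n2 t2] := typical hPhi tPhi hPhi (dominated_refl _) d2 e2.
exists (maxn n1 n2) => n; rewrite geq_max => /andP [hn1 hn2].
have [PY [[a1 a2 a3] _ a5 _]] := t1 n hn1.
have [P2 [[b1 b2 b3] b4 _ b6]] := t2 n hn2.
pose P1 := emb X PY.
have c1 : P1 ^† = P1 by rewrite /P1 emb_adj a1.
have c2 : P1 ** P1 = P1 by rewrite /P1 embM a2.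
have c3 : 1 - eta' <= rtr (Phi ^⊗ n ** P1) by rewrite rtr_emb.
have tP1 := proj_test c1 c2; have tP2 := proj_test b1 b2; have tPY := proj_test a1 a2.
have hrn := psd_tpw n hPhi; have r1n := rtr_tpw1 n hPhi tPhi.
exists (P1 ** P2 ** P1); split; first exact: test_conj tP2 c1 c2.
- have := gentle hrn r1n b1 b2 c1 c2 b3 c3 (test1 R _); rewrite e4 !mm1l r1n.
  rewrite ler_norml => /andP [_]; suff -> : rtr (P2 ** P1 ** Phi ^⊗ n ** P1 ** P2)
    = rtr (P1 ** P2 ** P1 ** Phi ^⊗ n) by lra.
  by rewrite rtrC !mmA b2 rtrC !mmA.
- move=> w hw.
  pose w' := PY ** w ** PY.
  have hw' : psd w' by have := psd_conj PY hw; rewrite a1.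
  have -> : rtr (P1 ** P2 ** P1 ** emb X w) = rtr (emb X w' ** P2).
    by rewrite /w' -!embM -/P1 -(mmA (P1 ** P2)) rtrC !mmA.
  set a := pow2 (n%:R * (rtr (Phi ** logm Phi) - delta / 2)) in b6.
  set b := pow2 (n%:R * (rtr (marg Phi ** logm (marg Phi)) + delta / 2)) in a5.
  (* a P2 <= Phi^n replaces the test by Phi^n, which sees only its Y marginal on 1 (x) w', and PY
     caps that marginal at b. Only tr w survives, so the bound is uniform in w. *)
  have s1 : a * rtr (emb X w' ** P2) <= rtr (marg Phi ^⊗ n ** w').
    have := lel_rtr (emb_psd X hw') (lel_trans b6 b4).
    by rewrite mmZr rtrZ [X in _ <= X]rtrC rtr_emb.
  have s2 : rtr (marg Phi ^⊗ n ** w') <= b * rtr w.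
    have -> : rtr (marg Phi ^⊗ n ** w') = rtr (w ** (PY ** marg Phi ^⊗ n ** PY)).
      by rewrite /w' !mmA rtrC !mmA rtrC !mmA.
    apply: le_trans (lel_rtr hw a5) _; rewrite mmZr rtrZ.
    apply: ler_wpM2l; first exact/ltW/pow2_gt0.
    by rewrite rtrC; exact: test_le1.
  have -> : pow2 (n%:R * (condent Phi + delta)) = b / a.
    rewrite /a /b -pow2N -pow2D; congr pow2; rewrite /condent.
    by move: (rtr _) (rtr _) => x y; clear; field.
  by rewrite mulrAC ler_pdivlMr ?pow2_gt0 // mulrC; exact: le_trans s1 s2.
Qed.

End Conditional.

(** * Powers of channels *)

Section Powers.
Variable R : realType.
Local Notation C := (R[i]).
Local Notation rop := (rop R).

Local Notation "X ^⊗ n" := (tpw (fun _ : 'I_n => X)) (at level 29).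

Lemma tpwZ n (T U : finType) (c : 'I_n -> C) (X : 'I_n -> rop T U) :
  tpw (fun k => c k *: X k) = (\prod_k c k) *: tpw X.
Proof.
apply: en_inj => p q; rewrite enZ !en_tpw -big_split /=.
by apply: eq_bigr => k _; rewrite enZ.
Qed.

Lemma tpw_sum_dep n (T U I : finType) (F : 'I_n -> I -> rop T U) :
  tpw (fun k => \sum_j F k j) = \sum_(f : {ffun 'I_n -> I}) tpw (fun k => F k (f k)).
Proof.
apply: en_inj => p q; rewrite en_tpw en_sum.
under eq_bigr do rewrite en_sum.
by rewrite bigA_distr_bigA; apply: eq_bigr => f _; rewrite en_tpw.
Qed.

Lemma eq_tpw n (T U : finType) (X Y : 'I_n -> rop T U) : (forall k, X k = Y k) -> tpw X = tpw Y.
Proof.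
by move=> h; apply: en_inj => p q; rewrite !en_tpw; apply: eq_bigr => k _; rewrite h.
Qed.

Lemma prod_eq n (T : finType) (a b : {ffun 'I_n -> T}) :
  \prod_k ((a k == b k)%:R : C) = (a == b)%:R.
Proof.
case: eqP => [->|/eqP ab]; first by rewrite big1 // => k _; rewrite eqxx.
have /existsP [k hk] : [exists k, a k != b k].
  rewrite -negb_forall; apply: contra ab => /forallP h.
  by apply/eqP/ffunP => k; apply/eqP.
by rewrite (bigD1 k) //= (negPf hk) mul0r.
Qed.

Section Power.
Variables (S O Sn On : finType) (n : nat).
Variables (f : Sn -> {ffun 'I_n -> S}) (g : On -> {ffun 'I_n -> O}).
Hypotheses (bf : bijective f) (bg : bijective g).

Definition pairup (p : Sn * On) : {ffun 'I_n -> (S * O)%type} :=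
  [ffun k => (f p.1 k, g p.2 k)].

Lemma pairup_bij : bijective pairup.
Proof.
case: bf bg => f' f1 f2 [g' g1 g2].
exists (fun d : {ffun 'I_n -> (S * O)%type} => (f' [ffun k => (d k).1], g' [ffun k => (d k).2])).
  move=> [a b]; congr (_, _).
    by rewrite -[RHS]f1; congr f'; apply/ffunP => k; rewrite !ffunE.
  by rewrite -[RHS]g1; congr g'; apply/ffunP => k; rewrite !ffunE.
move=> d; apply/ffunP => k; rewrite ffunE /= f2 g2 !ffunE; by case: (d k).
Qed.

Lemma card_Sn : (#|Sn| = #|S| ^ n)%N.
Proof. by rewrite (bij_eq_card bf) card_ffun card_ord. Qed.

(** Sn and On are arbitrary copies of the powers, identified by f and g: the n-fold bipartite
    channel acts on pairs of functions, the n-fold marginal on plain functions. *)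
Definition powchan (M : op R S -> op R O) : op R Sn -> op R On := app (reidx pairup (J M ^⊗ n)).

Lemma J_powchan M : J (powchan M) = reidx pairup (J M ^⊗ n).
Proof. exact: J_app. Qed.

Lemma nchoi_powchan M : nchoi (powchan M) = reidx pairup (nchoi M ^⊗ n).
Proof.
rewrite !nchoiE J_powchan tpwZ reidxZ; congr (_ *: _).
by rewrite prodr_const card_ord card_Sn -!invC -!natrC natrX exprVn.
Qed.

Lemma Kt_munit p q : Kt On (munit R p q) =
  reidx pairup (tpw (fun k => Kt O (munit R (f p k) (f q k)))).
Proof.
apply: en_inj => a b; rewrite en_reidx en_tpw en_mk en_munit.
transitivity (\prod_k (((f b.1 k == f p k)%:R * (f a.1 k == f q k)%:R)
                       * (g b.2 k == g a.2 k)%:R : C)).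
  rewrite !big_split /= !prod_eq !(bij_eq bf) (bij_eq bg).
  by congr (_ * _); rewrite -natrM mulnb.
by apply: eq_bigr => k _; rewrite en_mk en_munit !ffunE /= -natrM mulnb.
Qed.

Lemma powchan_channel M : is_channel M -> is_channel (powchan M).
Proof.
move=> hM; have lM := channel_lin hM; apply: is_channelI; first exact: app_lin.
  by rewrite J_powchan; apply: reidx_psd; apply: psd_tpw; exact: channel_J.
move=> X; have l : lin (powchan M) by exact: app_lin.
(* Trace preservation is linear in X, and on matrix units [Kt] is a tensor product, so the
   single-copy statement applies to each factor. *)
rewrite (op_decomp X) lin_sum // !tr_sum; apply: eq_bigr => s _.
rewrite lin_sum // !tr_sum; apply: eq_bigr => t _; rewrite linZ // !trZ; congr (_ * _).
rewrite -ctr_Kt Kt_munit -(reidxM pairup_bij) (ctr_reidx pairup_bij) tpwM ctr_tpw.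
under eq_bigr do rewrite ctr_Kt app_J // (channel_tp hM) ctr_munit.
by rewrite prod_eq (bij_eq bf) ctr_munit.
Qed.

Lemma Kt_decomp tau : Kt On tau = \sum_(s : Sn) \sum_t en tau s t *: Kt On (munit R s t).
Proof.
apply: en_inj => p q; rewrite en_mk {1}(op_decomp tau) !en_sum mulr_suml.
apply: eq_bigr => s _; rewrite !en_sum mulr_suml; apply: eq_bigr => t _.
by rewrite !enZ en_mk mulrA.
Qed.

Variables (I : finType) (x : I -> rop (S * O) (S * O)).

Definition xpow (h : {ffun 'I_n -> I}) : rop (Sn * On) (Sn * On) :=
  reidx pairup (tpw (fun k => x (h k))).

Lemma krausA_xpow (Y : 'I_n -> rop (S * O) (S * O)) :
  krausA xpow (reidx pairup (tpw Y)) = reidx pairup (tpw (fun k => krausA x (Y k))).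
Proof.
rewrite /krausA tpw_sum_dep reidx_sum; apply: eq_bigr => h _.
by rewrite /xpow reidx_adj -!(reidxM pairup_bij) tpwA !tpwM.
Qed.

(** [Kt] of a general, possibly entangled, input does not factor, but on matrix units it does; both
    sides are linear in the input. *)
Lemma twirling_pow : (0 < #|S|)%N -> twirling x -> twirling xpow.
Proof.
move=> s0 [i0 hu ht]; split.
- by rewrite card_ffun card_ord expn_gt0 i0.
- move=> h; split; rewrite /xpow reidx_adj -(reidxM pairup_bij) tpwA tpwM.
    rewrite (eq_tpw (Y := fun=> Id)) => [|k]; last by case: (hu (h k)).
    by rewrite tpw1 (reidx1 R pairup_bij).
  rewrite (eq_tpw (Y := fun=> Id)) => [|k]; last by case: (hu (h k)).
  by rewrite tpw1 (reidx1 R pairup_bij).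
move=> tau.
have hm (s t : Sn) : krausA xpow (Kt On (munit R s t)) =
     (#|{ffun 'I_n -> I}|%:R * ctr (munit R s t) / #|Sn|%:R) *: Id.
  rewrite Kt_munit krausA_xpow.
  rewrite (eq_tpw (Y := fun k => (#|I|%:R * ctr (munit R (f s k) (f t k)) / #|S|%:R) *: Id)).
    rewrite tpwZ reidxZ tpw1 (reidx1 R pairup_bij); congr (_ *: _).
    rewrite !big_split /= !prodr_const !card_ord ctr_munit.
    under eq_bigr do rewrite ctr_munit.
    by rewrite prod_eq (bij_eq bf) card_ffun card_ord card_Sn !natrX exprVn.
  by move=> k; exact: ht.
have kZ a X : krausA xpow (a *: X) = a *: krausA xpow X.
  by rewrite /krausA scaler_sumr; apply: eq_bigr => i _; rewrite mmZr mmZl.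
have ks (J0 : finType) (F : J0 -> rop (Sn * On) (Sn * On)) :
    krausA xpow (\sum_j F j) = \sum_j krausA xpow (F j).
  rewrite /krausA exchange_big; apply: eq_bigr => i _ /=.
  by rewrite mm_sumr mm_suml.
rewrite Kt_decomp ks.
under eq_bigr do rewrite ks.
rewrite {2}(op_decomp tau) tr_sum mulr_sumr mulr_suml scaler_suml; apply: eq_bigr => s _.
rewrite tr_sum mulr_sumr mulr_suml scaler_suml; apply: eq_bigr => t _.
by rewrite kZ hm scalerA trZ; congr (_ *: _); ring.
Qed.

Lemma invar_pow X : invar x X -> invar xpow (reidx pairup (X ^⊗ n)).
Proof.
move=> h i; rewrite /xpow reidx_adj -!(reidxM pairup_bij) tpwA !tpwM; congr (reidx _ _).
by apply: eq_tpw => k.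
Qed.

End Power.

End Powers.

(** * Tele-covariance *)

Section SingleLetter.
Variable R : realType.
Local Notation C := (R[i]).
Local Notation rop := (rop R).
Implicit Types T U S O : finType.

Lemma ctr_inj T (X Y : rop T T) : (forall B, ctr (X ** B) = ctr (Y ** B)) -> X = Y.
Proof.
move=> h; have aux Z s t : ctr (Z ** munit R t s) = en Z s t :> C.
  rewrite ctrM_en -[RHS](sum_pick2_sym (en Z) s t); apply: eq_bigr => x _.
  by apply: eq_bigr => y _; rewrite en_munit (eq_sym x) (eq_sym y) andbC.
by apply: en_inj => s t; rewrite -!aux.
Qed.

Lemma marg_kron T U (W : rop T T) (Z : rop U U) (X : rop (T * U) (T * U)) : unit2 W ->
  marg (kron W Z ** X ** (kron W Z) ^†) = Z ** marg X ** Z ^†.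
Proof.
move=> [_ hW]; apply: ctr_inj => B; rewrite -ctr_kronId kron_adj.
rewrite -!mmA trC -!mmA !kronM mm1l hW ctr_kronId [RHS]trC -!mmA //.
Qed.

Definition conjop T U (X : rop T U) : rop T U := mk (fun s t => (en X s t)^*).

(** The vector sum of all |ss> is fixed by conj(u) (x) u, so covariance of the map becomes
    invariance of its Choi matrix. *)
Lemma invar_J S O (M : op R S -> op R O) (u : rop S S) (w : rop O O) : lin M -> unit2 u ->
  (forall X, M (u ** X ** u ^†) = w ** M X ** w ^†) ->
  kron (conjop u) w ** J M ** (kron (conjop u) w) ^† = J M.
Proof.
move=> l [h1 h2] hM; apply: en_inj => -[s a] [t b].
rewrite [RHS]en_J /=.
have -> : munit R s t = u ** (u ^† ** munit R s t ** u) ** u ^†.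
  by rewrite !mmA h1 mm1l -mmA h1 mm1.
rewrite hM; set Z := u ^† ** _ ** u.
have enZ' c d : en Z c d = (en u s c)^* * en u t d.
  rewrite /Z enM; transitivity (\sum_y \sum_x ((en u x c)^* * en u y d) * ((x == s) && (y == t))%:R).
    apply: eq_bigr => y _; rewrite enM mulr_suml; apply: eq_bigr => x _.
    by rewrite enA en_munit; ring.
  by rewrite exchange_big; exact: (sum_pick2 (fun x y => (en u x c)^* * en u y d)).
rewrite !enM sum_pair exchange_big; apply: eq_bigr => d _ /=.
rewrite enM mulr_suml.
transitivity (\sum_(c : S) \sum_(b1 : O) \sum_(a1 : S) en w a b1 *
   ((en u s a1)^* * en u t c * en (J M) (a1, b1) (c, d)) * (en w b d)^*).
  apply: eq_bigr => c _; rewrite enM sum_pair exchange_big mulr_suml; apply: eq_bigr => b1 _.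
  rewrite mulr_suml; apply: eq_bigr => a1 _.
  by rewrite enA !en_kron !en_mk /= conjM conjK; ring.
rewrite exchange_big; apply: eq_bigr => b1 _ /=.
rewrite -(app_J Z l) en_app enA mulr_sumr mulr_suml exchange_big; apply: eq_bigr => a1 _ /=.
rewrite mulr_sumr mulr_suml; apply: eq_bigr => c _.
by rewrite enZ'; ring.
Qed.

(** The hypothesis concerns states only. The defect of the identity is linear and vanishes on
    rank-one states, hence on all rank-one operators, and these determine a linear functional. *)
Lemma twirl_ext (G : finType) T (U : G -> rop T T) :
  (forall rho : op R T, state rho ->
     (#|G|%:R)^-1 *: \sum_g (U g *m rho *m (U g) ^t*) = (#|T|%:R)^-1 *: 1%:M) ->
  (0 < #|G|)%N ->
  forall X, \sum_g U g ** X ** (U g) ^† = (#|G|%:R * ctr X / #|T|%:R) *: Id.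
Proof.
move=> h g0 X.
have gn : (#|G|%:R : C) != 0 by rewrite pnatr_eq0 -lt0n.
pose De (X : rop T T) := \sum_g U g ** X ** (U g) ^† - (#|G|%:R * ctr X / #|T|%:R) *: Id.
have DeL a Y Z : De (a *: Y + Z) = a *: De Y + De Z.
  rewrite /De scalerBr scaler_sumr addrACA -opprD -big_split; congr (_ - _).
    by apply: eq_bigr => g _; rewrite mmDr mmDl mmZr mmZl.
  by rewrite trD trZ scalerA -scalerDl; congr (_ *: _); ring.
have De0 (v : T -> C) : De (ketbra v) = 0.
  have hp := ketbra_psd v.
  have [t0|tn] := eqVneq (rtr (ketbra v)) 0.
    rewrite (psd_tr0 hp t0) /De tr0 mulr0 mul0r scale0r subr0 big1 // => g _.
    by rewrite mm0 mm0l.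
  pose c := rtr (ketbra v).
  have c0 : 0 <= c by exact: rtr_psd.
  have hs : state ((c^-1)%:C%C *: ketbra v).
    apply/stateE; split; first by apply: psdZ; rewrite ?invr_ge0.
    by rewrite trZ (ge0_Re (tr_psd hp)) -/(rtr _) -/c -rmorphM mulVf.
  have := h _ hs; rewrite idtE => hh.
  have e : \sum_g U g ** ketbra v ** (U g) ^† = (c%:C%C * #|G|%:R) *:
     ((#|G|%:R)^-1 *: \sum_g (U g *m ((c^-1)%:C%C *: ketbra v) *m (U g) ^t*)).
    rewrite scalerA -mulrA mulfV // mulr1 scaler_sumr; apply: eq_bigr => g _.
    by rewrite adjmxE !mmE mmZr mmZl scalerA -rmorphM mulfV // scale1r.
  rewrite /De e hh (ge0_Re (tr_psd hp)) -/(rtr _) -/c scalerA; apply/eqP.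
  by rewrite subr_eq0; apply/eqP; congr (_ *: _); ring.
suff : De X = 0 by move/eqP; rewrite subr_eq0 => /eqP.
apply: en_inj => s t; rewrite en0.
have [L hL] := riesz (phi := fun Y => en (De Y) s t)
  (fun a Y Z => eq_trans (congr1 (fun W => en W s t) (DeL a Y Z))
     (eq_trans (enD _ _ _ _) (congr1 (fun z => z + _) (enZ _ _ _ _)))).
rewrite hL; suff -> : L = 0 by rewrite mm0l tr0.
by apply: qf_eq0 => v; rewrite -ctr_ketbra -hL De0 en0.
Qed.

Lemma munit_kron T1 T2 (s t : T1 * T2) : munit R s t = kron (munit R s.1 t.1) (munit R s.2 t.2).
Proof.
apply: en_inj => -[a b] [c d]; rewrite en_kron !en_munit -natrM mulnb /=.
by case: s t => [s1 s2] [t1 t2] /=; rewrite !xpair_eqE andbACA.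
Qed.

Lemma twirl_kron (G H : finType) T1 T2 (U : G -> rop T1 T1) (V : H -> rop T2 T2) :
  (forall X, \sum_g U g ** X ** (U g) ^† = (#|G|%:R * ctr X / #|T1|%:R) *: Id) ->
  (forall X, \sum_h V h ** X ** (V h) ^† = (#|H|%:R * ctr X / #|T2|%:R) *: Id) ->
  forall X, \sum_(gh : G * H) kron (U gh.1) (V gh.2) ** X ** (kron (U gh.1) (V gh.2)) ^†
    = (#|{: G * H}|%:R * ctr X / #|{: T1 * T2}|%:R) *: Id.
Proof.
move=> hU hV X.
rewrite {2}(op_decomp X) tr_sum mulr_sumr mulr_suml scaler_suml.
transitivity (\sum_s \sum_t en X s t *:
   \sum_(gh : G * H) kron (U gh.1) (V gh.2) ** munit R s t ** (kron (U gh.1) (V gh.2)) ^†).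
  under [RHS]eq_bigr do under eq_bigr do rewrite scaler_sumr.
  under [RHS]eq_bigr do rewrite exchange_big.
  rewrite [RHS]exchange_big; apply: eq_bigr => gh _ /=.
  rewrite {1}(op_decomp X) mm_sumr mm_suml; apply: eq_bigr => s _.
  rewrite mm_sumr mm_suml; apply: eq_bigr => t _.
  by rewrite mmZr mmZl.
apply: eq_bigr => s _; rewrite tr_sum mulr_sumr mulr_suml scaler_suml.
apply: eq_bigr => t _; rewrite trZ.
have -> : \sum_(gh : G * H) kron (U gh.1) (V gh.2) ** munit R s t ** (kron (U gh.1) (V gh.2)) ^†
  = kron (\sum_g U g ** munit R s.1 t.1 ** (U g) ^†) (\sum_h V h ** munit R s.2 t.2 ** (V h) ^†).
  apply: en_inj => p q; rewrite en_sum en_kron !en_sum mulr_suml sum_pair.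
  apply: eq_bigr => g _; rewrite mulr_sumr; apply: eq_bigr => h _ /=.
  by rewrite munit_kron kron_adj !kronM en_kron.
rewrite hU hV; have -> : kron ((#|G|%:R * ctr (munit R s.1 t.1) / #|T1|%:R) *: Id)
   ((#|H|%:R * ctr (munit R s.2 t.2) / #|T2|%:R) *: Id) =
   ((#|G|%:R * ctr (munit R s.1 t.1) / #|T1|%:R) * (#|H|%:R * ctr (munit R s.2 t.2) / #|T2|%:R))
     *: (Id : rop (T1 * T2) (T1 * T2)).
  by apply: en_inj => p q; rewrite enZ -kron1 !en_kron !enZ; ring.
rewrite scalerA; congr (_ *: _).
by rewrite {1}munit_kron ctr_kron !card_prod !natrM invfM; ring.
Qed.

Lemma conjop_unit2 T (u : rop T T) : unit2 u -> unit2 (conjop u).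
Proof.
have conjopM (X Y : rop T T) : conjop X ** conjop Y = conjop (X ** Y).
  apply: en_inj => s t; rewrite en_mk !enM rmorph_sum; apply: eq_bigr => v _.
  by rewrite !en_mk /= conjM.
have conjopA (X : rop T T) : (conjop X) ^† = conjop (X ^†).
  by apply: en_inj => s t; rewrite enA !en_mk enA.
have conjop1 : conjop (Id : rop T T) = Id.
  by apply: en_inj => s t; rewrite en_mk en1 conjC_nat.
by case=> h1 h2; split; rewrite conjopA conjopM ?h1 ?h2 conjop1.
Qed.

Lemma kron_unit2 T U (u : rop T T) (w : rop U U) : unit2 u -> unit2 w -> unit2 (kron u w).
Proof. by move=> [h1 h2] [k1 k2]; split; rewrite kron_adj kronM ?h1 ?h2 ?k1 ?k2 kron1. Qed.

Lemma Kt_kron S O (tau : rop S S) : Kt O tau = kron (trp tau) Id.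
Proof.
by apply: en_inj => p q; rewrite en_mk en_kron en_mk en1 (eq_sym q.2).
Qed.

Lemma conjop_conj_trp T (u X : rop T T) : (conjop u) ^† ** trp X ** conjop u = trp (u ^† ** X ** u).
Proof.
apply: en_inj => s t; rewrite en_mk !enM.
transitivity (\sum_y \sum_x en u x s * en X y x * (en u y t)^*).
  apply: eq_bigr => y _; rewrite enM mulr_suml; apply: eq_bigr => x _.
  by rewrite enA !en_mk conjK.
rewrite exchange_big; apply: eq_bigr => x _ /=; rewrite enM mulr_suml.
by apply: eq_bigr => y _; rewrite enA; ring.
Qed.

Lemma en_lin T U (F : op R T -> op R U) X a b : lin F ->
  en (F X) a b = \sum_s \sum_t en X s t * en (F (munit R s t)) a b.
Proof.
move=> l; rewrite {1}(op_decomp X) (lin_sum l) en_sum; apply: eq_bigr => s _.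
by rewrite (lin_sum l) en_sum; apply: eq_bigr => t _; rewrite (linZ _ _ l) enZ.
Qed.

Lemma tensmap_kron T1 T2 U1 U2 (F1 : op R T1 -> op R U1) (F2 : op R T2 -> op R U2) X Y :
  lin F1 -> lin F2 -> tensmap F1 F2 (kron X Y) = kron (F1 X) (F2 Y).
Proof.
move=> l1 l2; apply: en_inj => p q; rewrite en_tensmap en_kron (en_lin _ _ _ l1) (en_lin _ _ _ l2).
rewrite sum_pair mulr_suml; apply: eq_bigr => s1 _; rewrite mulr_sumr; apply: eq_bigr => s2 _ /=.
rewrite sum_pair mulr_suml; apply: eq_bigr => t1 _; rewrite mulr_sumr; apply: eq_bigr => t2 _ /=.
by rewrite en_kron /=; ring.
Qed.

Lemma tensmap_covar T1 T2 U1 U2 (F1 : op R T1 -> op R U1) (F2 : op R T2 -> op R U2)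
    (u1 : rop T1 T1) (u2 : rop T2 T2) (w1 : rop U1 U1) (w2 : rop U2 U2) :
  lin F1 -> lin F2 ->
  (forall X, F1 (u1 ** X ** u1 ^†) = w1 ** F1 X ** w1 ^†) ->
  (forall X, F2 (u2 ** X ** u2 ^†) = w2 ** F2 X ** w2 ^†) ->
  forall X, tensmap F1 F2 (kron u1 u2 ** X ** (kron u1 u2) ^†) =
     kron w1 w2 ** tensmap F1 F2 X ** (kron w1 w2) ^†.
Proof.
move=> l1 l2 c1 c2 X; have l := tensmap_lin F1 F2.
rewrite (op_decomp X) mm_sumr mm_suml !(lin_sum l) mm_sumr mm_suml.
apply: eq_bigr => s _; rewrite mm_sumr mm_suml !(lin_sum l) mm_sumr mm_suml.
apply: eq_bigr => t _; rewrite mmZr mmZl !(linZ _ _ l) mmZr mmZl; congr (_ *: _).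
by rewrite munit_kron !kron_adj !kronM !tensmap_kron // c1 c2 !kronM.
Qed.

Section TeleCovariant.
Variables (A' B' A B : finType) (N : op R (A' * B') -> op R (A * B)).
Hypothesis hN : is_channel N.
Hypothesis a0' : (0 < #|A'|)%N.

(** The output on B may depend on the input on A'; the maximally mixed input is the one for which
    [marg_choi] holds. *)
Definition Bmarg : op R B' -> op R B :=
  fun X => marg (N (((#|A'|%:R : R)^-1)%:C%C *: kron (Id : rop A' A') X)).

Lemma kronDr T U (X : rop T T) a (Y Z : rop U U) : kron X (a *: Y + Z) = a *: kron X Y + kron X Z.
Proof. by apply: en_inj => p q; rewrite enD enZ !en_kron enD enZ; ring. Qed.

Lemma margD T U a (X Y : rop (T * U) (T * U)) :
  marg (a *: X + Y) = a *: marg X + marg Y.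
Proof.
apply: en_inj => s t; rewrite enD enZ !en_mk mulr_sumr -big_split.
by apply: eq_bigr => k _; rewrite enD enZ.
Qed.

Lemma Bmarg_lin : lin Bmarg.
Proof.
move=> a X Y; rewrite /Bmarg kronDr scalerDr.
have -> (c : C) (Z : rop (A' * B') (A' * B')) : c *: (a *: Z) = a *: (c *: Z).
  by rewrite !scalerA mulrC.
by rewrite (channel_lin hN) margD.
Qed.

Lemma kron_Id_munit T U (s t : U) : kron (Id : rop T T) (munit R s t) = \sum_k munit R (k, s) (k, t).
Proof.
apply: en_inj => -[a b] [c d]; rewrite en_sum en_kron en1 en_munit /=.
transitivity (\sum_k ((a == c) && ((b == s) && (d == t)))%:R * (a == k)%:R : C).
  by rewrite (sum_pick_sym (fun=> _) a) -natrM mulnb.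
apply: eq_bigr => k _; rewrite en_munit !xpair_eqE -natrM mulnb; congr (nat_of_bool _)%:R.
by case: (a =P k) => [->|_]; rewrite ?andbF // andbT eq_sym andbACA andbA /=.
Qed.

Lemma Bmarg_J (p q : B' * B) : en (J Bmarg) p q =
  (#|A'|%:R)^-1 * \sum_a \sum_k en (J N) ((k, p.1), (a, p.2)) ((k, q.1), (a, q.2)).
Proof.
rewrite en_J /Bmarg en_mk mulr_sumr; apply: eq_bigr => a _.
have lN := channel_lin hN.
rewrite linZ // enZ kron_Id_munit lin_sum // en_sum natrC invC; congr (_ * _).
by apply: eq_bigr => k _; rewrite en_J.
Qed.

Definition regroup (p : (A' * B') * (A * B)) : (A' * A) * (B' * B) :=
  ((p.1.1, p.2.1), (p.1.2, p.2.2)).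

Lemma regroup_bij : bijective regroup.
Proof.
exists (fun p => ((p.1.1, p.2.1), (p.1.2, p.2.2))).
  by move=> [[a b] [c d]].
by move=> [[a b] [c d]].
Qed.

Lemma nchoi_choi : nchoi N = reidx regroup (choi N).
Proof.
apply: en_inj => p q; rewrite nchoiE enZ en_reidx en_J /choi mkopE en_mk entE card_prod /=.
by rewrite natrC invC -!surjective_pairing.
Qed.

Lemma choi_psd : psd (choi N).
Proof.
have [r' h1 h2] := regroup_bij; rewrite -(reidxK (choi N) h2) -nchoi_choi.
by apply: reidx_psd; exact: nchoi_psd.
Qed.

Lemma choi_tr : (0 < #|{: A' * B'}|)%N -> rtr (choi N) = 1.
Proof. by move=> s0; rewrite -(rtr_reidx regroup_bij) -nchoi_choi; apply/rtr1/nchoi_tr. Qed.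

Lemma marg_choi : marg (choi N) = nchoi Bmarg.
Proof.
apply: en_inj => p q; rewrite nchoiE enZ Bmarg_J en_mk sum_pair exchange_big mulrA mulr_sumr.
apply: eq_bigr => a _; rewrite mulr_sumr; apply: eq_bigr => k _.
rewrite /choi mkopE en_mk entE en_J /=.
by rewrite natrM invfM !natrC !invC; congr (_ * _); rewrite mulrC.
Qed.

Lemma Bmarg_channel : (0 < #|B'|)%N -> is_channel Bmarg.
Proof.
move=> b0; apply: is_channelI; [exact: Bmarg_lin| |].
  have -> : J Bmarg = ((#|B'|%:R : R))%:C%C *: nchoi Bmarg.
    by rewrite nchoiE scalerA -rmorphM mulfV ?scale1r // pnatr_eq0 -lt0n.
  by apply: psdZ; rewrite ?ler0n // -marg_choi; apply: marg_psd; exact: choi_psd.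
move=> X; rewrite /Bmarg ctr_marg (channel_tp hN) trZ ctr_kron ctr_Id natrC mulrA -rmorphM.
by rewrite mulVf ?mul1r // pnatr_eq0 -lt0n.
Qed.

Lemma nchoi_tens_Id (G : op R A' -> op R A) (k : R) (Q : op R B' -> op R B) : J G = k%:C%C *: Id ->
  nchoi (tensmap G Q) = reidx regroup ((k / #|A'|%:R)%:C%C *: kron Id (nchoi Q)).
Proof.
move=> hG; apply: en_inj => p q; rewrite !nchoiE enZ en_reidx enZ en_J_tensmap.
rewrite hG [en (kron _ _) _ _]en_kron !enZ !en1 /= card_prod natrM invfM !rmorphM /=; ring.
Qed.

Hypothesis hT : tele_covariant N.

(** The Choi matrices are conjugated by conj(U (x) V) (x) (W (x) Z). The output unitaries cancel in
    [Kt], leaving the average over the two input representations, which is completely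
    depolarising. *)
Lemma tele_twirl : (0 < #|{: A' * B'}|)%N ->
  exists (I : finType) (x : I -> rop ((A' * B') * (A * B)) _),
  [/\ twirling x, invar x (J N) & invar x (J (tensmap (@rep_pi R A' A) Bmarg))].
Proof.
move=> s0; case: hT => gT [hT' [U [V [W [Z [[hU hV hW hZ] cov tU tV]]]]]].
have uU g : unit2 (U g) by case: hU => _ _ h; exact/unitary_unit2/h.
have uV g : unit2 (V g) by case: hV => _ _ h; exact/unitary_unit2/h.
have uW g h : unit2 (W g h) by case: hW => _ _ k; exact/unitary_unit2/k.
have uZ g h : unit2 (Z g h) by case: hZ => _ _ k; exact/unitary_unit2/k.
have cov' g h X : N (kron (U g) (V h) ** X ** (kron (U g) (V h)) ^†) =
    kron (W g h) (Z g h) ** N X ** (kron (W g h) (Z g h)) ^†.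
  have := cov g h X; rewrite !tens_kron.
  by rewrite !adjmxE !mmE.
(* The maximally mixed input on A' is fixed by every U g, and the trace over A removes W g h. *)
have cQ g h X : Bmarg (V h ** X ** (V h) ^†) = Z g h ** Bmarg X ** (Z g h) ^†.
  rewrite /Bmarg; have [u1 u2] := uU g.
  have -> : (((#|A'|%:R : R)^-1)%:C%C *: kron (Id : rop A' A') (V h ** X ** (V h) ^†))
     = kron (U g) (V h) ** (((#|A'|%:R : R)^-1)%:C%C *: kron (Id : rop A' A') X) ** (kron (U g) (V h)) ^†.
    by rewrite mmZr mmZl kron_adj !kronM mm1 u1.
  by rewrite cov' marg_kron.
exists (gT * hT')%type, (fun gh => kron (conjop (kron (U gh.1) (V gh.2))) (kron (W gh.1 gh.2) (Z gh.1 gh.2))).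
have g0 : (0 < #|gT|)%N by apply/card_gt0P; exists 1%g.
have h0 : (0 < #|hT'|)%N by apply/card_gt0P; exists 1%g.
have uUV gh : unit2 (kron (U gh.1) (V gh.2)) by exact: kron_unit2.
split.
- split.
  + by rewrite card_prod muln_gt0 g0.
  + by move=> gh; apply: kron_unit2; [exact/conjop_unit2|exact: kron_unit2].
  + move=> tau.
    (* [krausA] averages over adjoints; these are the representatives of the inverses, and inversion
       permutes the group. *)
    have inv_rep (G : finGroupType) (T : finType) (X : G -> op R T) : unitary_rep X ->
        (forall g, unit2 (X g)) -> forall g, X (g^-1)%g = (X g) ^†.
      move=> [r1 r2 _] hu g; have [u1 u2] := hu g.
      have := r2 (g^-1)%g g; rewrite mulVg r1 idtE mmE => e.
      by rewrite -[X _]mm1 -u1 mmA -e mm1l.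
    have tw1 (G : finGroupType) (T : finType) (X : G -> op R T) : unitary_rep X ->
        (forall g, unit2 (X g)) ->
        (forall Y, \sum_g X g ** Y ** (X g) ^† = (#|G|%:R * ctr Y / #|T|%:R) *: Id) ->
        forall Y, \sum_g (X g) ^† ** Y ** (X g) ^† ^† = (#|G|%:R * ctr Y / #|T|%:R) *: Id.
      move=> hX hu h Y; rewrite -h [RHS](reindex (@invg G)) /=; last first.
        by exists (@invg G) => ? _; exact: invgK.
      by apply: eq_bigr => g _; rewrite inv_rep.
    have k := twirl_kron (tw1 _ _ U hU uU (twirl_ext tU g0)) (tw1 _ _ V hV uV (twirl_ext tV h0)) tau.
    have e gh : (kron (conjop (kron (U gh.1) (V gh.2))) (kron (W gh.1 gh.2) (Z gh.1 gh.2))) ^† ** Kt (A * B)%type tau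
       ** kron (conjop (kron (U gh.1) (V gh.2))) (kron (W gh.1 gh.2) (Z gh.1 gh.2)) =
       kron (trp ((kron (U gh.1) (V gh.2)) ^† ** tau ** kron (U gh.1) (V gh.2))) Id.
      have [_ w2] := kron_unit2 (uW gh.1 gh.2) (uZ gh.1 gh.2).
      by rewrite Kt_kron kron_adj !kronM mm1 w2 conjop_conj_trp.
    rewrite /krausA; under eq_bigr do rewrite e.
    have -> : \sum_gh kron (trp ((kron (U gh.1) (V gh.2)) ^† ** tau ** kron (U gh.1) (V gh.2))) Id
      = kron (trp (\sum_gh kron ((U gh.1) ^†) ((V gh.2) ^†) ** tau ** (kron ((U gh.1) ^†) ((V gh.2) ^†)) ^†))
          (Id : rop (A * B) (A * B)).
      apply: en_inj => p q; rewrite en_sum en_kron en_mk en_sum mulr_suml.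
      by apply: eq_bigr => gh _; rewrite en_kron en_mk !kron_adj !adjK.
    rewrite k; apply: en_inj => p q; rewrite en_kron en_mk !enZ !en1 -mulrA -natrM mulnb.
    by case: p q => [p1 p2] [q1 q2] /=; rewrite xpair_eqE (eq_sym q1).
- by move=> gh; apply: invar_J; [exact: channel_lin|exact: uUV|move=> X; exact: cov'].
- move=> gh; apply: invar_J; [exact: tensmap_lin|exact: uUV|].
  have [w1 w2] := uW gh.1 gh.2; have [u1 u2] := uU gh.1.
  apply: tensmap_covar; [exact: rep_pi_lin|exact: Bmarg_lin| |move=> X; exact: cQ].
  move=> X; rewrite rep_piE [in RHS]rep_piE mmZr mmZl mm1 w1; congr (_ *: _).
  by rewrite trC mmA u2 mm1l.
Qed.

End TeleCovariant.

End SingleLetter.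

(** * Many copies *)

Section ManyCopies.
Variable R : realType.
Local Notation C := (R[i]).
Local Notation rop := (rop R).
Local Notation "X ^⊗ n" := (tpw (fun _ : 'I_n => X)) (at level 29).

Lemma join_pair_bij (X Y : finType) n : bijective (@join_pair X Y n).
Proof. exact: Bijective (@join_pairK X Y n) (@split_pairK X Y n). Qed.

Lemma tpw_reidx n (T U : finType) (h : T -> U) (X : rop U U) :
  (reidx h X) ^⊗ n = reidx (fun c : {ffun 'I_n -> T} => [ffun k => h (c k)]) (X ^⊗ n).
Proof.
apply: en_inj => p q; rewrite en_reidx !en_tpw; apply: eq_bigr => k _.
by rewrite en_reidx !ffunE.
Qed.

Variables (A' B' A B : finType) (N : op R (A' * B') -> op R (A * B)).
Hypothesis hN : is_channel N.
Hypothesis a0' : (0 < #|A'|)%N.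
Hypothesis b0' : (0 < #|B'|)%N.
Hypothesis a0 : (0 < #|A|)%N.

Local Notation RQ Q := (tensmap (@rep_pi R A' A) Q).
Local Notation Q1 := (Bmarg N).
Local Notation Phi := (choi N).
Local Notation D := (log2 ((#|A'| * #|A|)%:R : R) - condent Phi).

Let s0 : (0 < #|{: A' * B'}|)%N. Proof. by rewrite card_prod muln_gt0 a0'. Qed.
Let hQ1 : is_channel Q1. Proof. exact: Bmarg_channel. Qed.
Let hPhi : psd Phi. Proof. exact: choi_psd. Qed.
Let tPhi : rtr Phi = 1. Proof. exact: choi_tr. Qed.
Let c0 : 0 < ((#|A'| * #|A|)%:R : R)^-1. Proof. by rewrite invr_gt0 ltr0n muln_gt0 a0'. Qed.

Lemma nchoi_RQ (Q : op R B' -> op R B) :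
  nchoi (RQ Q) = reidx (@regroup A' B' A B) ((((#|A'| * #|A|)%:R : R)^-1)%:C%C *: kron Id (nchoi Q)).
Proof.
rewrite (nchoi_tens_Id (k := (#|A|%:R)^-1)); last by rewrite J_rep_pi natrC invC.
by congr (reidx _ (_%:C%C *: _)); rewrite natrM invfM mulrC.
Qed.

Lemma dominated_N : dominated (nchoi N) (nchoi (RQ Q1)).
Proof.
rewrite nchoi_RQ nchoi_choi // -marg_choi //; apply: dominated_reidx.
exact: Phi_dominated.
Qed.

Lemma dre_N : dre (nchoi N) (nchoi (RQ Q1)) = D.
Proof.
have hs : psd ((((#|A'| * #|A|)%:R : R)^-1)%:C%C *: kron (Id : rop (A' * A) _) (marg Phi)).
  by apply: psdZ (ltW c0) _; exact: kron_psd (psd1 R _) (marg_psd hPhi).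
rewrite nchoi_RQ (nchoi_choi N) -(marg_choi hN) (dre_reidx (regroup_bij A' B' A B) hPhi hs).
rewrite (dre_marg hPhi tPhi c0) /log2 lnV; first by rewrite mulNr opprK.
by rewrite posrE ltr0n muln_gt0 a0'.
Qed.

Variable n : nat.
Local Notation Sn := ({ffun 'I_n -> A'} * {ffun 'I_n -> B'})%type.
Local Notation On := ({ffun 'I_n -> A} * {ffun 'I_n -> B})%type.
Local Notation tpN := (@tpow R A' B' A B n N).
Local Notation fS := (@join_pair A' B' n).
Local Notation fO := (@join_pair A B n).
Local Notation K := (pairup fS fO).
Local Notation RQn Q := (tensmap (@rep_pi R {ffun 'I_n -> A'} {ffun 'I_n -> A}) Q).

Lemma tpowE : tpN = powchan fS fO N.
Proof.
apply: funext => X; apply: en_inj => x y.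
rewrite /tpow en_sum en_app; apply: eq_bigr => p _; rewrite en_sum; apply: eq_bigr => q _.
rewrite enZ mkopE en_mk en_reidx en_tpw; congr (_ * _); first exact: entE.
by apply: eq_bigr => k _; rewrite entE !ffunE en_J.
Qed.

Definition Qpow : op R {ffun 'I_n -> B'} -> op R {ffun 'I_n -> B} := powchan id id Q1.

Lemma id_bij T : bijective (@id T). Proof. by exists id. Qed.

Lemma Qpow_channel : is_channel Qpow.
Proof. by apply: powchan_channel => //; exact: id_bij. Qed.

Lemma RQ_Qpow : RQn Qpow = powchan fS fO (RQ Q1).
Proof.
apply: funext; apply: J_inj; [exact: tensmap_lin|exact: app_lin|].
rewrite J_powchan; apply: en_inj => p q; rewrite en_J_tensmap J_powchan !J_rep_pi !en_reidx !en_tpw.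
transitivity (\prod_k (((#|A|%:R)^-1 * ((p.1.1 k == q.1.1 k)%:R * (p.2.1 k == q.2.1 k)%:R)
   : C) * en (J Q1) (p.1.2 k, p.2.2 k) (q.1.2 k, q.2.2 k))).
  rewrite !big_split /= !prod_eq prodr_const card_ord enZ en1 card_ffun card_ord natrX exprVn.
  congr (_ * _ * _); first by rewrite xpair_eqE -natrM mulnb.
  by apply: eq_bigr => k _; rewrite !ffunE.
apply: eq_bigr => k _; rewrite en_J_tensmap J_rep_pi enZ en1 !ffunE /=.
by rewrite xpair_eqE -natrM mulnb.
Qed.

Lemma tpow_channel : is_channel (tpN).
Proof. by rewrite tpowE; apply: powchan_channel => //; exact: join_pair_bij. Qed.

Let K_bij : bijective K. Proof. by apply: pairup_bij; exact: join_pair_bij. Qed.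

Lemma nchoi_tpow : nchoi (tpN) = reidx K (nchoi N ^⊗ n).
Proof. by rewrite tpowE nchoi_powchan //; exact: join_pair_bij. Qed.

Lemma nchoi_Qpow : nchoi (RQn Qpow) = reidx K (nchoi (RQ Q1) ^⊗ n).
Proof. by rewrite RQ_Qpow nchoi_powchan //; exact: join_pair_bij. Qed.

Lemma tpow_twirl : tele_covariant N ->
  exists (I : finType) (x : I -> rop (Sn * On) (Sn * On)),
  [/\ twirling x, invar x (J (tpN)) & invar x (J (RQn Qpow))].
Proof.
move=> hT; have [I [x [x1 x2 x3]]] := tele_twirl hN hT s0.
exists {ffun 'I_n -> I}, (xpow fS fO x); split.
- by apply: twirling_pow => //; exact: join_pair_bij.
- by rewrite tpowE J_powchan; apply: invar_pow => //; exact: join_pair_bij.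
- by rewrite RQ_Qpow J_powchan; apply: invar_pow => //; exact: join_pair_bij.
Qed.

Definition toXY (p : Sn * On) : {ffun 'I_n -> ((A' * A) * (B' * B))%type} :=
  [ffun k => regroup (K p k)].

Lemma toXY_bij : bijective toXY.
Proof.
have [r' r1 r2] := regroup_bij A' B' A B; have [K' k1 k2] := K_bij.
exists (fun c : {ffun 'I_n -> ((A' * A) * (B' * B))%type} => K' [ffun k => r' (c k)]).
  by move=> p; rewrite -[RHS]k1; congr K'; apply/ffunP => k; rewrite !ffunE r1.
by move=> c; apply/ffunP => k; rewrite ffunE k2 ffunE r2.
Qed.

Lemma nchoi_tpow_XY : nchoi (tpN) = reidx toXY (Phi ^⊗ n).
Proof. by rewrite nchoi_tpow nchoi_choi // tpw_reidx; apply: en_inj => p q; rewrite !en_reidx. Qed.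

(** Q need not be a power: for any channel on the n copies the Choi state is maximally mixed on X^n
    times some state on Y^n, which is all the universal test asks. *)
Lemma nchoi_RQn (Q : op R {ffun 'I_n -> B'} -> op R {ffun 'I_n -> B}) :
  nchoi (RQn Q) = reidx toXY ((((#|A'| * #|A|)%:R ^+ n : R)^-1)%:C%C *:
     emb (A' * A)%type (reidx (@split_pair B' B n) (nchoi Q))).
Proof.
rewrite (nchoi_tens_Id (k := (#|{ffun 'I_n -> A}|%:R)^-1)); last by rewrite J_rep_pi natrC invC.
apply: en_inj => p q; rewrite !en_reidx !enZ !en_reidx !en_kron en_reidx !en1; congr (_%:C%C * (_ * _)).
- by rewrite !card_ffun !card_ord !natrX -invfM -exprMn -natrM mulnC.
- congr (nat_of_bool _)%:R; rewrite -(can_eq (@join_pairK A' A n)); congr (_ == _).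
    by apply/ffunP => k; rewrite !ffunE.
  by apply/ffunP => k; rewrite !ffunE.
- have h (z : Sn * On) : split_pair (split_pair (toXY z)).2 = (regroup z).2.
    by rewrite -[RHS]join_pairK; congr split_pair; apply/ffunP => k; rewrite !ffunE.
  by rewrite !h.
Qed.

End ManyCopies.

(** * Rates at fixed error *)

Section Asymptotic.
Variable R : realType.
Local Notation C := (R[i]).
Local Notation rop := (rop R).
Local Notation "X ^⊗ n" := (tpw (fun _ : 'I_n => X)) (at level 29).

Lemma log2M (x y : R) : 0 < x -> 0 < y -> log2 (x * y) = log2 x + log2 y.
Proof. by move=> x0 y0; rewrite /log2 lnM ?posrE // mulrDl. Qed.

Lemma log2V (x : R) : 0 < x -> log2 (x^-1) = - log2 x.
Proof. by move=> x0; rewrite /log2 lnV ?posrE // mulNr. Qed.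

Lemma pow2Mn n (x : R) : pow2 (n%:R * x) = pow2 x ^+ n.
Proof.
elim: n => [|n IH]; first by rewrite mul0r pow20 expr0.
by rewrite -natr1 mulrDl mul1r pow2D IH exprSr.
Qed.

Lemma floor_ex (x : R) : 0 <= x -> exists k : nat, k%:R <= x < k.+1%:R.
Proof. by move=> x0; exists (Num.truncn x); exact: truncn_itv. Qed.

(** m is the integer part of x, or 1 when that is 0. Rounding costs at most a factor 2, a constant
    in the logarithm. *)
Lemma dist_size (x : R) : 0 < x ->
  exists m : nat, [/\ (0 < m)%N, x / 2 <= m%:R & m%:R <= (1 : R) \/ m%:R <= x].
Proof.
move=> x0; have [k /andP [k1 k2]] := floor_ex (ltW x0); have [k0|kn] := posnP k.
  exists 1%N; split => //; last by left.
  by move: k2; rewrite k0 => k2; lra.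
exists k; split => //; last by right.
have : (1 : R) <= k%:R by rewrite ler1n.
by move: k2; rewrite -natr1; lra.
Qed.

Variables (A' B' A B : finType) (N : op R (A' * B') -> op R (A * B)).
Hypothesis hN : is_channel N.
Hypothesis a0' : (0 < #|A'|)%N.
Hypothesis b0' : (0 < #|B'|)%N.
Hypothesis a0 : (0 < #|A|)%N.

Local Notation Phi := (choi N).
Local Notation D := (log2 ((#|A'| * #|A|)%:R : R) - condent Phi).
Local Notation tpN n := (@tpow R A' B' A B n N).
Local Notation piN n := (@rep_pi R {ffun 'I_n -> A'} {ffun 'I_n -> A}).
Local Notation Q1 := (Bmarg N).
Local Notation RQn n Q := (tensmap (@rep_pi R {ffun 'I_n -> A'} {ffun 'I_n -> A}) Q).

Let s0 : (0 < #|{: A' * B'}|)%N. Proof. by rewrite card_prod muln_gt0 a0'. Qed.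

Let ffun_gt0 (T : finType) n : (0 < #|T|)%N -> (0 < #|{ffun 'I_n -> T}|)%N.
Proof. by move=> h; rewrite card_ffun card_ord expn_gt0 h. Qed.

Let sn0 n : (0 < #|{: {ffun 'I_n -> A'} * {ffun 'I_n -> B'}}|)%N.
Proof. by rewrite card_prod muln_gt0 !ffun_gt0. Qed.

Lemma smooth_tpow (delta eta : R) : 0 < delta -> 0 < eta ->
  exists n0, forall n, (n0 <= n)%N -> exists F,
  [/\ psd F, lel F ((pow2 (n%:R * (D + delta)))%:C%C *: nchoi (RQn n (Qpow N (n:=n))))
    & forall T, test T -> `|rtr (T ** nchoi (tpN n)) - rtr (T ** F)| <= eta].
Proof.
move=> d0 e0.
have hRQ : is_channel (tensmap (@rep_pi R A' A) Q1).
  by apply: tensmap_channel (rep_pi_channel _ _ a0) (Bmarg_channel hN a0' b0').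
have [n0 h] := smoothing (nchoi_psd hN) (rtr1 (nchoi_tr s0 hN)) (nchoi_psd hRQ)
  (dominated_N hN a0' b0' a0) d0 e0.
exists n0 => n /h [F [hF1 hF2 hF3]].
have kb := pairup_bij (@join_pair_bij A' B' n) (@join_pair_bij A B n).
have [K' k1 k2] := kb.
exists (reidx (pairup (@join_pair A' B' n) (@join_pair A B n)) F); split.
- exact: reidx_psd hF1.
- rewrite nchoi_Qpow -reidxZ; apply: lel_reidx; rewrite -(dre_N hN a0' b0' a0); exact: hF2.
- move=> T hT; rewrite nchoi_tpow -(reidxK T k1) -!(reidxM kb) !(rtr_reidx kb).
  apply: hF3; apply: test_reidx hT; exact: Bijective k2 k1.
Qed.

Lemma universal_test_tpow (delta eta : R) : 0 < delta -> 0 < eta ->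
  exists n0, forall n, (n0 <= n)%N -> exists T,
  [/\ test T, 1 - eta <= rtr (T ** nchoi (tpN n))
    & forall Q, is_channel Q -> rtr (T ** nchoi (RQn n Q)) <= pow2 (- (n%:R * (D - delta)))].
Proof.
move=> d0 e0.
have [n0 h] := universal_test (choi_psd hN) (choi_tr hN s0) d0 e0.
exists n0 => n /h [T [hT1 hT2 hT3]].
have tb := @toXY_bij A' B' A B n.
exists (reidx (@toXY A' B' A B n) T); split.
- exact: test_reidx.
- by rewrite nchoi_tpow_XY -(reidxM tb) (rtr_reidx tb).
- move=> Q hQ; rewrite nchoi_RQn -(reidxM tb) (rtr_reidx tb) mmZr rtrZ.
  set w := reidx _ (nchoi Q).
  have hw : psd w by apply: reidx_psd; exact: nchoi_psd.
  have tw : rtr w = 1.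
    rewrite /w (rtr_reidx (@split_pair_bij B' B n)); apply: rtr1; apply: nchoi_tr hQ.
    exact: ffun_gt0.
  have := hT3 w hw; rewrite tw mulr1 => hh.
  have c0 : (0 < (#|A'| * #|A|)%:R :> R) by rewrite ltr0n muln_gt0 a0'.
  have -> : pow2 (- (n%:R * (D - delta))) = ((#|A'| * #|A|)%:R ^+ n)^-1 * pow2 (n%:R * (condent Phi + delta)).
    have -> : (#|A'| * #|A|)%:R ^+ n = pow2 (n%:R * log2 ((#|A'| * #|A|)%:R : R)).
      by rewrite pow2Mn pow2_log2.
    by rewrite -pow2N -pow2D; congr pow2; ring.
  by apply: ler_wpM2l hh; rewrite invr_ge0 exprn_ge0 // ltW.
Qed.

Section FixedError.
Variable eps : R.
Hypothesis e0 : 0 < eps.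
Hypothesis e1 : eps < 1.

Let e2 : 0 < eps ^+ 2 < 1.
Proof. by rewrite exprn_gt0 //= exprn_ilt1 ?ltW. Qed.

Lemma dist_tpow_upper (delta : R) : tele_covariant N -> 0 < delta ->
  exists c n0, forall n, (n0 <= n)%N ->
  (dist1 eps (tpN n) (piN n) <= (n%:R * (D / 2 + delta) + c)%:E)%E.
Proof.
move=> hT d0; have /andP [e20 e21] := e2.
(* Smoothing may use up half of the acceptance 1 - eps^2; the other half stays positive for every
   eps < 1 and only affects the constant c. *)
pose eta := (1 - eps ^+ 2) / 2; have eta0 : 0 < eta by rewrite divr_gt0 // subr_gt0.
(* The one-shot bounds halve the logarithm, so a slack of 2 delta in the exponent is delta in the
   rate. *)
have d2 : 0 < delta *+ 2 by rewrite mulrn_wgt0.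
have [n0 h] := smooth_tpow d2 eta0.
exists (- log2 eta / 2), n0 => n /h [F [hF1 hF2 hF3]].
have [I [x [x1 x2 x3]]] := tpow_twirl hN a0' b0' n hT.
pose beta := pow2 (- (n%:R * (D + delta *+ 2))) * eta.
have b0 : 0 < beta by rewrite mulr_gt0 ?pow2_gt0.
have hb T : test T -> 1 - eps ^+ 2 <= rtr (T ** nchoi (tpN n)) ->
    beta <= rtr (T ** nchoi (RQn n (Qpow N (n:=n)))).
  move=> tT h1; have := hF3 T tT; rewrite ler_norml => /andP [_ h2].
  have := lel_rtr tT.1 hF2; rewrite mmZr rtrZ => h3.
  rewrite /beta pow2N -ler_pdivlMl ?invr_gt0 ?pow2_gt0 // invrK.
  apply: le_trans h3; move: h1 h2; rewrite /eta.
  by move: (rtr _) (rtr _) (eps ^+ 2) => a b c; lra.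
have := dist_upper (tpow_channel hN n) (ffun_gt0 n a0) (sn0 n) (Qpow_channel hN a0' b0' n)
  x1 x2 x3 (ltW e0) b0 hb.
congr (_ <= _)%E; congr _%:E.
rewrite log2V // /beta log2M ?pow2_gt0 // log2_pow2 mulr2n.
by move: D (log2 _) => a b; field.
Qed.

Lemma dist_tpow_lower (delta : R) : 0 < delta ->
  exists c n0, forall n, (n0 <= n)%N ->
  ((n%:R * (D / 2 - delta) - c)%:E <= dist1 eps (tpN n) (piN n))%E.
Proof.
move=> d0; have /andP [e20 e21] := e2.
pose eta := eps ^+ 2 / 2; have eta0 : 0 < eta by rewrite divr_gt0.
have d2 : 0 < delta *+ 2 by rewrite mulrn_wgt0.
have [n0 h] := universal_test_tpow d2 eta0.
exists (log2 2), n0 => n /h [T [hT1 hT2 hT3]].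
pose x := pow2 (n%:R * (D / 2 - delta)).
have x0 : 0 < x by exact: pow2_gt0.
have [m [m0 m1 m2]] := dist_size x0.
have mp : (0 : R) < m%:R by rewrite ltr0n.
have xx : x ^+ 2 = (pow2 (- (n%:R * (D - delta *+ 2))))^-1.
  rewrite -pow2N -pow2Mn; congr pow2; rewrite mulr2n.
  by move: D => a; field.
(* If rounding gave m = 1, every test meets the bound 1. *)
have hQ Q : is_channel Q -> rtr (T ** nchoi (RQn n Q)) <= (m%:R ^+ 2)^-1.
  move=> cQ; case: m2 => m2.
    have -> : m = 1%N by apply/eqP; rewrite eqn_leq m0 andbT -(ler_nat R).
    have cR : is_channel (RQn n Q) by apply: tensmap_channel cQ; exact: rep_pi_channel (ffun_gt0 n a0).
    rewrite expr1n invr1 -(rtr1 (nchoi_tr (sn0 n) cR)).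
    exact: test_le1 hT1 (nchoi_psd cR).
  apply: le_trans (hT3 Q cQ) _.
  rewrite -[X in X <= _]invrK -xx lef_pV2 ?posrE ?exprn_gt0 //.
  by rewrite ler_pXn2r // nnegrE ltW.
have eta1 : eta <= 1 by rewrite /eta; lra.
have he : 2 * eta <= eps ^+ 2 by rewrite /eta; lra.
apply: le_trans (dist_lower (tpow_channel hN n) (ffun_gt0 n a0) (sn0 n) hT1 m0 hT2 hQ
  (ltW e0) eta1 he).
rewrite lee_fin; apply: le_trans (ler_log2 _ m1); last by rewrite divr_gt0.
by rewrite log2M ?invr_gt0 // log2V // log2_pow2.
Qed.

Lemma cost_tpow_lower (delta : R) : 0 < delta ->
  exists c n0, forall n, (n0 <= n)%N ->
  ((n%:R * (D / 2 - delta) - c)%:E <= cost1 eps (tpN n) (piN n))%E.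
Proof.
move=> d0; have /andP [e20 e21] := e2.
(* sqrt eta is half of sqrt (1 - eps^2), which keeps [k] positive. *)
pose eta := (1 - eps ^+ 2) / 4; have eta0 : 0 < eta by rewrite divr_gt0 // subr_gt0.
have d2 : 0 < delta *+ 2 by rewrite mulrn_wgt0.
have [n0 h] := universal_test_tpow d2 eta0.
pose k := Num.sqrt (1 - eps ^+ 2) - Num.sqrt eta.
have k0 : 0 < k.
  rewrite subr_gt0 ltr_sqrt ?subr_gt0 // /eta; move: (eps ^+ 2) e21 => z hz; lra.
exists (- log2 (k ^+ 2) / 2), n0 => n /h [T [hT1 hT2 hT3]].
have := cost_lower (tpow_channel hN n) (sn0 n) hT1 hT2 (pow2_gt0 _) hT3 (ltW e0) k0.
congr (_ <= _)%E; congr _%:E; rewrite -/k.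
rewrite log2M ?exprn_gt0 ?invr_gt0 ?pow2_gt0 // log2V ?pow2_gt0 // log2_pow2 mulr2n.
by move: D (log2 _) => a b; field.
Qed.

Lemma cost_tpow_upper (delta : R) : tele_covariant N -> 0 < delta ->
  exists c n0, forall n, (n0 <= n)%N ->
  (cost1 eps (tpN n) (piN n) <= (n%:R * (D / 2 + delta) + c)%:E)%E.
Proof.
move=> hT d0; have /andP [e20 e21] := e2.
pose eta := eps ^+ 2 / 4; have eta0 : 0 < eta by rewrite divr_gt0.
have d2 : 0 < delta *+ 2 by rewrite mulrn_wgt0.
have [n0 h] := smooth_tpow d2 eta0.
exists (log2 8), n0 => n /h [F [hF1 hF2 hF3]].
have [I [x [x1 x2 x3]]] := tpow_twirl hN a0' b0' n hT.
pose y := pow2 (n%:R * (D / 2 + delta)).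
have y0 : 0 < y by exact: pow2_gt0.
have yy : pow2 (n%:R * (D + delta *+ 2)) = y ^+ 2.
  rewrite -pow2Mn; congr pow2; rewrite mulr2n.
  by move: D => a; field.
have eta2 : eta <= 2^-1 by rewrite /eta; lra.
have he : 4 * eta <= eps ^+ 2 by rewrite /eta; lra.
have cR : is_channel (RQn n (Qpow N (n:=n))).
  by apply: tensmap_channel (Qpow_channel hN a0' b0' n); exact: rep_pi_channel (ffun_gt0 n a0).
(* Traces in F <= y^2 (R (x) Q) give y^2 >= tr F >= 1 - eta; this covers the case of a negative
   exponent. *)
have yh : 2^-1 <= y.
  have := hF3 _ (test1 R _); rewrite !mm1l (rtr1 (nchoi_tr (sn0 n) (tpow_channel hN n))).
  have := lel_rtr (psd1 R _) hF2; rewrite !mm1l rtrZ (rtr1 (nchoi_tr (sn0 n) cR)) mulr1 yy.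
  rewrite ler_norml => h1 /andP [_ h2].
  have {h1 h2} : 2^-1 ^+ 2 <= y ^+ 2.
    by move: h1 h2 eta2; move: (rtr F) (y ^+ 2) => a b; lra.
  by rewrite ler_pXn2r // nnegrE ?invr_ge0 // ltW.
(* m is the integer part of 2 y plus 2: above 1, above 2 y, and below 8 y because y >= 1/2. *)
have [k /andP [k1 k2]] := floor_ex (ltW (mulr_gt0 (ltr0Sn R 1) y0)).
have m1 : (1 < k.+2)%N by [].
have hm : 2 * pow2 (n%:R * (D + delta *+ 2)) <= k.+2%:R ^+ 2.
  rewrite yy; apply: (@le_trans _ _ ((2 * y) ^+ 2)).
    by rewrite exprMn ler_wpM2r ?sqr_ge0 //; lra.
  rewrite ler_pXn2r ?nnegrE ?ler0n ?mulr_ge0 ?(ltW y0) //.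
  by apply: ltW; apply: lt_trans k2 _; rewrite ltr_nat.
apply: le_trans (cost_upper (tpow_channel hN n) (ffun_gt0 n a0) (sn0 n)
  (Qpow_channel hN a0' b0' n) x1 x2 x3 hF1 hF2 (ltW (pow2_gt0 _)) hF3 eta2 (ltW e0) he m1 hm) _.
rewrite lee_fin; apply: (@le_trans _ _ (log2 (y * 8))).
  apply: ler_log2; first by rewrite ltr0n.
  by rewrite -!natr1; move: yh k1; move: (k%:R) => z; lra.
by rewrite log2M // log2_pow2.
Qed.

End FixedError.

End Asymptotic.

(** * Conditional entropy of a channel *)

Section ChannelEntropy.
Variable R : realType.
Local Notation C := (R[i]).
Local Notation rop := (rop R).
Local Notation "X ^⊗ n" := (tpw (fun _ : 'I_n => X)) (at level 29).

Lemma tpw_kronId n (X Y : finType) (Z : rop Y Y) :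
  (kron (Id : rop X X) Z) ^⊗ n = emb X (Z ^⊗ n).
Proof.
apply: en_inj => p q; rewrite en_reidx en_kron !en_tpw en1 -prod_eq -big_split.
by apply: eq_bigr => k _; rewrite en_kron en1 /= !ffunE.
Qed.

Let half_le (r u w : R) : 1 - 4^-1 <= r -> r - 4^-1 <= u -> u <= w -> 2^-1 <= w.
Proof. lra. Qed.

(* -log c - S(X|Y) is the smallest relative entropy to c 1 (x) Z, Z a state on Y. *)
Lemma dre_marg_min (X Y : finType) (Phi : rop (X * Y) (X * Y)) (Z : rop Y Y) (c : R) :
  psd Phi -> rtr Phi = 1 -> psd Z -> rtr Z = 1 -> 0 < c ->
  dominated Phi (c%:C%C *: kron Id Z) -> - log2 c - condent Phi <= dre Phi (c%:C%C *: kron Id Z).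
Proof.
move=> hP tP hZ tZ c0 hd; set d := dre _ _; apply/ler_addgt0Pl => e e0.
have e2 : 0 < e / 2 by rewrite divr_gt0.
have q0 : (0 : R) < 4^-1 by rewrite invr_gt0.
have hs : psd (c%:C%C *: kron (Id : rop X X) Z) := psdZ (ltW c0) (kron_psd (psd1 R X) hZ).
have [n1 h1] := universal_test hP tP e2 q0.
have [n2 h2] := strong_converse hP tP hs hd e2 q0.
pose x := d + log2 c + condent Phi + e.
(* The universal test accepts Phi^n with probability 3/4 and is subject to the strong converse
   against c 1 (x) Z; the two exponents add up to n x. Since this holds for all large n, x cannot be
   negative. *)
have key n : (n1 <= n)%N -> (n2 <= n)%N -> 2^-1 <= pow2 (n%:R * x).
  move=> hn1 hn2; have [A [hA hA1 hA2]] := h1 n hn1.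
  have b1 := hA2 _ (psd_tpw n hZ).
  rewrite [X in _ <= _ * X](rtr_tpw1 n hZ tZ) mulr1 in b1.
  have := h2 n hn2 A hA.
  have -> : (c%:C%C *: kron (Id : rop X X) Z) ^⊗ n = (c ^+ n)%:C%C *: emb X (Z ^⊗ n).
    by rewrite (tpwZ (fun=> c%:C%C) (fun=> kron Id Z)) prodr_const card_ord tpw_kronId -rmorphXn.
  rewrite (mmZr (c ^+ n)%:C%C A).
  rewrite rtrZ.
  move=> b2.
  have pd := pow2_gt0 (n%:R * (d + e / 2)).
  have -> : pow2 (n%:R * x) = pow2 (n%:R * (d + e / 2)) * (c ^+ n * pow2 (n%:R * (condent Phi + e / 2))).
    by rewrite -{1}(pow2_log2 c0) -pow2Mn -!pow2D; congr pow2; rewrite /x; field.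
  have cn : 0 < c ^+ n by rewrite exprn_gt0.
  have := ler_wpM2l (ltW pd) (ler_wpM2l (ltW cn) b1).
  exact: half_le hA1 b2.
suff : 0 <= x by rewrite /x; clearbody d; move: (log2 c) (condent Phi) => u v; lra.
clearbody x.
rewrite leNgt; apply/negP => x0.
have [k /andP [_ hk]] := floor_ex (ltW (divr_gt0 (ltr0Sn R 0) (etrans (oppr_gt0 x) x0))).
pose n := maxn (maxn n1 n2) k.+1.
have := key n; rewrite !leq_max !leqnn /= orbT => /(_ isT isT).
have -> : 2^-1 = pow2 (-1) :> R by rewrite pow2N /pow2 mul1r lnK // posrE.
rewrite ler_pow2 => h.
have kn : (k.+1%:R <= n%:R :> R) by rewrite ler_nat leq_maxr.
move: hk; rewrite ltr_pdivrMr ?oppr_gt0 // => hk.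
have : k.+1%:R * - x <= n%:R * - x by rewrite ler_wpM2r // oppr_ge0 ltW.
move: h hk; rewrite !mulrN.
by move: (n%:R * x) (k.+1%:R * x) => u v; lra.
Qed.

(** The Kraus operators of linking with Y^2. For an input state rho = Y^2 they produce the output of
    a channel from its Choi matrix, but they add up to [Kt] of the marginal of rho rather than to
    the identity. *)
Definition lkraus (K S O : finType) (Y : rop (K * S) (K * S)) (w : K * S)
  : rop (K * O) (S * O) :=
  mk (fun p q => en Y (p.1, q.1) w * (p.2 == q.2)%:R).

Lemma en_lkrausM (K S O U : finType) (Y : rop (K * S) (K * S))
    (X : rop (S * O) U) w p y :
  en (lkraus O Y w ** X) p y = \sum_s en Y (p.1, s) w * en X (s, p.2) y.
Proof.
rewrite enM sum_pair; apply: eq_bigr => s _.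
rewrite -[RHS](sum_pick_sym (fun o => en Y (p.1, s) w * en X (s, o) y) p.2).
by apply: eq_bigr => o _; rewrite en_mk /=; ring.
Qed.

Lemma link_kraus (K S O : finType) (Y : rop (K * S) (K * S)) X : Y ^† = Y ->
  kraus (@lkraus K S O Y) X = link (Y ** Y) X.
Proof.
move=> hY; apply: en_inj => p q; rewrite en_link en_sum.
transitivity (\sum_w \sum_t \sum_s en Y (p.1, s) w * en Y w (q.1, t) * en X (s, p.2) (t, q.2)).
  apply: eq_bigr => w _; rewrite enM sum_pair; apply: eq_bigr => t _.
  rewrite -[RHS](sum_pick_sym (fun o => \sum_s en Y (p.1, s) w * en Y w (q.1, t)
    * en X (s, p.2) (t, o)) q.2); apply: eq_bigr => o _.
  rewrite en_lkrausM enA en_mk /= conjM conjC_nat -enA hY mulr_suml mulr_suml.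
  by apply: eq_bigr => s _; ring.
rewrite exchange_big [RHS]exchange_big; apply: eq_bigr => t _ /=.
rewrite exchange_big; apply: eq_bigr => s _ /=.
by rewrite enM mulr_suml.
Qed.

Lemma lkraus_complete (K S O : finType) (Y : rop (K * S) (K * S)) : Y ^† = Y ->
  \sum_w (@lkraus K S O Y w) ^† ** lkraus O Y w = Kt O (marg (Y ** Y)).
Proof.
move=> hY; apply: en_inj => p q; rewrite en_sum en_mk en_mk mulr_suml.
transitivity (\sum_w \sum_k en Y (k, q.1) w * en Y w (k, p.1) * (q.2 == p.2)%:R).
  apply: eq_bigr => w _; rewrite enM sum_pair; apply: eq_bigr => k _.
  rewrite -[RHS](sum_pick (fun o => en Y (k, q.1) w * en Y w (k, p.1) * (q.2 == o)%:R) p.2).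
  apply: eq_bigr => o _; rewrite enA !en_mk /= conjM conjC_nat -enA hY.
  by rewrite (eq_sym q.2); ring.
rewrite exchange_big; apply: eq_bigr => k _ /=.
by rewrite enM mulr_suml.
Qed.

End ChannelEntropy.

Section ChannelConditionalEntropy.
Variable R : realType.
Local Notation C := (R[i]).
Local Notation rop := (rop R).

Lemma sum_pairV (V : zmodType) (T U : finType) (F : T * U -> V) :
  \sum_p F p = \sum_i \sum_j F (i, j).
Proof. by rewrite pair_bigA; apply: eq_bigr; case. Qed.

Variables (A' B' A B : finType) (N : op R (A' * B') -> op R (A * B)).
Hypothesis hN : is_channel N.
Hypothesis a0' : (0 < #|A'|)%N.
Hypothesis b0' : (0 < #|B'|)%N.
Hypothesis a0 : (0 < #|A|)%N.

Local Notation Phi := (choi N).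
Local Notation D1 := (log2 (#|A'|%:R : R) - condent Phi).
Local Notation Q1 := (Bmarg N).
Local Notation R1 Q := (tensmap (@rep_one R A' A) Q).

Let s0 : (0 < #|{: A' * B'}|)%N. Proof. by rewrite card_prod muln_gt0 a0'. Qed.
Let an0 : (0 < #|A'|%:R :> R). Proof. by rewrite ltr0n. Qed.
Let c0 : 0 < ((#|A'|%:R : R))^-1. Proof. by rewrite invr_gt0. Qed.
Let hPhi : psd Phi. Proof. exact: choi_psd. Qed.
Let tPhi : rtr Phi = 1. Proof. exact: choi_tr. Qed.

Lemma condent_stE : condent_st Phi = condent Phi.
Proof.
have vE T (X : op R T) : vN X = - rtr (X ** logm X) by rewrite /vN trE mmE.
have -> : condent_st Phi = vN Phi - vN (marg Phi).
  by congr (_ - vN _); rewrite /ptr1 mkopE; apply: en_inj => s t; rewrite !en_mk;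
     apply: eq_bigr => k _; rewrite entE.
by rewrite !vE /condent opprK addrC.
Qed.

Lemma J_rep_one : J (@rep_one R A' A) = (1 : R)%:C%C *: Id.
Proof.
apply: en_inj => -[s o] [t o']; rewrite en_J /rep_one trE idtE ctr_munit !enZ !en1 /=.
by rewrite xpair_eqE -mulnb natrM mul1r.
Qed.

Lemma nchoi_R1 (Q : op R B' -> op R B) :
  nchoi (R1 Q) = reidx (@regroup A' B' A B) (((#|A'|%:R : R)^-1)%:C%C *: kron Id (nchoi Q)).
Proof. by rewrite (nchoi_tens_Id Q J_rep_one) div1r. Qed.

Lemma R1_scale (Q : op R B' -> op R B) : J (R1 Q) = #|A|%:R *: J (tensmap (@rep_pi R A' A) Q).
Proof.
apply: en_inj => p q; rewrite enZ !en_J_tensmap J_rep_one J_rep_pi !enZ mul1r !mulrA mulfV.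
  by rewrite mul1r.
by rewrite pnatr_eq0 -lt0n.
Qed.

(** The maximally entangled input, its reference numbered, is one candidate in the supremum and
    outputs the Choi states, to which [dre_marg_min] applies; an infinite relative entropy leaves
    nothing to prove. *)
Lemma chrelent_ge (Q : op R B' -> op R B) : is_channel Q -> (D1%:E <= chrelent N (R1 Q))%E.
Proof.
move=> hQ; pose r := #|{: A' * B'}|.
pose h T (p : 'I_r * T) := (enum_val p.1, p.2) : (A' * B') * T.
have hb T : bijective (h T).
  exists (fun p => (enum_rank p.1, p.2)) => -[a b]; rewrite /h /= ?enum_valK ?enum_rankK //.
pose rho : op R ('I_r * (A' * B')) := reidx (h _) (mes R {: A' * B'}).
have out (M : op R (A' * B') -> op R (A * B)) :
    tensmap (@idfun (op R 'I_r)) M rho = reidx (h _) (nchoi M).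
  rewrite -tensmap_mes !tensmap_link; apply: en_inj => p q; rewrite en_reidx !en_link.
  by apply: eq_bigr => s _; apply: eq_bigr => t _; rewrite en_reidx.
have hrho : state rho.
  apply/stateE; split; first exact: reidx_psd (mes_psd R _).
  by rewrite (ctr_reidx (hb _)); exact: ctr_mes.
apply: (@le_trans _ _ (relent (tensmap (@idfun (op R 'I_r)) N rho)
                              (tensmap (@idfun (op R 'I_r)) (R1 Q) rho))); last first.
  by apply: ereal_sup_ubound; exists r, rho; split.
rewrite !out nchoi_R1 nchoi_choi.
set sig := _ *: kron Id (nchoi Q).
have hsig : psd sig := psdZ (ltW c0) (kron_psd (psd1 R _) (nchoi_psd hQ)).
pose G (p : 'I_r * (A * B)) := regroup (h _ p).
have Gb : bijective G := bij_comp (regroup_bij A' B' A B) (hb _).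
have GE X : reidx (h (A * B)%type) (reidx (@regroup A' B' A B) X) = reidx G X.
  by apply: en_inj => p q; rewrite !en_reidx.
rewrite !GE.
have [->|fin] := eqVneq (relent (reidx G Phi) (reidx G sig)) +oo%E; first exact: leey.
have hd := relent_fin (reidx_psd G hPhi) (reidx_psd G hsig) fin.
rewrite (relentE (reidx_psd G hPhi) hd) (dre_reidx Gb hPhi hsig) lee_fin.
have [G' _ g2] := Gb.
have hd' : dominated Phi sig by have := dominated_reidx G' hd; rewrite !(reidxK _ g2).
have := dre_marg_min hPhi tPhi (nchoi_psd hQ) (rtr1 (nchoi_tr b0' hQ)) c0 hd'.
by rewrite log2V // opprK.
Qed.

(* The output on any input is a Kraus image of the Choi state: twirling makes
   the Kraus operators of gate teleportation complete. *)
Lemma chrelent_le : tele_covariant N -> (chrelent N (R1 Q1) <= D1%:E)%E.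
Proof.
move=> hT; have hQ1 : is_channel Q1 by exact: Bmarg_channel.
have [I [x [[i0 xu xt] xN xQ]]] := tele_twirl hN hT s0.
apply: ge_ereal_sup => _ [r [rho [r0 /stateE [hr tr] ->]]].
rewrite !tensmap_link.
have [Y [hY rhoE]] := psd_ex hr.
have dn0 : (0 : R) < #|{: A' * B'}|%:R by rewrite ltr0n.
have in0 : (0 : R) < #|I|%:R by rewrite ltr0n.
(* In k^2 the numerator undoes the normalisation of the Choi state and the denominator averages over
   the twirl. *)
pose k : R := Num.sqrt (#|{: A' * B'}|%:R / #|I|%:R).
have kk : k * k = #|{: A' * B'}|%:R / #|I|%:R.
  by rewrite -expr2 sqr_sqrtr // ltW // divr_gt0.
pose L (wg : ('I_r * (A' * B')) * I) := k%:C%C *: (lkraus {: A * B} Y wg.1 ** x wg.2).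
have LE (M : op R (A' * B') -> op R (A * B)) : invar x (J M) -> kraus L (nchoi M) = link rho (J M).
  move=> hX; rewrite rhoE -(link_kraus _ hY) /kraus sum_pairV; apply: eq_bigr => w _.
  transitivity (\sum_(i : I) ((#|I|%:R : R)^-1)%:C%C *: (lkraus {: A * B} Y w ** J M ** (lkraus {: A * B} Y w) ^†)).
    apply: eq_bigr => i _; rewrite /L /= adjZ conjc_complex conjc_real mmZl mmZl mmZr scalerA -rmorphM kk.
    rewrite nchoiE mmZr mmZl scalerA -rmorphM adjM !mmA -(mmA _ (x i)) -(mmA _ (x i ** _)) hX.
    by congr (_%:C%C *: _); field; rewrite ?gt_eqF.
  by rewrite sumr_const scalerMnl -mulr_natl natrC -rmorphM mulfV ?scale1r ?gt_eqF.
have Lc : \sum_wg (L wg) ^† ** L wg = Id.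
  rewrite sum_pairV exchange_big /=.
  transitivity ((#|{: A' * B'}|%:R / #|I|%:R : R)%:C%C *: krausA x (Kt {: A * B} (marg rho))).
    rewrite rhoE -(lkraus_complete _ hY) /krausA scaler_sumr; apply: eq_bigr => i _.
    rewrite mm_sumr mm_suml scaler_sumr; apply: eq_bigr => w _.
    by rewrite /L /= adjZ conjc_complex conjc_real mmZl mmZr scalerA -rmorphM kk adjM !mmA.
  rewrite xt ctr_marg tr scalerA !natrC invC -!rmorphM mulr1.
  suff -> : (#|{: A' * B'}|%:R / #|I|%:R) * (#|I|%:R / #|{: A' * B'}|%:R) = 1 :> R by rewrite scale1r.
  by field; rewrite !gt_eqF.
have iQ : invar x (J (R1 Q1)) by rewrite R1_scale; exact: invarZ.
rewrite -(LE N xN) -(LE _ iQ) nchoi_R1 -(marg_choi hN) nchoi_choi.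
set sig := _ *: kron Id (marg Phi).
have hsig : psd sig := psdZ (ltW c0) (kron_psd (psd1 R _) (marg_psd hPhi)).
have hd : dominated Phi sig := Phi_dominated hPhi tPhi c0.
have hd2 := dominated_reidx (@regroup A' B' A B) hd.
have p1 := reidx_psd (@regroup A' B' A B) hPhi; have p2 := reidx_psd (@regroup A' B' A B) hsig.
rewrite (relentE (psd_kraus L p1) (dominated_kraus L hd2)) lee_fin.
apply: le_trans (dre_kraus Lc p1 _ p2 hd2) _; first by rewrite (rtr_reidx (regroup_bij A' B' A B)).
rewrite (dre_reidx (regroup_bij A' B' A B) hPhi hsig) (dre_marg hPhi tPhi c0) log2V //.
by rewrite opprK.
Qed.

Lemma condent_chE : tele_covariant N -> condent_ch N = (- D1%:E)%E.
Proof.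
move=> hT; congr (- _)%E; apply/eqP; rewrite eq_le; apply/andP; split.
  apply: le_trans (chrelent_le hT); apply: ereal_inf_lbound.
  by exists Q1; split => //; exact: Bmarg_channel.
apply: le_ereal_inf_tmp => _ [Q [hQ ->]]; exact: chrelent_ge.
Qed.

End ChannelConditionalEntropy.

(** * From linear bounds to the iterated limit *)

Section Limit.
Variable R : realType.

(** Infima and suprema may be infinite, but the two bounds make f n finite for large n; half of the
    tolerance goes to delta, the other half absorbs c / n. *)
Lemma cvg_rate (f : nat -> \bar R) (v : R) :
  (forall delta, 0 < delta -> exists c n0, forall n, (n0 <= n)%N ->
     (f n <= (n%:R * (v + delta) + c)%:E)%E) ->
  (forall delta, 0 < delta -> exists c n0, forall n, (n0 <= n)%N ->
     ((n%:R * (v - delta) - c)%:E <= f n)%E) ->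
  ((((n%:R : R)^-1)%:E * f n)%E @[n --> \oo] --> v%:E)%classic.
Proof.
move=> hu hl; have fin : exists n0, forall n, (n0 <= n)%N -> f n \is a fin_num.
  have [c1 [n1 h1]] := hu 1 ltr01; have [c2 [n2 h2]] := hl 1 ltr01.
  exists (maxn n1 n2) => n; rewrite geq_max => /andP [/h1 k1 /h2 k2].
  rewrite fin_numE; apply/andP; split.
    by apply: contraTneq k2 => ->; rewrite leeNy_eq.
  by apply: contraTneq k1 => ->; rewrite leye_eq.
have [n0 h0] := fin.
apply/fine_cvgP; split.
  by exists n0 => // n /= hn; rewrite fin_numM // h0.
apply/cvgrPdist_le => e e0.
have e2 : 0 < e / 2 by rewrite divr_gt0.
have [c1 [n1 h1]] := hu _ e2; have [c2 [n2 h2]] := hl _ e2.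
have [k /andP [_ hk]] := floor_ex (divr_ge0 (addr_ge0 (normr_ge0 c1) (normr_ge0 c2)) (ltW e2)).
exists (maxn (maxn n0 k.+1) (maxn n1 n2)) => // n /=; rewrite !geq_max.
move=> /andP [/andP [m0 mk] /andP [m1 m2]].
have := h1 n m1; have := h2 n m2; have {m0} := h0 n m0.
case: (f n) => [r| |] //= _; rewrite !lee_fin => l2 l1.
have np : 0 < (n%:R : R) by rewrite ltr0n; apply: leq_trans mk.
have nk : (k.+1%:R : R) <= n%:R by rewrite ler_nat.
rewrite ltr_pdivrMr // in hk.
have hc : `|c1| + `|c2| <= n%:R * (e / 2).
  by apply: le_trans (ltW hk) _; rewrite ler_wpM2r // ltW.
have a1 := ler_norm c1; have a2 := ler_norm c2.
have b1 := normr_ge0 c1; have b2 := normr_ge0 c2.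
have -> : v - n%:R^-1 * r = n%:R^-1 * (n%:R * v - r) by field; rewrite gt_eqF.
rewrite normrM ger0_norm ?invr_ge0 ?ler0n // mulrC ler_pdivrMr //.
rewrite mulrDr in l1; rewrite mulrBr in l2.
have -> : e * n%:R = n%:R * (e / 2) + n%:R * (e / 2) by field.
move: l1 l2 hc a1 a2 b1 b2; move: (n%:R * v) (n%:R * (e / 2)) `|c1| `|c2| => x y z1 z2.
by move=> *; rewrite ler_norml; apply/andP; split; lra.
Qed.

(** The inner limit is v at every eps in ]0,1[, so the outer limit is that of a constant. *)
Lemma iterlim_rate (f : R -> nat -> \bar R) (v : R) :
  (forall eps, 0 < eps -> eps < 1 -> forall delta, 0 < delta -> exists c n0, forall n, (n0 <= n)%N ->
     (f eps n <= (n%:R * (v + delta) + c)%:E)%E) ->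
  (forall eps, 0 < eps -> eps < 1 -> forall delta, 0 < delta -> exists c n0, forall n, (n0 <= n)%N ->
     ((n%:R * (v - delta) - c)%:E <= f eps n)%E) ->
  iterlim (fun eps n => ((n%:R : R)^-1)%:E * f eps n)%E v%:E.
Proof.
move=> hu hl; exists (fun=> v%:E); split; last exact: cvg_cst.
near=> eps.
have e0 : 0 < eps by near: eps; exact: nbhs_right_gt.
have e1 : eps < 1 by near: eps; exact: nbhs_right_lt.
by apply: cvg_rate => delta d0; [exact: hu|exact: hl].
Unshelve. all: by end_near.
Qed.

End Limit.

Theorem theorem5 (R : realType) (A' B' A B : finType)
    (N : op R (A' * B') -> op R (A * B)) :
  (0 < #|A'|)%N -> (0 < #|B'|)%N -> (0 < #|A|)%N -> (0 < #|B|)%N ->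
  #|A'| = #|A| ->
  is_channel N -> tele_covariant N ->
  let v := ((2^-1)%:E * ((log2 (#|A|%:R : R))%:E - condent_ch N))%E in
  [/\ iterlim (dist_seq N) v,
      iterlim (cost_seq N) v
    & v = (2^-1 * (log2 ((#|A'| * #|A|)%:R : R) - condent_st (choi N)))%:E].
Proof.
move=> a0' b0' a0 _ _ hN hT v.
have vE : v = ((log2 ((#|A'| * #|A|)%:R : R) - condent (choi N)) / 2)%:E.
  rewrite /v condent_chE // oppeK -EFinD -EFinM natrM log2M ?ltr0n //.
  by congr _%:E; move: (condent _) (log2 _) (log2 _) => x y z; field.
rewrite vE; split; last by rewrite condent_stE mulrC.
- apply: iterlim_rate => eps e0 e1 delta d0.
    exact: (dist_tpow_upper hN a0' b0' a0 e0 e1 hT d0).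
  exact: (dist_tpow_lower hN a0' b0' a0 e0 e1 d0).
- apply: iterlim_rate => eps e0 e1 delta d0.
    exact: (cost_tpow_upper hN a0' b0' a0 e0 e1 hT d0).
  exact: (cost_tpow_lower hN a0' b0' a0 e0 e1 d0).
Qed.
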